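(* Under assumptions (A1)-(A3), $$\left|E\,b_{\hat{\mathbf R}}(z)-b_K(z)\right|\le \frac{1}{K^2}\,P_9(|z|)\,P_{12}(|\mathrm{Im}\,z|^{-1}),$$ $$\left|E\,b_{\hat{\mathbf R}}'(z)-b_K'(z)\right|\le \frac{1}{K^2}\,P_{15}(|z|)\,P_{20}(|\mathrm{Im}\,z|^{-1}),$$ for $z\in\mathbb{C}\setminus\mathbb{R}$ and all large $K$. Here $P_m$ denotes a generic deterministic polynomial of degree $m$ whose coefficients are nonnegative and independent of $K$.
   Context: Setting: $K$ independent observations $\mathbf y_1,\dots,\mathbf y_K\in\mathbb{C}^N$ with zero mean and covariance matrix $\mathbf R_N$; $\mathbf Y=\frac1{\sqrt K}[\mathbf y_1,\dots,\mathbf y_K]$. (A1) $\mathbf R_N\in\mathbb{C}^{N\times N}$ is a Hermitian matrix with $L$ ($L$ fixed and known) distinct eigenvalues $\lambda_1<\dots<\lambda_L$ of multiplicities $N_1,\dots,N_L$, $\sum_i N_i=N$; there exist $\lambda_{\min},\lambda_{\max}$ such that $0<\lambda_{\min}<\inf_N\lambda_1\le\sup_N\lambda_L<\lambda_{\max}<\infty$ for all large $N$. (A2) As $N,K\to\infty$, $c_K=N/K\to c\in(0,1)$ and $N_i/K\to c_i\in(0,1)$ for all $1\le i\le L$. (A3) $\mathbf Y=\mathbf R_N^{1/2}\mathbf X$, where $\mathbf X\in\mathbb{C}^{N\times K}$ has i.i.d. complex Gaussian entries of mean zero and variance $1/K$. The sample covariance matrix is $\hat{\mathbf R}_N=\mathbf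 Y\mathbf Y^H$, with eigenvalues $\hat\sigma_1<\dots<\hat\sigma_N$, and $b_{\hat{\mathbf R}}(z)=\frac1N\sum_{i=1}^N\frac{1}{\hat\sigma_i-z}$ is the Stieltjes transform of its empirical spectral distribution. The function $b_K$ is the Stieltjes transform of the deterministic measure $F_K$ to which the empirical spectral distribution of $\hat{\mathbf R}_N$ almost surely converges; for $z\in\mathbb{C}\setminus\mathbb{R}$, $b=b_K(z)$ is the unique solution of $$b=\frac1N\sum_{i=1}^LN_i\frac{1}{\lambda_i(1-c-czb)-z}.$$ Primes denote derivatives in $z$.
   Formalization: In the equation defining b_K, the constant c is taken to be the finite ratio c_K = N/K rather than its limit c; with the limit, the 1/K^2 bound fails when N/K converges slowly (e.g. R = I, N = ⌊K/2⌋+⌊√K⌋). *)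

(* Defs.v *)
From HB Require Import structures.
From mathcomp Require Import all_boot all_order all_algebra.
From mathcomp Require Import spectral sesquilinear.
From mathcomp Require Export complex.
From mathcomp Require Import all_classical all_reals all_analysis.

Set Implicit Arguments.
Unset Strict Implicit.
Unset Printing Implicit Defensive.

Import Order.TTheory GRing.Theory Num.Theory.
Import numFieldNormedType.Exports.
Export Normc.

Local Open Scope classical_set_scope.
Local Open Scope ring_scope.
Local Open Scope complex_scope.
Local Open Scope sesquilinear_scope.

(* Real and imaginary parts are integrated separately; an integrand that is not
   integrable gets a junk value. *)
Definition cintegral (R : realType) (d : measure_display) (T : measurableType d)
    (mu : {measure set T -> \bar R}) (f : T -> R[i]) : R[i] :=
  (\int[mu]_x complex.Re (f x)) +i* (\int[mu]_x complex.Im (f x)).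

Definition stieltjes (R : realType) (F : probability (measurableTypeR R) R)
    (z : R[i]) : R[i] :=
  cintegral F (fun t : measurableTypeR R => ((t : R)%:C - z)^-1).

(* [spectral_diag A] lists the eigenvalues of the normal matrix [A] with their
   multiplicities; their order is irrelevant in the sum. *)
Definition esd_stieltjes (R : realType) (n : nat) (A : 'M[R[i]]_n) (z : R[i]) :
    R[i] :=
  n%:R^-1 * \sum_(i < n) (spectral_diag A 0 i - z)^-1.

(* The positive semidefinite square root of a positive semidefinite Hermitian
   matrix, by functional calculus in an orthonormal eigenbasis. *)
Definition psd_sqrtmx (R : realType) (n : nat) (A : 'M[R[i]]_n) : 'M[R[i]]_n :=
  invmx (spectralmx A) *m diag_mx (map_mx sqrtC (spectral_diag A))
    *m spectralmx A.

Definition sample_cov (R : realType) (n k : nat) (A : 'M[R[i]]_n)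
    (X : 'M[R[i]]_(n, k)) : 'M[R[i]]_n :=
  let Y := psd_sqrtmx A *m X in Y *m Y^t*.

Definition complex_derive (R : realType) (f : R[i] -> R[i]) (z : R[i]) : R[i] :=
  derive1 (f : R[i] -> R[i]^o) z.

(* Since some of the [B i] may be [setT], the product rule over the whole finite
   family contains the product rules over its subfamilies. *)
Definition mutually_independent (R : realType) (d : measure_display)
    (T : measurableType d) (P : probability T R) (I : finType)
    (f : I -> T -> R) : Prop :=
  forall B : I -> set R, (forall i, measurable (B i)) ->
    P (\bigcap_i (f i @^-1` B i)) = (\prod_i P (f i @^-1` B i))%E.

(* Circularly symmetric complex Gaussian entries of variance [v]: all the real
   and imaginary parts of the entries are independent N(0, v / 2) variables.
   The second parameter of [normal_prob] is the standard deviation. *)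
Definition iid_complex_gaussian (R : realType) (d : measure_display)
    (T : measurableType d) (P : probability T R) (n k : nat)
    (X : T -> 'M[R[i]]_(n, k)) (v : R) : Prop :=
  let part (e : 'I_n * 'I_k * bool) (w : T) : R :=
    if e.2 then complex.Im (X w e.1.1 e.1.2)
    else complex.Re (X w e.1.1 e.1.2) in
  [/\ forall e, measurable_fun setT (part e),
      forall e (B : set R), measurable B ->
        P (part e @^-1` B) = normal_prob 0 (Num.sqrt (v / 2)) B
    & mutually_independent P part].

(* Because the multiplicities add up to [n], a Hermitian [A] has no eigenvalue
   besides the [lam i]. *)
Definition has_spectrum (R : realType) (L n : nat) (A : 'M[R[i]]_n)
    (lam : 'I_L -> R) (mult : 'I_L -> nat) : Prop :=
  [/\ A \is hermsymmx,
      forall i j : 'I_L, (i < j)%N -> lam i < lam j,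
      forall i, eigenvalue A (lam i)%:C,
      forall i, \rank (eigenspace A (lam i)%:C) = mult i
    & (\sum_(i < L) mult i)%N = n].

Definition assumption_A1 (R : realType) (L : nat) (N : nat -> nat)
    (RN : forall K, 'M[R[i]]_(N K)) (lam : nat -> 'I_L -> R)
    (mult : nat -> 'I_L -> nat) : Prop :=
  (\forall K \near \oo, has_spectrum (RN K) (lam K) (mult K)) /\
  (exists lmin lmax : R, 0 < lmin /\
    \forall K \near \oo, forall i, lmin < lam K i < lmax).

Definition assumption_A2 (R : realType) (L : nat) (N : nat -> nat)
    (mult : nat -> 'I_L -> nat) : Prop :=
  (exists c : R, 0 < c < 1 /\
    ((N K)%:R / K%:R : R) @[K --> \oo] --> c) /\
  (forall i, exists ci : R, 0 < ci < 1 /\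
    ((mult K i)%:R / K%:R : R) @[K --> \oo] --> ci).

Definition assumption_A3 (R : realType) (d : measure_display)
    (T : measurableType d) (P : probability T R) (N : nat -> nat)
    (X : forall K, T -> 'M[R[i]]_(N K, K)) : Prop :=
  forall K, iid_complex_gaussian P (X K) K%:R^-1.

(* The equation has several complex roots for given [z]; [stieltjes F] is the
   only family of roots that is the Stieltjes transform of a probability
   measure. The constant in the equation is the ratio at rank K, not its
   limit. *)
Definition is_deterministic_equivalent (R : realType) (L n K : nat)
    (lam : 'I_L -> R) (mult : 'I_L -> nat)
    (F : probability (measurableTypeR R) R) : Prop :=
  let c : R[i] := n%:R / K%:R in
  forall z : R[i], complex.Im z != 0 ->
    let b := stieltjes F z in
    b = n%:R^-1 * \sum_(i < L)
          (mult i)%:R * ((lam i)%:C * (1 - c - c * z * b) - z)^-1.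

Definition nonneg_poly (R : realType) (m : nat) (p : {poly R}) : Prop :=
  size p = m.+1 /\ forall i, 0 <= p`_i.

(* Main.v *)
Require Import Defs.
From mathcomp Require Import all_boot all_order all_algebra.
From mathcomp Require Import perm spectral sesquilinear.
From mathcomp Require Import all_classical all_reals all_analysis.
From mathcomp Require Import measurable_realfun ring lra.

(* Let [Q] be the resolvent of the sample covariance matrix at [z], [q] its
   trace divided by [K], and [g = E q]. Gaussian integration by parts gives
   [1 + z E Q = R E ((1 - c - z q) Q)]; replacing [q] by [g] turns this into
   the fixed point equation for [c b_K] up to an error
   [eps = z E ((q - g) tr (D Q) / K)], with [D] deterministic and bounded. The
   covariance in [eps] is at most the sum of the two variances, and these are
   O(K^-2) by the Poincare inequality, whose dimension-free form follows from
   Efron-Stein and the one-dimensional case.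

   Stability of the fixed point equation: for a solution [f], the imaginary
   parts of [f] and of [z f] satisfy two linear relations, which force
   [|z| v1 < 1] with an explicit gap, where [v1] is [1 / K] times the sum of
   [lam / |(1 - c - z f) lam - z|^2] over the eigenvalues. When [eps] is small,
   [g] still satisfies [|z| v1 <= 1], so the map contracts between the two
   points; otherwise the trivial bound [|g - f| <= 2 / |Im z|] suffices.

   The derivatives are compared by a discrete version of Cauchy's formula on the
   circle of radius [|Im z| / 2] around [z]. *)

Set Implicit Arguments.
Unset Strict Implicit.
Unset Printing Implicit Defensive.
Import Order.TTheory GRing.Theory Num.Theory.
Import numFieldNormedType.Exports.
Import Normc.

Local Open Scope ring_scope.
Local Open Scope sesquilinear_scope.

(** * Matrix identities and Frobenius bounds *)

(** Two obstacles shape the argument. [spectral_diag] is obtained by choice, so it says nothing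
    about how eigenvalues depend on the matrix; the random transforms are therefore rewritten as
    traces of resolvents, whose entries are rational functions of the Gaussian coordinates by
    Cramer's rule. That gives measurability and smoothness. Moreover the data matrix [Y] is
    unbounded, and products are regrouped until [Y] stands next to a resolvent: [Q Y], [Y^* Q] and
    [Y^* Q Y] are bounded, so almost all integrands are bounded functions.

    On the deterministic side, the measure behind [b_K] is only known to be a probability on the
    whole line. The sign of [Im b_K] is available but that of [Im (z b_K)] is not, and the stability
    argument has to treat the exact solution under weaker assumptions than the expected trace [g].

    The bounds obtained are multiples of [(1 + |z|)^5 (1 + 1 / |Im z|)^10] and, for the derivatives,
    of [(1 + |z|)^5 (1 + 1 / |Im z|)^11]; raising the exponents gives the degrees of the
    statement. *)

Section adjoint.
Context {C : numClosedFieldType}.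

Lemma adjE m n (A : 'M[C]_(m, n)) i j : A^t* i j = Num.conj (A j i).
Proof. by rewrite !mxE. Qed.

Lemma adjM m n p (A : 'M[C]_(m, n)) (B : 'M[C]_(n, p)) : (A *m B)^t* = B^t* *m A^t*.
Proof. by rewrite trmx_mul map_mxM. Qed.

Lemma adjZ m n a (A : 'M[C]_(m, n)) : (a *: A)^t* = Num.conj a *: A^t*.
Proof. by apply/matrixP => i j; rewrite !mxE rmorphM. Qed.

Lemma adj_delta m n (i : 'I_m) (j : 'I_n) : (delta_mx i j : 'M[C]_(m, n)) ^t* = delta_mx j i.
Proof. by apply/matrixP => k l; rewrite !mxE andbC; case: (_ && _); rewrite ?rmorph0 ?rmorph1. Qed.

Lemma mul_adj_unitary n (U : 'M[C]_n) : U \is unitarymx -> U *m U^t* = 1%:M.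
Proof. by move=> /unitarymxP. Qed.

Lemma adj_unitary n (U : 'M[C]_n) : U \is unitarymx -> U^t* *m U = 1%:M.
Proof. by move=> /unitarymxP /mulmx1C. Qed.

End adjoint.

Section frobenius.
Context {C : numClosedFieldType}.

(** The squared Frobenius norm, kept in [C] so that it can be compared with traces. Operator norms
    enter only through their effect on [F2]: a bound [m] on the squared norm of [M] is the
    inequality [F2 (A *m M) <= m * F2 A] for all [A]. *)
Definition F2 m n (A : 'M[C]_(m, n)) : C := \sum_i \sum_j `|A i j| ^+ 2.

Lemma F2_ge_coef m n (A : 'M[C]_(m, n)) i j : `|A i j| ^+ 2 <= F2 A.
Proof.
rewrite /F2 (bigD1 i)//= (bigD1 j)//= -addrA lerDl addr_ge0//.
  by apply: sumr_ge0 => *; exact: exprn_ge0.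
by apply: sumr_ge0 => *; apply: sumr_ge0 => *; exact: exprn_ge0.
Qed.

Lemma F2_tr m n (A : 'M[C]_(m, n)) : F2 A = \tr (A *m A^t* ).
Proof.
rewrite /F2 /mxtrace; apply: eq_bigr => i _; rewrite mxE.
by apply: eq_bigr => j _; rewrite adjE normCK.
Qed.

Lemma F2_adj m n (A : 'M[C]_(m, n)) : F2 (A^t* ) = F2 A.
Proof.
rewrite /F2 exchange_big /=; apply: eq_bigr => i _; apply: eq_bigr => j _.
by rewrite adjE norm_conjC.
Qed.

Lemma F2_diag_l m n (e : 'rV[C]_m) (A : 'M[C]_(m, n)) (c : C) :
  (forall i, `|e 0 i| ^+ 2 <= c) -> F2 (diag_mx e *m A) <= c * F2 A.
Proof.
move=> ec; rewrite /F2 mulr_sumr; apply: ler_sum => i _.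
rewrite mulr_sumr; apply: ler_sum => j _.
by rewrite mul_diag_mx mxE normrM exprMn ler_wpM2r ?exprn_ge0.
Qed.

Lemma F2_unitary_l n p (U : 'M[C]_n) (A : 'M[C]_(n, p)) : U \is unitarymx -> F2 (U *m A) = F2 A.
Proof.
move=> uU; rewrite !F2_tr adjM mxtrace_mulC.
by rewrite -!mulmxA (mulmxA _ U) adj_unitary// mul1mx mxtrace_mulC.
Qed.

Lemma F2_adj_unitary_l n p (U : 'M[C]_n) (A : 'M[C]_(n, p)) : U \is unitarymx -> F2 (U^t* *m A) = F2 A.
Proof. by move=> uU; apply: F2_unitary_l; rewrite trmxC_unitary. Qed.

End frobenius.

(* Functional calculus in the orthonormal basis formed by the rows of [U]. *)
Section functional_calculus.
Context {C : numClosedFieldType} (n : nat).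
Variable U : 'M[C]_n.
Hypothesis uU : U \is unitarymx.
Implicit Types g h : 'I_n -> C.

Definition fcalc g : 'M[C]_n := U^t* *m diag_mx (\row_i g i) *m U.

Lemma eq_fcalc g h : g =1 h -> fcalc g = fcalc h.
Proof.
move=> gh; rewrite /fcalc; suff -> : \row_i g i = \row_i h i :> 'rV[C]_n by [].
by apply/rowP => i; rewrite !mxE gh.
Qed.

Lemma fcalcM g h : fcalc g *m fcalc h = fcalc (fun i => g i * h i).
Proof.
rewrite /fcalc !mulmxA -(mulmxA _ U) mul_adj_unitary// mulmx1 -(mulmxA _ (diag_mx _) (diag_mx _)).
rewrite mulmx_diag; suff -> : \row_i ((\row_i g i) 0 i * (\row_i h i) 0 i) = \row_i (g i * h i) :> 'rV[C]_n by [].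
by apply/rowP => i; rewrite !mxE.
Qed.

Lemma fcalcC g h : fcalc g *m fcalc h = fcalc h *m fcalc g.
Proof. by rewrite !fcalcM; apply: eq_fcalc => i; rewrite mulrC. Qed.

Lemma fcalcD g h : fcalc g + fcalc h = fcalc (fun i => g i + h i).
Proof.
rewrite /fcalc -mulmxDl -mulmxDr -raddfD.
suff -> : (\row_i g i) + (\row_i h i) = \row_i (g i + h i) :> 'rV[C]_n by [].
by apply/rowP => i; rewrite !mxE.
Qed.

Lemma fcalcZ a g : a *: fcalc g = fcalc (fun i => a * g i).
Proof.
rewrite /fcalc scalemxAl scalemxAr -linearZ /=.
suff -> : a *: (\row_i g i) = \row_i (a * g i) :> 'rV[C]_n by [].
by apply/rowP => i; rewrite !mxE.
Qed.

Lemma fcalc_cst a : fcalc (fun=> a) = a%:M.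
Proof.
rewrite /fcalc (_ : diag_mx _ = a%:M); last first.
  by rewrite -diag_const_mx; congr diag_mx; apply/rowP => i; rewrite !mxE.
by rewrite mul_mx_scalar -scalemxAl adj_unitary// scalemx1.
Qed.

Lemma fcalcB g a : fcalc g - a%:M = fcalc (fun i => g i - a).
Proof.
rewrite -fcalc_cst -[- _]scaleN1r fcalcZ fcalcD.
by apply: eq_fcalc => i; rewrite mulN1r.
Qed.

Lemma fcalc_mulV g : (forall i, g i != 0) -> fcalc g *m fcalc (fun i => (g i)^-1) = 1%:M.
Proof. by move=> g0; rewrite fcalcM -fcalc_cst; apply: eq_fcalc => i; rewrite divff. Qed.

Lemma fcalc_unit g : (forall i, g i != 0) -> fcalc g \in unitmx.
Proof. by move=> /fcalc_mulV /mulmx1_unit[]. Qed.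

Lemma fcalcV g : (forall i, g i != 0) -> invmx (fcalc g) = fcalc (fun i => (g i)^-1).
Proof.
move=> g0; have uG := fcalc_unit g0.
by rewrite -[RHS](mulKmx uG) fcalc_mulV// mulmx1.
Qed.

Lemma fcalc_adj g : (fcalc g)^t* = fcalc (fun i => Num.conj (g i)).
Proof.
rewrite /fcalc !adjM trmxCK mulmxA tr_diag_mx map_diag_mx.
suff -> : map_mx Num.conj (\row_i g i) = \row_i (Num.conj (g i)) by [].
by apply/rowP => i; rewrite !mxE.
Qed.

Lemma fcalc_tr g : \tr (fcalc g) = \sum_i g i.
Proof.
rewrite /fcalc mxtrace_mulC mulmxA mul_adj_unitary// mul1mx mxtrace_diag.
by apply: eq_bigr => i _; rewrite mxE.
Qed.

Lemma F2_fcalc_l p g (c : C) (B : 'M[C]_(n, p)) : (forall i, `|g i| ^+ 2 <= c) ->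
  F2 (fcalc g *m B) <= c * F2 B.
Proof.
move=> gc; rewrite /fcalc -!mulmxA F2_adj_unitary_l//.
by rewrite -(F2_unitary_l B uU); apply: F2_diag_l => i; rewrite mxE.
Qed.

Lemma F2_fcalc_r p g (c : C) (B : 'M[C]_(p, n)) : (forall i, `|g i| ^+ 2 <= c) ->
  F2 (B *m fcalc g) <= c * F2 B.
Proof.
move=> gc; rewrite -F2_adj adjM fcalc_adj -(F2_adj B); apply: F2_fcalc_l => i.
by rewrite norm_conjC.
Qed.

Lemma F2_fcalc g : F2 (fcalc g) = \sum_i `|g i| ^+ 2.
Proof.
rewrite F2_tr fcalc_adj fcalcM fcalc_tr.
by apply: eq_bigr => i _; rewrite normCK.
Qed.

End functional_calculus.

Section spectral_theorem.
Context {C : numClosedFieldType}.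

Lemma herm_fcalc n (A : 'M[C]_n) : A \is hermsymmx ->
  A = fcalc (spectralmx A) (fun i => spectral_diag A 0 i).
Proof.
move=> hA; have /hermitian_normalmx/orthomx_spectralP {1}-> := hA.
rewrite invmx_unitary ?spectral_unitarymx// /fcalc.
suff -> : \row_i spectral_diag A 0 i = spectral_diag A by [].
by apply/rowP => i; rewrite mxE.
Qed.

Lemma gram_herm n k (Y : 'M[C]_(n, k)) : Y *m Y^t* \is hermsymmx.
Proof. by rewrite qualifE /= expr0 scale1r adjM trmxCK. Qed.

(** The eigenvalue is a diagonal entry of the Gram matrix of [U Y], hence a sum of squared
    moduli. *)
Lemma spectral_gram_ge0 n k (Y : 'M[C]_(n, k)) i : 0 <= spectral_diag (Y *m Y^t* ) 0 i.
Proof.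
set A := Y *m Y^t*; have hA : A \is hermsymmx by exact: gram_herm.
set U := spectralmx A; have uU : U \is unitarymx by exact: spectral_unitarymx.
have : U *m A *m U^t* = diag_mx (\row_i (spectral_diag A 0 i)).
  rewrite {1}(herm_fcalc hA) /fcalc !mulmxA mul_adj_unitary// mul1mx.
  by rewrite -mulmxA mul_adj_unitary// mulmx1.
move=> /matrixP /(_ i i); rewrite [in RHS]mxE [in RHS]mxE eqxx mulr1n => <-.
rewrite (_ : U *m A *m U^t* = U *m Y *m (U *m Y)^t* ); last by rewrite adjM !mulmxA.
by rewrite mxE; apply: sumr_ge0 => j _; rewrite adjE -normCK exprn_ge0.
Qed.

End spectral_theorem.

(** * Sums over the real coordinate directions of a complex matrix *)

Section matrix_units.
Context {C : numClosedFieldType}.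

Lemma delta_mul_delta m n p q (A : 'M[C]_(n, p)) (i : 'I_m) (j : 'I_n) (k : 'I_p) (l : 'I_q) :
  delta_mx i j *m A *m delta_mx k l = A j k *: delta_mx i l.
Proof.
(* Each matrix unit factors through dimension 1, which leaves the 1 by 1 block [A j k] in the
   middle. *)
rewrite -(mul_delta_mx (0 : 'I_1) i j) -(mul_delta_mx (0 : 'I_1) k l).
rewrite -!mulmxA (mulmxA _ A) (mulmxA (_ *m A)) -rowE -colE.
rewrite [col k _]mx11_scalar mul_scalar_mx !mxE -scalemxAr.
by rewrite mul_delta_mx.
Qed.

Lemma mxtrace_mul_delta m n (G : 'M[C]_(n, m)) (i : 'I_m) (j : 'I_n) :
  \tr (G *m delta_mx i j) = G j i.
Proof.
rewrite -(mul_delta_mx (0 : 'I_1) i j) mulmxA mxtrace_mulC mulmxA -rowE -colE.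
by rewrite trace_mx11 !mxE.
Qed.

Lemma sum_delta_diag n : \sum_(i < n) (delta_mx i i : 'M[C]_n) = 1%:M.
Proof.
apply/matrixP => a b; rewrite summxE !mxE (bigD1 a)//= big1 ?addr0.
  by rewrite mxE eqxx eq_sym.
by move=> i ia; rewrite mxE eq_sym (negbTE ia).
Qed.

(* The direction in which a matrix moves when the real part ([e.2 = false]) or
   the imaginary part ([e.2 = true]) of its entry [e.1] varies. *)
Definition entry_dir n k (e : 'I_n * 'I_k * bool) : 'M[C]_(n, k) :=
  (if e.2 then 'i else 1) *: delta_mx e.1.1 e.1.2.

Lemma sum_entries (W : nmodType) n k (f : 'I_n * 'I_k * bool -> W) :
  \sum_e f e = \sum_i \sum_j (f (i, j, true) + f (i, j, false)).
Proof.
rewrite (eq_bigr (fun e => f (e.1, e.2))); last by case.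
rewrite -(pair_bigA _ (fun p b => f (p, b))) /=.
rewrite (eq_bigr (fun p => f (p.1, p.2, true) + f (p.1, p.2, false))); last first.
  by case=> i j _; rewrite big_bool.
by rewrite -(pair_bigA _ (fun i j => f (i, j, true) + f (i, j, false))).
Qed.

Lemma sum_entry_dir n k (f : 'I_n * 'I_k * bool -> C) :
  \sum_e f e *: entry_dir e = \matrix_(i, j) (f (i, j, false) + 'i * f (i, j, true)).
Proof.
apply/matrixP => i j; rewrite mxE summxE (sum_entries (fun e => (f e *: entry_dir e) i j)).
rewrite (bigD1 i)//= (bigD1 j)//= big1 ?addr0; last first.
  by move=> l /negbTE lj; rewrite /entry_dir !mxE /= (eq_sym j) lj andbF !mulr0 addr0.
rewrite big1 ?addr0; last first.
  move=> l /negbTE li; apply: big1 => p _.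
  by rewrite /entry_dir !mxE /= (eq_sym i) li !mulr0 addr0.
by rewrite /entry_dir !mxE !eqxx /= !mulr1 addrC mulrC.
Qed.

(** The real and the imaginary direction of each entry cancel because ['i ^+ 2 = -1]. This is the
    algebraic trace of [E X^2 = 0] for a circularly symmetric variable. *)
Lemma sum_entry_dir_holo n k (A : 'M[C]_(k, n)) :
  \sum_e entry_dir e *m A *m entry_dir e = 0.
Proof.
rewrite sum_entries big1// => i _; rewrite big1// => j _; rewrite /entry_dir /=.
by rewrite -!scalemxAl -!scalemxAr !scalerA -expr2 sqrCi mulr1 scale1r scaleN1r addNr.
Qed.

(** With an adjoint the two directions of an entry reinforce each other, since ['i] times its
    conjugate is 1; hence the factor 2. *)
Lemma sum_entry_dir_mixed n k (A : 'M[C]_k) :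
  \sum_(e : 'I_n * 'I_k * bool) entry_dir e *m A *m (entry_dir e)^t* = (2 * \tr A)%:M.
Proof.
rewrite sum_entries -scalemx1 -sum_delta_diag scaler_sumr; apply: eq_bigr => i _.
rewrite /mxtrace mulr_sumr scaler_suml; apply: eq_bigr => j _; rewrite /entry_dir /=.
rewrite !adjZ adj_delta -!scalemxAl -!scalemxAr !scalerA delta_mul_delta.
by rewrite -normCK normCi expr1n conjC1 mulr1 scale1r -mulr2n -scaler_nat scalerA.
Qed.

(** The left side is the squared gradient of a function with differential [tr (G D) + tr (D^* W)].
    For one entry the two directions give [a + b] and ['i (a - b)], with [a] and [b] the matching
    entries of [G] and [W], and the parallelogram identity applies. *)
Lemma sum_entry_dir_grad n k (G : 'M[C]_(k, n)) (W : 'M[C]_(n, k)) :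
  \sum_e `|\tr (G *m entry_dir e) + \tr ((entry_dir e)^t* *m W)| ^+ 2 = 2 * (F2 G + F2 W).
Proof.
have -> : F2 G = \sum_i \sum_j `|G j i| ^+ 2 by rewrite /F2 exchange_big.
rewrite sum_entries /F2 -big_split /= mulr_sumr; apply: eq_bigr => i _.
rewrite -big_split /= mulr_sumr; apply: eq_bigr => j _; rewrite /entry_dir /=.
rewrite !adjZ !adj_delta -!scalemxAr -!scalemxAl !mxtraceZ (mxtrace_mulC _ W) !mxtrace_mul_delta.
rewrite conjCi conjC1 !mul1r mulNr -mulrBr normrM normCi mul1r.
rewrite !normCK rmorphB rmorphD /=; ring.
Qed.

(** Up to sign, the left side is the differential of [tr (Q M)] in the direction [D]; cyclicity of
    the trace separates its linear part in [D] from its antilinear part. *)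
Lemma tr_resolvent_grad n k (Q M S : 'M[C]_n) (Y D : 'M[C]_(n, k)) : S^t* = S ->
  \tr (Q *m (S *m D *m Y^t* + Y *m (S *m D)^t* ) *m Q *m M) =
  \tr (Y^t* *m (Q *m M *m Q) *m S *m D) + \tr (D^t* *m (S *m (Q *m M *m Q) *m Y)).
Proof.
move=> hS; rewrite mulmxDr !mulmxDl mxtraceD adjM hS; congr (_ + _).
  rewrite (_ : _ *m M = (Q *m S *m D) *m (Y^t* *m Q *m M)); last by rewrite !mulmxA.
  by rewrite mxtrace_mulC !mulmxA.
rewrite (_ : _ *m M = (Q *m Y) *m (D^t* *m S *m Q *m M)); last by rewrite !mulmxA.
by rewrite mxtrace_mulC !mulmxA.
Qed.

Lemma resolvent_gradE n k (Q : 'M[C]_n) (Y B : 'M[C]_(n, k)) :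
  Q *m (B *m Y^t* + Y *m B^t* ) *m Q = Q *m B *m (Y^t* *m Q) + (Q *m Y) *m B^t* *m Q.
Proof. by rewrite mulmxDr mulmxDl !mulmxA. Qed.

Lemma data_resolvent_gradE n k (Q : 'M[C]_n) (Y B : 'M[C]_(n, k)) :
  Y^t* *m (Q *m (B *m Y^t* + Y *m B^t* ) *m Q) =
  (Y^t* *m Q) *m B *m (Y^t* *m Q) + (Y^t* *m Q *m Y) *m B^t* *m Q.
Proof. by rewrite resolvent_gradE mulmxDr !mulmxA. Qed.

(** Three terms arise. Varying [Y^*] gives the trace [k] of the identity; varying [Q] through [Y]
    gives a holomorphic sum, which vanishes; varying [Q] through [Y^*] gives the trace of
    [Y^* Q Y]. *)
Lemma sum_resolvent_ibp n k (Q S : 'M[C]_n) (Y : 'M[C]_(n, k)) : S^t* = S ->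
  \sum_(e : 'I_n * 'I_k * bool) (S *m entry_dir e) *m ((S *m entry_dir e)^t* *m Q -
     Y^t* *m (Q *m (S *m entry_dir e *m Y^t* + Y *m (S *m entry_dir e)^t* ) *m Q)) =
  (2 * k%:R - 2 * \tr (Y^t* *m Q *m Y)) *: (S *m S *m Q).
Proof.
move=> hS.
transitivity (S *m (\sum_(e : 'I_n * 'I_k * bool) entry_dir e *m 1%:M *m (entry_dir e)^t* ) *m S *m Q
  - S *m (\sum_(e : 'I_n * 'I_k * bool) entry_dir e *m (Y^t* *m Q *m S) *m entry_dir e) *m (Y^t* *m Q)
  - S *m (\sum_(e : 'I_n * 'I_k * bool) entry_dir e *m (Y^t* *m Q *m Y) *m (entry_dir e)^t* ) *m S *m Q).
  rewrite !mulmx_sumr !mulmx_suml -!sumrB; apply: eq_bigr => e _.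
  by rewrite adjM hS mulmxBr mulmx1 !mulmxDr !mulmxDl !mulmxDr opprD addrA !mulmxA.
rewrite sum_entry_dir_holo mulmx0 mul0mx subr0 !sum_entry_dir_mixed mxtrace1.
by rewrite !mul_mx_scalar -!scalemxAl scalerBl.
Qed.

End matrix_units.

(** * Resolvents of Gram matrices, with bounds independent of the data *)

Section resolvent.
Context {C : numClosedFieldType}.

Definition resolvent n (H : 'M[C]_n) (z : C) : 'M[C]_n := invmx (H - z%:M).

Variables (n k : nat) (Y : 'M[C]_(n, k)) (z b w w2 : C).
Hypothesis z_pos : forall r, 0 <= r -> r - z != 0.
Hypothesis hb : forall r, 0 <= r -> `|(r - z)^-1| ^+ 2 <= b.
Hypothesis hw : forall r, 0 <= r -> r * `|(r - z)^-1| ^+ 2 <= w.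
Hypothesis hw2 : forall r, 0 <= r -> r ^+ 2 * `|(r - z)^-1| ^+ 2 <= w2.
Let H := Y *m Y^t*.
Let U := spectralmx H.
Let uU : U \is unitarymx. Proof. exact: spectral_unitarymx. Qed.
Let sg i : C := spectral_diag H 0 i.
Let sg_ge0 i : 0 <= sg i. Proof. exact: spectral_gram_ge0. Qed.
Let sg_neq0 i : sg i - z != 0. Proof. exact: z_pos. Qed.
Let gram_fcalc : H = fcalc U sg. Proof. exact: herm_fcalc (gram_herm Y). Qed.

Lemma gram_shift_unit : H - z%:M \in unitmx.
Proof. by rewrite {1}gram_fcalc fcalcB//; apply: fcalc_unit. Qed.

Lemma resolvent_fcalc : resolvent H z = fcalc U (fun i => (sg i - z)^-1).
Proof. by rewrite /resolvent {1}gram_fcalc fcalcB// fcalcV. Qed.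

Lemma mul_resolvent : H *m resolvent H z = 1%:M + z *: resolvent H z.
Proof.
have := mulmxV gram_shift_unit; rewrite -/(resolvent H z) mulmxBl mul_scalar_mx.
by move=> <-; rewrite subrK.
Qed.

Lemma tr_data_resolvent_data : \tr (Y^t* *m resolvent H z *m Y) = n%:R + z * \tr (resolvent H z).
Proof. by rewrite mxtrace_mulC mulmxA -/H mul_resolvent mxtraceD mxtrace1 mxtraceZ. Qed.

Lemma tr_resolvent : \tr (resolvent H z) = \sum_i (sg i - z)^-1.
Proof. by rewrite resolvent_fcalc fcalc_tr. Qed.

Lemma F2_resolvent_l p (B : 'M[C]_(n, p)) : F2 (resolvent H z *m B) <= b * F2 B.
Proof. by rewrite resolvent_fcalc; apply: F2_fcalc_l => // i; exact: hb. Qed.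

Lemma F2_resolvent_r p (B : 'M[C]_(p, n)) : F2 (B *m resolvent H z) <= b * F2 B.
Proof. by rewrite resolvent_fcalc; apply: F2_fcalc_r => // i; exact: hb. Qed.

Let sum_le (f : 'I_n -> C) (c : C) : (forall i, f i <= c) -> \sum_i f i <= n%:R * c.
Proof.
move=> fc; rewrite mulr_natl -[X in _ *+ X]card_ord -sumr_const.
by apply: ler_sum => i _.
Qed.

Lemma F2_resolvent : F2 (resolvent H z) <= n%:R * b.
Proof. by rewrite resolvent_fcalc F2_fcalc//; apply: sum_le => i; exact: hb. Qed.

(** [Q Y] is bounded although [Y] is not: its squared norm is the trace of [Q H Q^*], a spectral sum
    of the quantities [r |r - z|^-2] that [hw] controls. *)
Lemma F2_resolvent_data : F2 (resolvent H z *m Y) <= n%:R * w.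
Proof.
rewrite F2_tr adjM mulmxA -(mulmxA _ Y) -/H resolvent_fcalc {1}gram_fcalc fcalc_adj// !fcalcM//.
rewrite fcalc_tr//; apply: sum_le => i.
by rewrite mulrAC -normCK mulrC; exact: hw.
Qed.

Lemma F2_data_resolvent : F2 (Y^t* *m resolvent H z) <= n%:R * w.
Proof.
rewrite -F2_adj adjM trmxCK F2_tr adjM trmxCK mulmxA -(mulmxA _ Y) -/H.
rewrite resolvent_fcalc {1}gram_fcalc fcalc_adj// !fcalcM//.
rewrite fcalc_tr//; apply: sum_le => i.
by rewrite mulrAC mulrC (mulrC _ (sg i - z)^-1) -normCK; exact: hw.
Qed.

Lemma F2_data_resolvent_data : F2 (Y^t* *m resolvent H z *m Y) <= n%:R * w2.
Proof.
rewrite F2_tr !adjM trmxCK -!mulmxA mxtrace_mulC -!mulmxA -/H (mulmxA Y) -/H.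
rewrite resolvent_fcalc {1 2}gram_fcalc fcalc_adj// !fcalcM//.
rewrite fcalc_tr//; apply: sum_le => i.
by have := hw2 (sg_ge0 i); rewrite normCK; congr (_ <= _); ring.
Qed.

(* The hypotheses say that the squared operator norms of [M] and [S] are at most
   [m] and [l]. *)
Lemma F2_grad_le (M S : 'M[C]_n) (m l : C) : 0 <= b -> 0 <= m -> 0 <= l ->
  (forall p (B : 'M[C]_(p, n)), F2 (B *m M) <= m * F2 B) ->
  (forall p (B : 'M[C]_(n, p)), F2 (M *m B) <= m * F2 B) ->
  (forall p (B : 'M[C]_(p, n)), F2 (B *m S) <= l * F2 B) ->
  (forall p (B : 'M[C]_(n, p)), F2 (S *m B) <= l * F2 B) ->
  F2 (Y^t* *m (resolvent H z *m M *m resolvent H z) *m S) +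
  F2 (S *m (resolvent H z *m M *m resolvent H z) *m Y) <= 2 * (l * (b * (m * (n%:R * w)))).
Proof.
move=> b0 m0 l0 Mr Ml Sr Sl; rewrite mulr2n mulrDl !mul1r; apply: lerD.
  apply: le_trans (Sr _ _) _; apply: ler_wpM2l => //; rewrite !mulmxA.
  apply: le_trans (F2_resolvent_r _) _; apply: ler_wpM2l => //.
  apply: le_trans (Mr _ _) _; apply: ler_wpM2l => //.
  exact: F2_data_resolvent.
rewrite -!mulmxA; apply: le_trans (Sl _ _) _; apply: ler_wpM2l => //.
apply: le_trans (F2_resolvent_l _) _; apply: ler_wpM2l => //.
apply: le_trans (Ml _ _) _; apply: ler_wpM2l => //.
exact: F2_resolvent_data.
Qed.

End resolvent.

(** * One-dimensional Gaussian measure *)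

Local Open Scope classical_set_scope.
Local Open Scope ring_scope.
Local Close Scope sesquilinear_scope.

Section gaussian_line.
Context {R : realType}.
Implicit Types (s : R).
Notation mu := (@lebesgue_measure R).

Lemma ge0_integral_normal_prob s (f : R -> \bar R) :
  measurable_fun [set: measurableTypeR R] f -> (forall x, 0 <= f x)%E ->
  (\int[normal_prob 0 s]_x f x = \int[mu]_x (f x * (normal_pdf 0 s x)%:E))%E.
Proof.
move=> mf f0.
have dom := normal_prob_dominates 0 s.
rewrite -(Radon_Nikodym_SigmaFinite.change_of_variables dom)//.
have ir := Radon_Nikodym_SigmaFinite.f_integrable dom.
have mp : measurable_fun setT (fun x : measurableTypeR R => (normal_pdf 0 s x)%:E).
  by apply/measurable_EFinP; exact: measurable_normal_pdf.
apply: ae_eq_integral => //.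
- by apply: emeasurable_funM => //; exact: (measurable_int _ ir).
- exact: emeasurable_funM.
(* The Radon-Nikodym derivative is accessible only through its integrals over measurable sets, which
   determine it almost everywhere. *)
- apply: ae_eqe_mul2l => /=; apply: integral_ae_eq => //= E _ mE.
  by rewrite -Radon_Nikodym_SigmaFinite.f_integral.
Qed.

Lemma integrable_normal_prob s (f : R -> R) :
  measurable_fun [set: measurableTypeR R] f ->
  mu.-integrable setT (EFin \o (fun x => f x * normal_pdf 0 s x)) ->
  (normal_prob 0 s).-integrable setT (EFin \o f).
Proof.
move=> mf /integrableP[_ fi]; apply/integrableP; split; first exact/measurable_EFinP.
rewrite ge0_integral_normal_prob//; last first.
  by apply: measurableT_comp => //; exact/measurable_EFinP.
apply: le_lt_trans fi; rewrite le_eqVlt; apply/orP; left; apply/eqP.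
apply: eq_integral => x _ /=.
by rewrite -EFinM normrM (ger0_norm (normal_pdf_ge0 _ _ _)).
Qed.

Lemma Rintegral_normal_prob s (f : R -> R) :
  (normal_prob 0 s).-integrable [set: measurableTypeR R] (EFin \o f) ->
  \int[normal_prob 0 s]_x f x = \int[mu]_x (f x * normal_pdf 0 s x).
Proof.
move=> fi; rewrite /Rintegral.
have dom := normal_prob_dominates 0 s.
rewrite -(Radon_Nikodym_change_of_variables dom)//=; congr fine.
have mp : measurable_fun setT (fun x : measurableTypeR R => (normal_pdf 0 s x)%:E).
  by apply/measurable_EFinP; exact: measurable_normal_pdf.
have mf := measurable_int _ fi.
apply: ae_eq_integral => //.
- by apply: emeasurable_funM => //; apply: (measurable_int mu); apply: Radon_Nikodym_integrable; exact: dom.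
- under eq_fun do rewrite EFinM; exact: emeasurable_funM.
- under [X in ae_eq _ _ _ X]eq_fun do rewrite EFinM.
  apply: ae_eqe_mul2l => /=; apply: integral_ae_eq => //=.
  + by apply: Radon_Nikodym_integrable; exact: dom.
  + by move=> E _ mE; rewrite -Radon_Nikodym_integral.
Qed.

Lemma bounded_integrable (d : measure_display) (T : measurableType d)
    (P : probability T R) (f : T -> R) (M : R) :
  measurable_fun setT f -> (forall x, `|f x| <= M) ->
  P.-integrable setT (EFin \o f).
Proof.
move=> mf fM.
apply: (@le_integrable _ _ _ _ _ measurableT _ (EFin \o cst M)) => //.
- exact/measurable_EFinP.
- move=> x _ /=; rewrite lee_fin; apply: le_trans (fM x) _; exact: ler_norm.
- exact: finite_measure_integrable_cst.
Qed.

Lemma Rintegral_cst_prob (d : measure_display) (T : measurableType d)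
    (P : probability T R) (r : R) : \int[P]_x r = r.
Proof. by rewrite /Rintegral integral_cst//= probability_setT mule1. Qed.

Lemma integrable_id_normal_pdf s : 0 < s ->
  mu.-integrable setT (EFin \o (fun x => x * normal_pdf 0 s x)).
Proof.
move=> s0.
have s20 : s *+ 2 != 0 by rewrite mulrn_eq0 /= gt_eqF.
(* The dominating function is a multiple of the centred normal density of standard deviation [2 s].
   In terms of [u = x / s] the comparison reads [|u| <= exp (3 / 8 u^2)], where
   [3 / 8 = 1 / 2 - 1 / 8] is the difference of the two exponents. *)
have := integrableZl measurableT (s / normal_peak (s *+ 2) * normal_peak s) (integrable_normal_pdf 0 (s *+ 2)).
apply: le_integrable => //.
- apply/measurable_EFinP; apply: measurable_funM => //; exact: measurable_normal_pdf.
- move=> x _ /=; rewrite lee_fin !normrM.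
  rewrite !normal_pdfE// ?gt_eqF//.
  have pk : 0 < normal_peak (s *+ 2) by exact: normal_peak_gt0.
  have pk1 : 0 < normal_peak s by apply: normal_peak_gt0; rewrite gt_eqF.
  move: (normal_peak (s *+ 2)) pk (normal_peak s) pk1 => p2 pk p1 pk1.
  rewrite !normfV normrM (normrM p2) !(ger0_norm (normal_fun_ge0 _ _ _)) !(gtr0_norm pk) (gtr0_norm pk1) (gtr0_norm s0).
  rewrite mulrA [leRHS](_ : _ = s * p1 * normal_fun 0 (s *+ 2) x); last first.
    by field; rewrite gt_eqF.
  rewrite (mulrC `|x|) (mulrC s) -!mulrA ler_wpM2l ?(ltW pk1)// /normal_fun.
  rewrite subr0; set E := expR (- x ^+ 2 / _); set u := x / s.
  have {1}-> : x = s * u by rewrite /u mulrC divfK// gt_eqF.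
  rewrite normrM (gtr0_norm s0) -mulrA ler_pM2l//.
  have <- : expR (3 / 8 * u ^+ 2) * E = expR (- x ^+ 2 / ((s *+ 2) ^+ 2 *+ 2)).
    rewrite /E -expRD; congr expR; rewrite /u; by field; rewrite gt_eqF.
  rewrite ler_pM2r ?expR_gt0//; apply: le_trans (expR_ge1Dx _).
  by rewrite -[u ^+ 2]real_normK ?num_real//; have := sqr_ge0 (`|u| - 4 / 3); nra.
Qed.


Lemma bounded_integrable_normal s (h : R -> R) (M : R) : continuous h -> (forall x, `|h x| <= M) ->
  mu.-integrable setT (EFin \o (fun x => h x * normal_pdf 0 s x)).
Proof.
move=> ch hM; have := integrableZl measurableT M (integrable_normal_pdf 0 s).
apply: le_integrable => //.
- apply/measurable_EFinP; apply: measurable_funM.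
    exact: continuous_measurable_fun.
  exact: measurable_normal_pdf.
- move=> x _ /=; rewrite lee_fin !normrM ler_wpM2r//.
  by apply: le_trans (hM x) _; exact: ler_norm.
Qed.

Lemma bounded_id_integrable_normal s (h : R -> R) (M : R) : 0 < s -> continuous h -> (forall x, `|h x| <= M) ->
  mu.-integrable setT (EFin \o (fun x => x * h x * normal_pdf 0 s x)).
Proof.
move=> s0 ch hM; have := integrableZl measurableT M (integrable_id_normal_pdf s0).
apply: le_integrable => //.
- apply/measurable_EFinP; apply: measurable_funM.
    by apply: measurable_funM => //; exact: continuous_measurable_fun.
  exact: measurable_normal_pdf.
- move=> x _ /=; rewrite lee_fin !normrM (mulrC `|x|) -mulrA ler_wpM2r//.
  by apply: le_trans (hM x) _; exact: ler_norm.
Qed.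

Lemma bounded_Rintegral_normal s (h : R -> R) (M : R) : continuous h -> (forall x, `|h x| <= M) ->
  \int[normal_prob 0 s]_x h x = \int[mu]_x (h x * normal_pdf 0 s x).
Proof.
move=> ch hM; apply: Rintegral_normal_prob.
apply: (@bounded_integrable _ _ (normal_prob 0 s) _ M) => //.
exact: continuous_measurable_fun.
Qed.

(** Carries estimates from segments, where the fundamental theorem of calculus applies, over to the
    whole line. *)
Lemma cvg_Rintegral_itv (h : R -> R) : mu.-integrable setT (EFin \o h) ->
  (fun n => \int[mu]_(x in `[(- n%:R)%R, n%:R]) h x) @ \oo --> \int[mu]_x h x.
Proof.
move=> hi.
pose h_ n := (EFin \o h) \_ (`[(- n%:R)%R, n%:R]%classic : set (measurableTypeR R)).
have mh : measurable_fun setT (EFin \o h) by exact: measurable_int hi.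
have [] := @dominated_convergence _ _ _ mu _ measurableT h_ (EFin \o h) (abse \o (EFin \o h)) _ mh.
- by move=> n; apply/(measurable_restrictT _ _).1 => //; exact: measurable_funTS.
- apply: aeW => x _; apply: cvg_near_cst; near=> n.
  rewrite /h_ patchE mem_set//= in_itv/= -ler_norml.
  by near: n; exact: nbhs_infty_ger.
- exact: integrable_abse.
- apply: aeW => x n _; rewrite /h_ patchE; case: ifP => _ //=.
  by rewrite normr0 lee_fin.
move=> _ _ cv.
have fin : (\int[mu]_x (h x)%:E)%E \is a fin_num by exact: integrable_fin_num.
have -> : (fun n => \int[mu]_(x in `[(- n%:R)%R, n%:R]) h x) =
   fine \o (fun n => \int[mu]_x h_ n x)%E.
  by apply/funext => n; rewrite /Rintegral integral_mkcond.
by apply: fine_cvg; rewrite /Rintegral fineK.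
Unshelve. all: by end_near. Qed.

Lemma is_derive_normal_pdf s (x : R) : 0 < s ->
  is_derive x 1 (normal_pdf 0 s) (- x / s ^+ 2 * normal_pdf 0 s x).
Proof.
move=> s0; rewrite normal_pdfE ?gt_eqF//.
have -> : (fun y => normal_peak s * normal_fun 0 s y) =
   (normal_peak s) *: (expR \o (- (s ^+ 2 *+ 2)^-1 *: ((@id R) ^+ 2))) :> (R -> R).
  apply/funext => y; rewrite /normal_fun subr0 /= ?fctE /GRing.scale /=; congr (_ * expR _).
  by rewrite mulNr mulrC mulNr.
apply: is_derive_eq.
rewrite /GRing.scale /= ?fctE /= /normal_fun subr0 /GRing.scale /=.
have -> : - (s ^+ 2 *+ 2)^-1 * x ^+ 2 = - x ^+ 2 / (s ^+ 2 *+ 2) by field; rewrite gt_eqF.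
by field; rewrite gt_eqF.
Qed.

Lemma Rintegral_FTC (F F' : R -> R) (a b : R) : a < b ->
  (forall x : R, is_derive x 1 F (F' x)) -> continuous F' ->
  \int[mu]_(x in `[a, b]) F' x = F b - F a.
Proof.
move=> ab dF cF'.
have cF : continuous F.
  by move=> x; apply: differentiable_continuous; apply/derivable1_diffP; have [] := dF x.
rewrite /Rintegral (@continuous_FTC2 _ F' F)//.
- exact: continuous_subspaceT.
- split.
  + by move=> x _; have [] := dF x.
  + exact/cvg_at_right_filter/cF.
  + exact/cvg_at_left_filter/cF.
- by move=> x _; rewrite derive1E; have [_ ->] := dF x.
Qed.

Lemma normal_pdf_cvg0 s : 0 < s -> (fun n => normal_pdf 0 s n%:R) @ \oo --> (0 : R).
Proof.
move=> s0.
have s20 : s *+ 2 != 0 by rewrite mulrn_eq0 /= gt_eqF.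
have pk1 : 0 < normal_peak s by apply: normal_peak_gt0; rewrite gt_eqF.
(* From [exp t >= 1 + t] and [n.+1 <= n.+1 ^ 2]; a harmonic rate suffices for the limit. *)
have H n : normal_pdf 0 s n.+1%:R <= (normal_peak s * (s ^+ 2 *+ 2)) * harmonic n.
  rewrite normal_pdfE ?gt_eqF// -mulrA ler_pM2l// /normal_fun subr0.
  have s2 : 0 < s ^+ 2 *+ 2 by rewrite mulrn_wgt0 ?exprn_gt0.
  rewrite mulNr expRN -[leRHS]invrK lef_pV2 ?posrE ?expR_gt0 ?invr_gt0 ?mulr_gt0 ?harmonic_gt0//.
  apply: le_trans (expR_ge1Dx _); rewrite /harmonic invfM invrK mulrC.
  apply: (@le_trans _ _ (n.+1%:R ^+ 2 / (s ^+ 2 *+ 2))); last by rewrite lerDr.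
  by rewrite ler_pM2r ?invr_gt0// -natrX ler_nat -mulnn leq_pmull.
rewrite -(cvg_shiftS (fun n => normal_pdf 0 s n%:R)).
apply: (@squeeze_cvgr _ _ _ _ (fun=> 0) (fun n => normal_peak s * (s ^+ 2 *+ 2) * harmonic n)).
- by near=> n; rewrite normal_pdf_ge0 /= H.
- exact: cvg_cst.
- rewrite -[X in _ --> X](mulr0 (normal_peak s * (s ^+ 2 *+ 2))).
  by apply: cvgM; [exact: cvg_cst|exact: cvg_harmonic].
Unshelve. all: by end_near. Qed.

(** Stein's identity. The derivative of [f] times the density has integral 0, because [f] is bounded
    and the density vanishes at infinity. *)
Lemma normal_ibp s (f f' : R -> R) (M : R) : 0 < s -> (forall x : R, is_derive x 1 f (f' x)) -> continuous f' ->
  (forall x, `|f x| <= M) -> (forall x, `|f' x| <= M) ->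
  \int[normal_prob 0 s]_x (x * f x) = s ^+ 2 * \int[normal_prob 0 s]_x f' x.
Proof.
move=> s0 df cf' fM f'M.
have cf : continuous f.
  by move=> x; apply: differentiable_continuous; apply/derivable1_diffP; have [] := df x.
have i1 := bounded_id_integrable_normal s0 cf fM.
have i2 := bounded_integrable_normal s cf' f'M.
rewrite Rintegral_normal_prob; last first.
  apply: integrable_normal_prob => //; apply: measurable_funM => //.
  exact: continuous_measurable_fun.
rewrite (bounded_Rintegral_normal _ cf' f'M).
pose G x := f x * normal_pdf 0 s x.
pose G' x := f' x * normal_pdf 0 s x - s ^- 2 * (x * f x * normal_pdf 0 s x).
have dG (x : R) : is_derive x 1 G (G' x).
  have d1 := is_derive_normal_pdf x s0.
  have d2 := df x.
  apply: is_derive_eq; rewrite /G' /GRing.scale /=.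
  by field; rewrite gt_eqF.
have cp : continuous (normal_pdf 0 s) by apply: continuous_normal_pdf; rewrite gt_eqF.
have cG' : continuous G'.
  move=> x; apply: cvgB; first by apply: cvgM; [exact: cf'|exact: cp].
  apply: cvgM; first exact: cvg_cst.
  by apply: cvgM; [apply: cvgM; [exact: cvg_id|exact: cf]|exact: cp].
have iG' : mu.-integrable setT (EFin \o G').
  have -> : EFin \o G' = ((EFin \o (fun x => (f' x * normal_pdf 0 s x)%R)) \-
     (fun x => (s ^- 2)%:E * (EFin \o (fun x => (x * f x * normal_pdf 0 s x)%R)) x))%E.
    by apply/funext => x /=; rewrite /G' EFinB EFinM.
  by apply: integrableB => //; exact: integrableZl.
have lim1 := cvg_Rintegral_itv iG'.
have lim0 : (fun n => \int[mu]_(x in `[(- n%:R)%R, n%:R]) G' x) @ \oo --> (0 : R).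
  have -> : (0 : R) = M * 0 + M * 0 by rewrite mulr0 addr0.
  apply: (@squeeze_cvgr _ _ _ _ (fun n => - (M * normal_pdf 0 s n%:R + M * normal_pdf 0 s n%:R)) (fun n => M * normal_pdf 0 s n%:R + M * normal_pdf 0 s n%:R)).
  - near=> n.
    have n0 : 0 < n%:R :> R by rewrite ltr0n; near: n; exact: nbhs_infty_gt.
    rewrite (Rintegral_FTC _ dG)//; last by rewrite gtrN.
    rewrite -ler_norml; apply: le_trans (ler_normB _ _) _.
    have ev : normal_pdf 0 s (- n%:R) = normal_pdf 0 s n%:R.
      by rewrite normal_pdfE ?gt_eqF// /normal_fun !subr0 sqrrN.
    rewrite /G ev !normrM !(ger0_norm (normal_pdf_ge0 _ _ _)).
    by apply: lerD; rewrite ler_wpM2r ?normal_pdf_ge0.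
  - rewrite -[X in _ --> X]opprK; apply: cvgN; rewrite opprD -!mulrN oppr0.
    by apply: cvgD; apply: cvgM; [exact: cvg_cst|exact: normal_pdf_cvg0|exact: cvg_cst|exact: normal_pdf_cvg0].
  - by apply: cvgD; apply: cvgM; [exact: cvg_cst|exact: normal_pdf_cvg0|exact: cvg_cst|exact: normal_pdf_cvg0].
have : \int[mu]_x G' x = 0 by apply: (cvg_unique _ lim1 lim0).
have iz : mu.-integrable setT (EFin \o (fun x => s ^- 2 * (x * f x * normal_pdf 0 s x))).
  by have := integrableZl measurableT (s ^- 2) i1; under eq_fun do rewrite /= -EFinM.
rewrite RintegralB// RintegralZl// => /eqP; rewrite subr_eq0 => /eqP ->.
by rewrite mulrA divff ?mul1r// expf_neq0// gt_eqF.
Unshelve. all: by end_near. Qed.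

Lemma half_le_arith (a b c : R) : 2^-1 * a <= 8 * c * b -> a <= 16 * c * b.
Proof. lra. Qed.

(** The pointwise core of the next estimate, where [b] is the function, [a] its derivative scaled by
    [s] up to sign, [u] the distance to the origin in units of [s], and [c = exp (- u)]. Since
    [u >= 1 - c], the coefficient of [b ^+ 2] is at least 1, and half of it absorbs the cross
    term. *)
Lemma hardy_arith (a b c u : R) : 0 < c -> c <= 1 -> 0 <= u -> 1 - u <= c ->
  2 * a * b * (1 + c) - b ^+ 2 * (c + u * (1 + c)) <= 8 * a ^+ 2 - 2^-1 * b ^+ 2.
Proof.
move=> c0 c1 u0 cu.
have K : 1 <= c + u * (1 + c) by nra.
have Kb : b ^+ 2 <= b ^+ 2 * (c + u * (1 + c)) by rewrite ler_peMr ?sqr_ge0.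
have : 2 * a * b * (1 + c) <= 2^-1 * b ^+ 2 + 2 * a ^+ 2 * (1 + c) ^+ 2.
  by have := sqr_ge0 (b - 2 * a * (1 + c)); lra.
have : 2 * a ^+ 2 * (1 + c) ^+ 2 <= 2 * a ^+ 2 * 4.
  by apply: ler_wpM2l; [rewrite mulr_ge0 ?sqr_ge0|nra].
lra.
Qed.

(* The weight [psi t = s (1 + exp (- t / s))] satisfies
   [psi' - t psi / s^2 <= - 1] for [t >= 0]; integrating the derivative of
   [g^2 psi pdf] over both half-lines bounds the second moment of a function [g]
   vanishing at the origin. *)
Lemma normal_hardy s (g g' : R -> R) (M : R) : 0 < s -> (forall x : R, is_derive x 1 g (g' x)) -> continuous g' ->
  g 0 = 0 -> (forall x, `|g x| <= M) -> (forall x, `|g' x| <= M) ->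
  \int[normal_prob 0 s]_x (g x ^+ 2) <= 16 * s ^+ 2 * \int[normal_prob 0 s]_x (g' x ^+ 2).
Proof.
move=> s0 dg cg' g0 gM g'M.
have cg : continuous g.
  by move=> x; apply: differentiable_continuous; apply/derivable1_diffP; have [] := dg x.
have csq (h : R -> R) : continuous h -> continuous (fun x => h x ^+ 2).
  move=> ch; have -> : (fun x => h x ^+ 2) = (fun x => h x * h x) by apply/funext => y; rewrite expr2.
  by move=> x; apply: cvgM; exact: ch.
have bsq (h : R -> R) : (forall x, `|h x| <= M) -> (forall x, `|h x ^+ 2| <= M ^+ 2).
  by move=> hM x; rewrite normrX lerXn2r ?nnegrE// (le_trans _ (hM x)).
have i1 := bounded_integrable_normal s (csq _ cg) (bsq _ gM).
have i2 := bounded_integrable_normal s (csq _ cg') (bsq _ g'M).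
rewrite (bounded_Rintegral_normal _ (csq _ cg) (bsq _ gM)) (bounded_Rintegral_normal _ (csq _ cg') (bsq _ g'M)).
have cp : continuous (normal_pdf 0 s) by apply: continuous_normal_pdf; rewrite gt_eqF.
pose h x := 8 * s ^+ 2 * (g' x ^+ 2 * normal_pdf 0 s x) - 2^-1 * (g x ^+ 2 * normal_pdf 0 s x).
have ch : continuous h.
  move=> x; apply: cvgB; apply: cvgM; try exact: cvg_cst.
    by apply: cvgM; [exact: csq|exact: cp].
  by apply: cvgM; [exact: csq|exact: cp].
have ih1 : mu.-integrable setT (EFin \o (fun x => 8 * s ^+ 2 * (g' x ^+ 2 * normal_pdf 0 s x))).
  by have := integrableZl measurableT (8 * s ^+ 2) i2; under eq_fun do rewrite /= -EFinM.
have ih2 : mu.-integrable setT (EFin \o (fun x => 2^-1 * (g x ^+ 2 * normal_pdf 0 s x))).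
  by have := integrableZl measurableT (2^-1) i1; under eq_fun do rewrite /= -EFinM.
have ih : mu.-integrable setT (EFin \o h).
  have -> : EFin \o h = ((EFin \o (fun x => 8 * s ^+ 2 * (g' x ^+ 2 * normal_pdf 0 s x))%R) \- (EFin \o (fun x => 2^-1 * (g x ^+ 2 * normal_pdf 0 s x))%R))%E.
    by apply/funext => x /=; rewrite /h EFinB.
  exact: integrableB.
suff : 0 <= \int[mu]_x h x.
  rewrite RintegralB// !RintegralZl// subr_ge0 => H.
  by move: H; apply: half_le_arith.
apply: (@closed_cvg _ _ _ _ _ (fun y : R => 0 <= y) _ _ _ (cvg_Rintegral_itv ih)) => //.
(* [e] is 1 on the right half-line and -1 on the left one, so that [e * x] is the distance to the
   origin and one computation serves both sides. *)
pose E (e : R) x := expR (- e * x / s).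
pose F (e : R) x := e * s * (g x ^+ 2 * (1 + E e x) * normal_pdf 0 s x).
pose F' (e : R) x := e * s * (2 * g x * g' x * (1 + E e x) * normal_pdf 0 s x
   + g x ^+ 2 * (- e / s * E e x) * normal_pdf 0 s x
   + g x ^+ 2 * (1 + E e x) * (- x / s ^+ 2 * normal_pdf 0 s x)).
have dE e (x : R) : is_derive x 1 (E e) (- e / s * E e x).
  have -> : E e = expR \o ((- e / s) *: (@id R)).
    by apply/funext => y; rewrite /E /= /GRing.scale /= ?fctE; congr expR; rewrite mulrAC.
  apply: is_derive_eq; rewrite /GRing.scale /= ?fctE /E /GRing.scale /=.
  by rewrite mulrC mulr1 mulrAC.
have dF e (x : R) : is_derive x 1 (F e) (F' e x).
  have d1 := is_derive_normal_pdf x s0.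
  have d2 := dg x.
  have d3 := dE e x.
  have -> : F e = (e * s) *: ((g ^+ 2 * (cst 1 + E e)) * normal_pdf 0 s) by apply/funext => y.
  apply: is_derive_eq; rewrite /F' /GRing.scale /= ?fctE /= /GRing.scale /=.
  by ring.
have cE e : continuous (E e).
  by move=> x; apply: differentiable_continuous; apply/derivable1_diffP; have [] := dE e x.
have cF' e : continuous (F' e).
  move=> x; apply: cvgM; first exact: cvg_cst.
  have c1 : (1 + E e y) @[y --> x] --> 1 + E e x by apply: cvgD; [exact: cvg_cst|exact: cE].
  apply: cvgD; first apply: cvgD.
  - by apply: cvgM (cp x); apply: cvgM c1; apply: cvgM (cg' x); apply: cvgM (cg x); exact: cvg_cst.
  - by apply: cvgM (cp x); apply: cvgM; [exact: csq|apply: cvgM (cE e x); exact: cvg_cst].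
  - apply: cvgM; first by apply: cvgM c1; exact: csq.
    apply: cvgM (cp x); apply: cvgM; last exact: cvg_cst.
    by apply: cvgN; exact: cvg_id.
have F'h e x : e ^+ 2 = 1 -> 0 <= e * x -> F' e x <= h x.
  move=> e1 ex; rewrite /F' /h.
  have E1 : E e x <= 1.
    by rewrite /E -expR0 ler_expR 2!mulNr oppr_le0 divr_ge0 // ltW.
  have E0 : 0 < E e x by exact: expR_gt0.
  have E2 : 1 - e * x / s <= E e x by rewrite /E; apply: le_trans (expR_ge1Dx _); rewrite mulNr mulNr.
  have p0 := normal_pdf_ge0 0 s x.
  set u := e * x / s in E2; have u0 : 0 <= u by rewrite /u divr_ge0 // ltW.
  have -> : e * s * (2 * g x * g' x * (1 + E e x) * normal_pdf 0 s x +
   g x ^+ 2 * (- e / s * E e x) * normal_pdf 0 s x +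
   g x ^+ 2 * (1 + E e x) * (- x / s ^+ 2 * normal_pdf 0 s x)) =
   (2 * (e * s * g' x) * g x * (1 + E e x) - g x ^+ 2 * (e ^+ 2 * E e x + u * (1 + E e x))) * normal_pdf 0 s x.
    by rewrite /u; field; rewrite gt_eqF.
  rewrite [leRHS](_ : _ = (8 * s ^+ 2 * g' x ^+ 2 - 2^-1 * g x ^+ 2) * normal_pdf 0 s x); last by ring.
  rewrite ler_wpM2r// e1 mul1r.
  have -> : 8 * s ^+ 2 * g' x ^+ 2 = 8 * (e * s * g' x) ^+ 2 by rewrite !exprMn e1; ring.
  exact: hardy_arith.
have sub a b : mu.-integrable `[a, b] (EFin \o h) by exact: integrableS ih.
have subF e a b : mu.-integrable `[a, b] (EFin \o F' e).
  by apply: continuous_compact_integrable; [exact: segment_compact|exact: continuous_subspaceT].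
near=> n.
have n0 : 0 < n%:R :> R by rewrite ltr0n; near: n; exact: nbhs_infty_gt.
(* Both boundary terms are harmless: the one at the origin vanishes with [g], and the outer one has
   the favourable sign. The same happens on the left half-line. *)
have R1 : 0 <= \int[mu]_(x in `[0, n%:R]) h x.
  apply: (@le_trans _ _ (\int[mu]_(x in `[0, n%:R]) F' 1 x)).
    rewrite (Rintegral_FTC n0 (dF 1))// /F g0 expr0n /= !mul0r mulr0 subr0 mul1r.
    apply: mulr_ge0; [exact: ltW|apply: mulr_ge0; [apply: mulr_ge0|exact: normal_pdf_ge0]].
      exact: sqr_ge0.
    by rewrite addr_ge0// expR_ge0.
  apply: le_Rintegral => // x; rewrite /= in_itv /= => /andP[x0 _].
  by apply: F'h; rewrite ?expr1n ?mul1r.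
have n1 : - n%:R < 0 :> R by rewrite oppr_lt0.
have R2 : 0 <= \int[mu]_(x in `[- n%:R, 0]) h x.
  apply: (@le_trans _ _ (\int[mu]_(x in `[(- n%:R)%R, 0]) F' (- 1) x)).
    rewrite (Rintegral_FTC n1 (dF (- 1)))// /F g0 expr0n /= !mul0r mulr0 sub0r !mulN1r mulNr opprK.
    apply: mulr_ge0; [exact: ltW|apply: mulr_ge0; [apply: mulr_ge0|exact: normal_pdf_ge0]].
      exact: sqr_ge0.
    by rewrite addr_ge0// expR_ge0.
  apply: le_Rintegral => // x; rewrite /= in_itv /= => /andP[_ x0].
  by apply: F'h; rewrite ?sqrrN ?expr1n ?mulN1r ?oppr_ge0.
have := @Rintegral_itvB R h (BLeft (- n%:R)) (BRight n%:R) 0 (sub _ _).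
rewrite !bnd_simp oppr_le0 ler0n => /(_ isT isT) /eqP.
rewrite subr_eq Rintegral_itv_obnd_cbnd; last by apply: integrableS ih.
by move=> /eqP ->; exact: addr_ge0.
Unshelve. all: by end_near. Qed.

(** The variance is at most the mean square of [f - f 0], to which the estimate for functions
    vanishing at the origin applies. The price is the constant 16 instead of the sharp 1, which only
    affects coefficients. *)
Lemma normal_poincare s (f f' : R -> R) (M : R) : 0 < s -> (forall x : R, is_derive x 1 f (f' x)) -> continuous f' ->
  (forall x, `|f x| <= M) -> (forall x, `|f' x| <= M) ->
  \int[normal_prob 0 s]_x (f x ^+ 2) - (\int[normal_prob 0 s]_x f x) ^+ 2 <=
  16 * s ^+ 2 * \int[normal_prob 0 s]_x (f' x ^+ 2).
Proof.
move=> s0 df cf' fM f'M.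
have cf : continuous f.
  by move=> x; apply: differentiable_continuous; apply/derivable1_diffP; have [] := df x.
have M0 : 0 <= M by exact: le_trans (fM 0).
have := @normal_hardy s (fun x => f x - f 0) f' (M + M) s0.
have -> : (fun x => f x - f 0) = f - cst (f 0) by apply/funext.
move=> H; apply: le_trans (H _ cf' _ _ _); last 4 first.
- by move=> x; have d2 := df x; apply: is_derive_eq; rewrite subr0.
- by rewrite subrr.
- by move=> x; apply: le_trans (ler_normB _ _) _; exact: lerD.
- by move=> x; apply: le_trans (f'M x) _; rewrite lerDl.
have bi (h : R -> R) B : continuous h -> (forall x, `|h x| <= B) -> (normal_prob 0 s).-integrable setT (EFin \o h).
  by move=> ch hB; apply: (@bounded_integrable _ _ (normal_prob 0 s) _ B) => //; exact: continuous_measurable_fun.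
have if1 := bi _ _ cf fM.
have if2 : (normal_prob 0 s).-integrable setT (EFin \o (fun x => f x ^+ 2)).
  apply: (bi _ (M ^+ 2)).
    have -> : (fun x => f x ^+ 2) = (fun x => f x * f x) by apply/funext => y; rewrite expr2.
    by move=> x; apply: cvgM; exact: cf.
  by move=> x; rewrite normrX lerXn2r ?nnegrE.
have if3 : (normal_prob 0 s).-integrable setT (EFin \o (fun x => (2 * f 0) * f x)).
  by have := integrableZl measurableT (2 * f 0) if1; under eq_fun do rewrite /= -EFinM.
have if4 : (normal_prob 0 s).-integrable setT (EFin \o (fun x => f 0 ^+ 2)).
  exact: finite_measure_integrable_cst.
have if5 : (normal_prob 0 s).-integrable setT (EFin \o (fun x => f x ^+ 2 - (2 * f 0) * f x)).
  have -> : EFin \o (fun x => f x ^+ 2 - (2 * f 0) * f x) = ((EFin \o (fun x => (f x ^+ 2)%R)) \- (EFin \o (fun x => ((2 * f 0) * f x)%R)))%E.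
    by apply/funext => x /=; rewrite EFinB.
  exact: integrableB.
have -> : \int[normal_prob 0 s]_x ((f x - f 0) ^+ 2) = \int[normal_prob 0 s]_x ((f x ^+ 2 - (2 * f 0) * f x) + f 0 ^+ 2).
  by apply: eq_Rintegral => x _; ring.
rewrite RintegralD// RintegralB// RintegralZl// Rintegral_cst_prob.
rewrite -subr_ge0 [leRHS](_ : _ = (\int[normal_prob 0 s]_x f x - f 0) ^+ 2) ?sqr_ge0//; ring.
Qed.

End gaussian_line.

(** * Gaussian product measures *)

Definition rect_set (R : realType) (E : finType) (B : E -> set R) : set (E -> R) :=
  [set x | forall e, B e (x e)].

(** Rectangles are closed under intersection, so a probability on [E -> R] is determined by its
    values on them. Keeping functions on a finite type, rather than iterated products, lets any
    coordinate be changed in place. *)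
Definition rect_sets (R : realType) (E : finType) : set (set (E -> R)) :=
  [set A | exists2 B : E -> set R, (forall e, measurable (B e)) & A = rect_set B].

Arguments rect_sets : clear implicits.

Notation vecspace R E := (g_sigma_algebraType (rect_sets R E)).

Definition update (R : realType) (E : finType) (e : E) (x : E -> R) (t : R) : E -> R :=
  fun e' => if e' == e then t else x e'.

Section vecspace_measurability.
Context (R : realType) (E : finType).
Notation V := (vecspace R E).

Lemma rect_setE (B : E -> set R) : rect_set B = \bigcap_e [set x | B e (x e)].
Proof. by apply/seteqP; split => x /= H e; [move=> _|]; exact: H. Qed.

Lemma rect_sets_setI : setI_closed (rect_sets R E).
Proof.
move=> _ _ [B mB ->] [C mC ->]; exists (fun e => B e `&` C e).
  by move=> e; exact: measurableI.
apply/seteqP; split => x /=.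
  by move=> [xB xC] e; split; [exact: xB|exact: xC].
by move=> H; split => e; case: (H e).
Qed.

Lemma measurable_vec (d : measure_display) (T : measurableType d) (f : T -> V) :
  (forall e, measurable_fun setT (fun w => f w e)) -> measurable_fun setT f.
Proof.
move=> mf; apply: (@measurability _ _ T V setT f (rect_sets R E)) => //.
move=> _ [_ [B mB ->] <-]; rewrite rect_setE setTI preimage_bigcap.
apply: fin_bigcap_measurable; first exact: finite_finset.
by move=> e _; rewrite -[X in measurable X]setTI; apply: mf.
Qed.

Lemma measurable_coord (e : E) : measurable_fun [set: V] (fun x : V => x e).
Proof.
move=> _ B mB; rewrite setTI; apply: sub_sigma_algebra.
exists (fun e' => if e' == e then B else setT).
  by move=> e'; case: ifP.
apply/seteqP; split => x /=.
  by move=> xB e'; case: eqP => [->|].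
by move=> /(_ e); rewrite eqxx.
Qed.

Lemma measurable_update (e : E) :
  measurable_fun setT (fun p : V * measurableTypeR R => update e p.1 p.2 : V).
Proof.
apply: measurable_vec => e'; rewrite /update; case: (e' == e).
  exact: measurable_snd.
apply: (measurableT_comp (measurable_coord e')); exact: measurable_fst.
Qed.

Lemma measurable_update2 (e : E) (x : V) :
  measurable_fun setT (fun t : R => update e x t : V).
Proof.
by apply: measurable_vec => e'; rewrite /update; case: (e' == e).
Qed.

Lemma update_same (e : E) (x : E -> R) t u : update e (update e x t) u = update e x u.
Proof. by apply/funext => e'; rewrite /update; case: eqP. Qed.

Lemma updateC (e e' : E) (x : E -> R) t u : e != e' ->
  update e (update e' x u) t = update e' (update e x t) u.
Proof.
move=> ne; apply/funext => i; rewrite /update.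
by case: (eqVneq i e) => // ->; rewrite (negbTE ne).
Qed.

End vecspace_measurability.

(** Unlike integrable functions, bounded measurable ones are closed under products and stay so after
    fixing all coordinates but one. The integrands outside this class are those with a Gaussian
    coordinate as a factor, which are treated separately. *)
Definition bmfun (R : realType) (d : measure_display) (T : measurableType d) (F : T -> R) :=
  measurable_fun setT F /\ exists M, forall x, `|F x| <= M.

Section bmfun.
Context (R : realType) (d : measure_display) (T : measurableType d).
Implicit Types F G : T -> R.

Lemma bmfun_integrable (P : probability T R) F : bmfun F -> P.-integrable setT (EFin \o F).
Proof. by move=> [mF [M FM]]; exact: bounded_integrable FM. Qed.

Lemma bmfun_cst (r : R) : bmfun (fun _ : T => r).
Proof. by split; [exact: measurable_cst|exists `|r|]. Qed.

Lemma bmfunD F G : bmfun F -> bmfun G -> bmfun (fun x => F x + G x).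
Proof.
move=> [mF [M FM]] [mG [M' GM]]; split; first exact: measurable_funD.
by exists (M + M') => x; apply: le_trans (ler_normD _ _) _; exact: lerD.
Qed.

Lemma bmfunN F : bmfun F -> bmfun (fun x => - F x).
Proof.
move=> [mF [M FM]]; split; first exact: measurableT_comp.
by exists M => x; rewrite normrN.
Qed.

Lemma bmfunB F G : bmfun F -> bmfun G -> bmfun (fun x => F x - G x).
Proof. by move=> bF bG; apply: bmfunD => //; exact: bmfunN. Qed.

Lemma bmfunM F G : bmfun F -> bmfun G -> bmfun (fun x => F x * G x).
Proof.
move=> [mF [M FM]] [mG [M' GM]]; split; first exact: measurable_funM.
by exists (M * M') => x; rewrite normrM ler_pM.
Qed.

Lemma bmfunZ r F : bmfun F -> bmfun (fun x => r * F x).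
Proof. by move=> bF; apply: bmfunM => //; exact: bmfun_cst. Qed.

Lemma bmfunX F : bmfun F -> bmfun (fun x => F x ^+ 2).
Proof. by move=> bF; under eq_fun do rewrite expr2; exact: bmfunM. Qed.

Lemma bmfun_sum (I : Type) (s : seq I) (p : pred I) (F : I -> T -> R) :
  (forall i, bmfun (F i)) -> bmfun (fun x => \sum_(i <- s | p i) F i x).
Proof.
move=> bF; elim: s => [|i s IH].
  by under eq_fun do rewrite big_nil; exact: bmfun_cst.
under eq_fun do rewrite big_cons; case: (p i) => //; exact: bmfunD.
Qed.

Section expectation.
Variable P : probability T R.

Lemma bmRintegralD F G : bmfun F -> bmfun G ->
  \int[P]_x (F x + G x) = \int[P]_x F x + \int[P]_x G x.
Proof. by move=> bF bG; rewrite RintegralD//; exact: bmfun_integrable. Qed.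

Lemma bmRintegralB F G : bmfun F -> bmfun G ->
  \int[P]_x (F x - G x) = \int[P]_x F x - \int[P]_x G x.
Proof. by move=> bF bG; rewrite RintegralB//; exact: bmfun_integrable. Qed.

Lemma bmRintegralZ r F : bmfun F ->
  \int[P]_x (r * F x) = r * \int[P]_x F x.
Proof. by move=> bF; rewrite RintegralZl//; exact: bmfun_integrable. Qed.

Lemma bmRintegral_sum (I : Type) (s : seq I) (p : pred I) (F : I -> T -> R) :
  (forall i, bmfun (F i)) ->
  \int[P]_x (\sum_(i <- s | p i) F i x) = \sum_(i <- s | p i) \int[P]_x F i x.
Proof.
move=> bF; elim: s => [|i s IH].
  rewrite big_nil -[RHS](Rintegral_cst_prob P 0).
  by apply: eq_Rintegral => x _; rewrite big_nil.
rewrite big_cons -IH; under eq_Rintegral do rewrite big_cons.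
case: (p i) => //; rewrite bmRintegralD//; exact: bmfun_sum.
Qed.

Lemma bmRintegral_le F G : bmfun F -> bmfun G -> (forall x, F x <= G x) ->
  \int[P]_x F x <= \int[P]_x G x.
Proof. by move=> bF bG FG; apply: le_Rintegral => //; exact: bmfun_integrable. Qed.

Lemma bmRintegral_sqr F : bmfun F -> (\int[P]_x F x) ^+ 2 <= \int[P]_x (F x ^+ 2).
Proof.
move=> bF; set m := \int[P]_x F x; rewrite -subr_ge0.
have -> : \int[P]_x (F x ^+ 2) - m ^+ 2 = \int[P]_x ((F x - m) ^+ 2).
  transitivity (\int[P]_x ((F x ^+ 2 - (2 * m) * F x) + m ^+ 2)); last first.
    by apply: eq_Rintegral => x _; ring.
  have b1 := bmfunX bF; have b2 := bmfunZ (2 * m) bF.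
  rewrite bmRintegralD; [|exact: bmfunB|exact: bmfun_cst].
  by rewrite bmRintegralB// bmRintegralZ// Rintegral_cst_prob -/m; ring.
by apply: Rintegral_ge0 => x _; exact: sqr_ge0.
Qed.

End expectation.
End bmfun.

(** * Averages over one coordinate and the Efron-Stein inequality *)

Section product_probability.
Context (R : realType) (E : finType).
Notation V := (vecspace R E).
Variables (nu : probability (measurableTypeR R) R) (mu : probability V R).
Hypothesis mu_rect : forall B : E -> set R, (forall e, measurable (B e)) ->
  mu (rect_set B) = (\prod_e nu (B e))%E.
Implicit Types F G : V -> R.

(** Drawing one coordinate afresh preserves a product law, since both sides agree on rectangles.
    This serves as the disintegration of [mu] along the coordinate [e]. *)
Lemma update_law (e : E) (A : set V) : measurable A ->
  mu A = (mu \x nu)%E ((fun p : V * measurableTypeR R => update e p.1 p.2 : V) @^-1` A).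
Proof.
move=> mA.
pose X : {mfun (V * measurableTypeR R)%type >-> V} := mfun_Sub (mem_set (@measurable_update R E e)).
have -> : (mu \x nu)%E ((fun p : V * measurableTypeR R => update e p.1 p.2 : V) @^-1` A) =
   distribution (mu \x nu)%E X A by [].
apply: (@measure_unique _ R V (rect_sets R E) (fun=> setT) erefl (@rect_sets_setI R E) _ _ mu (distribution (mu \x nu)%E X)) => //.
- by move=> _; exists (fun=> setT) => //; apply/seteqP; split.
- by rewrite bigcup_const//; exists 0%N.
- move=> _ [B mB ->] /=; rewrite /distribution /pushforward/=.
  pose B' e' := if e' == e then setT else B e'.
  have mB' e' : measurable (B' e') by rewrite /B'; case: ifP.
  have -> : (fun p : V * measurableTypeR R => update e p.1 p.2 : V) @^-1` (rect_set B) = rect_set B' `*` B e.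
    apply/seteqP; split => -[x t] /=.
      move=> H; split; last by have := H e; rewrite /update eqxx.
      by move=> e'; rewrite /B'; have := H e'; rewrite /update; case: (e' == e).
    by move=> [H Ht] e'; have := H e'; rewrite /update /B'; case: eqP => // ->.
  rewrite product_measure1E; [|by apply: sub_sigma_algebra; exists B'|exact: mB].
  rewrite (mu_rect mB); apply: (@etrans _ _ ((\prod_e' nu (B' e')) * nu (B e))%E); last by rewrite -(mu_rect mB').
  rewrite (bigD1 e)//= [in RHS](bigD1 e)//= /B' eqxx probability_setT mul1e muleC.
  by congr (_ * _)%E; apply: eq_bigr => e' /negbTE ->.
- by move=> _; apply: (@le_lt_trans _ _ 1%E); [exact: probability_le1|exact: ltry].
Qed.

Lemma integral_update (e : E) (F : V -> R) : measurable_fun setT F ->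
  mu.-integrable setT (EFin \o F) ->
  (\int[mu]_x (F x)%:E = \int[mu]_x \int[nu]_t (F (update e x t))%:E)%E.
Proof.
move=> mF iF.
have mU := @measurable_update R E e.
pose X : {mfun (V * measurableTypeR R)%type >-> V} := mfun_Sub (mem_set mU).
have eqm A : measurable A -> mu A = distribution (mu \x nu)%E X A by exact: update_law.
have i2 : (mu \x nu)%E.-integrable setT ((EFin \o F) \o X).
  apply/integrableP; split.
    by apply: measurableT_comp => //; exact/measurable_EFinP.
  have := @ge0_integral_distribution _ _ _ _ _ (mu \x nu)%E X (abse \o (EFin \o F)).
  move=> <-; last 2 first.
  - by do 2 apply: measurableT_comp => //.
  - by move=> y; exact: abse_ge0.
  case/integrableP: iF => _; rewrite (eq_measure_integral (distribution (mu \x nu)%E X))//.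
  by move=> A mA _; exact: eqm.
rewrite (eq_measure_integral (distribution (mu \x nu)%E X)); last first.
  by move=> A mA _; exact: eqm.
rewrite (@integral_distribution _ _ _ _ _ (mu \x nu)%E X (EFin \o F))//; last exact/measurable_EFinP.
by rewrite -integral12_prod_meas1.
Qed.

(** The conditional expectation given all coordinates other than [e], as an explicit integral
    defined at every point. *)
Definition avg (e : E) (F : V -> R) (x : V) : R := \int[nu]_t F (update e x t).

Lemma bmfun_update (e : E) x F : bmfun F -> bmfun (fun t : measurableTypeR R => F (update e x t)).
Proof.
move=> [mF [M FM]]; split; last by exists M.
apply: (measurableT_comp mF); exact: measurable_update2.
Qed.

Lemma avg_EFin (e : E) F x : bmfun F -> ((avg e F x)%:E = \int[nu]_t (F (update e x t))%:E)%E.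
Proof.
move=> bF; rewrite /avg /Rintegral fineK//; apply: integrable_fin_num => //.
by apply: bmfun_integrable; exact: bmfun_update.
Qed.

Lemma bmfun_avg (e : E) F : bmfun F -> bmfun (avg e F).
Proof.
move=> bF; have [mF [M FM]] := bF; split.
  apply/measurable_EFinP.
  have -> : EFin \o avg e F = fubini_F nu (fun p : V * measurableTypeR R => (F (update e p.1 p.2))%:E).
    by apply/funext => x /=; rewrite avg_EFin.
  apply: (@measurable_fubini_F _ _ _ _ _ mu nu).
  apply: (@bounded_integrable _ _ _ (mu \x nu)%E (fun p : V * measurableTypeR R => F (update e p.1 p.2)) M) => //.
  by apply: (measurableT_comp mF); exact: measurable_update.
exists M => x; rewrite -(Rintegral_cst_prob nu M).
apply: le_trans (le_normr_Rintegral _ _) _ => //.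
  by apply: bmfun_integrable; exact: bmfun_update.
apply: bmRintegral_le => //; last exact: bmfun_cst.
have [mG [M' GM]] := bmfun_update e x bF.
by split; [exact: measurableT_comp|exists M' => t; rewrite normr_id].
Qed.

Lemma Rintegral_avg (e : E) F : bmfun F -> \int[mu]_x avg e F x = \int[mu]_x F x.
Proof.
move=> bF; rewrite /Rintegral [in RHS](integral_update e)//; last 2 first.
- by case: bF.
- exact: bmfun_integrable.
by congr fine; apply: eq_integral => x _; rewrite avg_EFin.
Qed.

Lemma avg_update (e : E) F x t : avg e F (update e x t) = avg e F x.
Proof. by apply: eq_Rintegral => u _; rewrite update_same. Qed.

Lemma avgB e F G x : bmfun F -> bmfun G -> avg e (fun y => F y - G y) x = avg e F x - avg e G x.
Proof. by move=> bF bG; rewrite /avg bmRintegralB//; exact: bmfun_update. Qed.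

Lemma avgC e e' F x : bmfun F -> avg e (avg e' F) x = avg e' (avg e F) x.
Proof.
move=> bF; have [<-//|ne] := eqVneq e e'.
have [mF [M FM]] := bF.
have := @Fubini _ _ _ _ R nu nu (fun p => (F (update e' (update e x p.1) p.2))%:E).
have mU : measurable_fun setT (fun p : measurableTypeR R * measurableTypeR R => update e' (update e x p.1) p.2 : V).
  apply: measurable_vec => i; rewrite /update; case: (i == e'); first exact: measurable_snd.
  by case: (i == e); [exact: measurable_fst|].
move=> H; have {}H := H (@bounded_integrable _ _ _ (nu \x nu)%E _ M (measurableT_comp mF mU) (fun=> FM _)).
rewrite {1}/avg {2}/avg /Rintegral; transitivity (fine (\int[nu]_x0 \int[nu]_y (F (update e' (update e x x0) y))%:E)%E).
  by congr fine; apply: eq_integral => t _; rewrite avg_EFin.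
rewrite H; congr fine; apply: eq_integral => t _; rewrite avg_EFin//.
by apply: eq_integral => u _; rewrite updateC// eq_sym.
Qed.

(** The mean of the conditional variance along [e], written as a difference of second moments so
    that successive averages telescope. *)
Definition cvar (e : E) F : R := \int[mu]_x (F x ^+ 2) - \int[mu]_x (avg e F x ^+ 2).

Lemma avgM e F G x : bmfun F -> bmfun G -> avg e (fun y => avg e F y * G y) x = avg e F x * avg e G x.
Proof.
move=> bF bG; rewrite /avg -bmRintegralZ; last exact: bmfun_update.
by apply: eq_Rintegral => t _; congr (_ * _); exact: avg_update.
Qed.

Lemma cvarE e F : bmfun F -> cvar e F = \int[mu]_x ((F x - avg e F x) ^+ 2).
Proof.
move=> bF; have bA := bmfun_avg e bF.
transitivity (\int[mu]_x ((F x ^+ 2 - 2 * (avg e F x * F x)) + avg e F x ^+ 2)); last first.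
  by apply: eq_Rintegral => x _; ring.
have b1 := bmfunX bF; have b2 := bmfunX bA; have b3 := bmfunM bA bF.
have b4 := bmfunZ 2 b3.
rewrite bmRintegralD//; last exact: bmfunB.
rewrite bmRintegralB// bmRintegralZ// -(Rintegral_avg e b3).
rewrite (_ : \int[mu]_x avg e (fun y => avg e F y * F y) x = \int[mu]_x (avg e F x ^+ 2)).
  by rewrite /cvar; ring.
by apply: eq_Rintegral => x _; rewrite avgM.
Qed.

(** Averages over two coordinates commute, so the deviation of [avg e' F] from its [e]-average is
    the [e']-average of the deviation of [F]; averaging does not increase a mean square. *)
Lemma cvar_avg e e' F : bmfun F -> cvar e (avg e' F) <= cvar e F.
Proof.
move=> bF; have bA := bmfun_avg e bF; have bA' := bmfun_avg e' bF.
rewrite !cvarE//.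
have bD : bmfun (fun x => F x - avg e F x) by exact: bmfunB.
rewrite -(Rintegral_avg e' (bmfunX bD)).
apply: bmRintegral_le; [|exact/bmfun_avg/bmfunX|].
  by apply: bmfunX; apply: bmfunB => //; exact: bmfun_avg.
move=> x; rewrite avgC// -avgB//.
exact: (bmRintegral_sqr nu (bmfun_update e' x bD)).
Qed.

Definition avgs (s : seq E) F : V -> R := foldr avg F s.

Lemma bmfun_avgs s F : bmfun F -> bmfun (avgs s F).
Proof. by move=> bF; elim: s => //= e s IH; exact: bmfun_avg. Qed.

Lemma cvar_avgs e s F : bmfun F -> cvar e (avgs s F) <= cvar e F.
Proof.
move=> bF; elim: s => [|e' s IH]; first exact: lexx.
apply: (le_trans _ IH); apply: cvar_avg; exact: bmfun_avgs.
Qed.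

Lemma Rintegral_avgs s F : bmfun F -> \int[mu]_x avgs s F x = \int[mu]_x F x.
Proof.
by move=> bF; elim: s => //= e s <-; rewrite Rintegral_avg//; exact: bmfun_avgs.
Qed.

(** A telescoping sum: averaging over one more coordinate [e] lowers the second moment by
    [cvar e (avgs s F)], which is at most [cvar e F]. *)
Lemma efron_stein_avgs s F : bmfun F ->
  \int[mu]_x (F x ^+ 2) - \int[mu]_x (avgs s F x ^+ 2) <= \sum_(e <- s) cvar e F.
Proof.
move=> bF; elim: s => [|e s IH]; first by rewrite big_nil subrr.
rewrite big_cons /=; have := cvar_avgs e s bF; rewrite {1}/cvar; move: IH; lra.
Qed.

Lemma avgs_update s e F x t : bmfun F -> e \in s -> avgs s F (update e x t) = avgs s F x.
Proof.
move=> bF; elim: s x => // e' s IH x; rewrite inE => /orP[/eqP <-|es] /=.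
  exact: avg_update.
have [<-|ne] := eqVneq e' e; first exact: avg_update.
by apply: eq_Rintegral => u _; rewrite updateC// IH.
Qed.

Lemma avgs_enum_cst F x y : bmfun F -> avgs (enum E) F x = avgs (enum E) F y.
Proof.
move=> bF.
(* [mix s] is [x] with the coordinates in [s] replaced by those of [y]. Changing averaged
   coordinates one at a time leads from [x] to [y] without changing the value. *)
pose mix (s : seq E) := foldr (fun e z => update e z (y e)) x s.
have H s : avgs (enum E) F (mix s) = avgs (enum E) F x.
  by elim: s => //= e s <-; rewrite avgs_update// mem_enum.
rewrite -(H (enum E)); congr (avgs _ _ _); apply/funext => e.
have : e \in enum E by rewrite mem_enum.
elim: (enum E) => //= e' s IH; rewrite inE /update.
by have [->//|ne] := eqVneq e e'.
Qed.

Theorem efron_stein F : bmfun F ->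
  \int[mu]_x (F x ^+ 2) - (\int[mu]_x F x) ^+ 2 <= \sum_e cvar e F.
Proof.
move=> bF; rewrite [leRHS](_ : _ = \sum_(e <- enum E) cvar e F); last by rewrite big_enum.
apply: le_trans (efron_stein_avgs _ bF).
rewrite lerD2l lerN2.
set c := avgs (enum E) F point.
have cE x : avgs (enum E) F x = c by exact: avgs_enum_cst.
rewrite -(Rintegral_avgs (enum E) bF).
under eq_Rintegral do rewrite cE; under [X in _ <= X ^+ 2]eq_Rintegral do rewrite cE.
by rewrite !Rintegral_cst_prob.
Qed.

End product_probability.

Section gaussian_product.
Context (R : realType) (E : finType) (s : R) (s_gt0 : 0 < s).
Notation V := (vecspace R E).
Variable mu : probability V R.
Hypothesis mu_rect : forall B : E -> set R, (forall e, measurable (B e)) ->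
  mu (rect_set B) = (\prod_e normal_prob 0 s (B e))%E.
Implicit Types F G : V -> R.

Definition partial_deriv (e : E) F G :=
  forall x : V, (forall t : R, is_derive t 1 (fun u : R => F (update e x u)) (G (update e x t))) /\
    continuous (fun t : R => G (update e x t)).

Lemma bmfun_common_bound F G : bmfun F -> bmfun G ->
  exists M, (forall x, `|F x| <= M) /\ (forall x, `|G x| <= M).
Proof.
move=> [_ [M FM]] [_ [M' GM]]; exists (Num.max M M').
by split => x; rewrite le_max ?FM ?GM ?orbT.
Qed.

Theorem gauss_poincare F (dF : E -> V -> R) : bmfun F -> (forall e, bmfun (dF e)) ->
  (forall e, partial_deriv e F (dF e)) ->
  \int[mu]_x (F x ^+ 2) - (\int[mu]_x F x) ^+ 2 <=
  16 * s ^+ 2 * \sum_e \int[mu]_x (dF e x ^+ 2).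
Proof.
move=> bF bdF dFE; apply: le_trans (efron_stein mu_rect bF) _.
rewrite mulr_sumr; apply: ler_sum => e _.
have bF2 := bmfunX bF; have bd2 := bmfunX (bdF e).
have bA := bmfun_avg (normal_prob 0 s) mu e bF.
rewrite /cvar -(Rintegral_avg mu_rect e bF2) -(Rintegral_avg mu_rect e bd2).
have bAd := bmfun_avg (normal_prob 0 s) mu e bd2.
rewrite -bmRintegralB; [|exact: bmfun_avg|exact: bmfunX].
rewrite -bmRintegralZ//.
apply: bmRintegral_le; [apply: bmfunB; [exact: bmfun_avg|exact: bmfunX]|exact: bmfunZ|].
move=> x; have [M [FM dM]] := bmfun_common_bound bF (bdF e).
have [d1 c1] := dFE e x.
exact: (@normal_poincare R s _ _ M s_gt0 d1 c1).
Qed.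

Lemma normal_prob_id_integrable :
  (normal_prob 0 s).-integrable [set: measurableTypeR R] (EFin \o (fun t : measurableTypeR R => t)).
Proof. by apply: integrable_normal_prob => //; exact: integrable_id_normal_pdf. Qed.

Lemma coord_integrable (e : E) : mu.-integrable setT (EFin \o (fun x : V => x e : R)).
Proof.
have mX : @measurable_fun _ _ V (measurableTypeR R) setT (fun x => x e) by exact: measurable_coord.
pose X : {mfun V >-> measurableTypeR R} := @mfun_Sub _ _ V (measurableTypeR R) _ (mem_set mX).
apply/integrableP; split; first by apply/measurable_EFinP; exact: measurable_coord.
have := @ge0_integral_distribution _ _ _ _ _ mu X (abse \o EFin).
move=> <-; last 2 first.
- by apply: measurableT_comp => //.
- by move=> y; exact: abse_ge0.
have /integrableP[_] := normal_prob_id_integrable.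
congr (_ < _)%E; apply: eq_measure_integral => B mB _ /=.
rewrite /distribution /pushforward.
have -> : X @^-1` B = rect_set (fun e' => if e' == e then B else setT).
  apply/seteqP; split => x /=.
    by move=> xB e'; case: eqP => [->|].
  by move=> /(_ e); rewrite eqxx.
rewrite mu_rect; last by move=> e'; case: ifP.
rewrite (bigD1 e)//= eqxx big1 ?mule1// => i /negbTE ->.
exact: (@probability_setT _ _ _ (normal_prob 0 s)).
Qed.

Lemma coordM_integrable (e : E) F : bmfun F -> mu.-integrable setT (EFin \o (fun x : V => x e * F x : R)).
Proof.
move=> [mF [M FM]].
have := integrableZl measurableT M (coord_integrable e).
apply: le_integrable => //.
  by apply/measurable_EFinP; apply: measurable_funM => //; exact: measurable_coord.
move=> x _ /=; rewrite lee_fin !normrM mulrC ler_wpM2r//.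
by apply: le_trans (FM x) _; exact: ler_norm.
Qed.

Theorem gauss_ibp (e : E) F (dF : V -> R) : bmfun F -> bmfun dF -> partial_deriv e F dF ->
  \int[mu]_x (x e * F x) = s ^+ 2 * \int[mu]_x dF x.
Proof.
move=> bF bdF dFE.
have mxF : measurable_fun setT (fun x : V => x e * F x).
  by apply: measurable_funM; [exact: measurable_coord|case: bF].
rewrite {1}/Rintegral (integral_update mu_rect e mxF (coordM_integrable e bF)).
rewrite -(Rintegral_avg mu_rect e bdF) -bmRintegralZ; last exact: bmfun_avg.
rewrite /Rintegral; congr fine; apply: eq_integral => x _.
have [M [FM dM]] := bmfun_common_bound bF bdF.
have [d1 c1] := dFE x.
rewrite /avg -(@normal_ibp R s _ _ M s_gt0 d1 c1)// /Rintegral fineK.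
  by apply: eq_integral => t _; rewrite {1}/update eqxx.
apply: integrable_fin_num => //.
have [mU _] := bmfun_update e x bF.
have := integrableZl measurableT M normal_prob_id_integrable.
apply: le_integrable => //.
  by apply/measurable_EFinP; apply: measurable_funM.
move=> t _ /=; rewrite lee_fin !normrM mulrC ler_wpM2r//.
by apply: le_trans (FM _) _; exact: ler_norm.
Qed.

End gaussian_product.

(** * The joint law of finitely many independent variables *)

Section independent_law.
Context (R : realType) (d : measure_display) (T : measurableType d)
  (P : probability T R) (E : finType) (xi : E -> T -> R)
  (nu : probability (measurableTypeR R) R).
Hypothesis mxi : forall e, measurable_fun setT (xi e).
Hypothesis lawxi : forall e (B : set R), measurable B -> P (xi e @^-1` B) = nu B.
Hypothesis indep : forall B : E -> set R, (forall i, measurable (B i)) ->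
    P (\bigcap_i (xi i @^-1` B i)) = (\prod_i P (xi i @^-1` B i))%E.

Definition vec_rv : {mfun T >-> vecspace R E} :=
  mfun_Sub (mem_set (measurable_vec (f := fun w e => xi e w) mxi)).

Lemma distribution_rect (B : E -> set R) : (forall e, measurable (B e)) ->
  distribution P vec_rv (rect_set B) = (\prod_e nu (B e))%E.
Proof.
move=> mB; rewrite /distribution /pushforward.
have -> : vec_rv @^-1` rect_set B = \bigcap_i (xi i @^-1` B i).
  by apply/seteqP; split => w /= H e; [move=> _|]; exact: H.
by rewrite indep//; apply: eq_bigr => e _; exact: lawxi.
Qed.

Lemma Rintegral_vec_rv (F : vecspace R E -> R) : bmfun F ->
  \int[P]_w F (fun e => xi e w) = \int[distribution P vec_rv]_x F x.
Proof.
move=> [mF [M FM]]; rewrite /Rintegral (@integral_distribution _ _ _ _ _ P vec_rv (EFin \o F))//.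
  exact/measurable_EFinP.
apply: (@bounded_integrable _ _ _ P (F \o vec_rv) M) => //.
  by apply: measurableT_comp.
by move=> w; exact: FM.
Qed.

End independent_law.

(** * Complex-valued integrands *)

Local Open Scope complex_scope.
Local Open Scope sesquilinear_scope.

Section squared_modulus.
Context {R : realType}.
Implicit Types (z a b : R[i]) (x : R).

(** The squared modulus as an element of [R], polynomial in the two parts and thus open to real
    arithmetic; the norm of [R[i]] takes its values in [R[i]]. *)
Definition sqn z : R := complex.Re z ^+ 2 + complex.Im z ^+ 2.

Lemma Re_add a b : complex.Re (a + b) = complex.Re a + complex.Re b.
Proof. by case: a; case: b. Qed.
Lemma Im_add a b : complex.Im (a + b) = complex.Im a + complex.Im b.
Proof. by case: a; case: b. Qed.
Lemma Re_opp a : complex.Re (- a) = - complex.Re a.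
Proof. by case: a. Qed.
Lemma Im_opp a : complex.Im (- a) = - complex.Im a.
Proof. by case: a. Qed.
Lemma Re_mul a b : complex.Re (a * b) = complex.Re a * complex.Re b - complex.Im a * complex.Im b.
Proof. by case: a; case: b. Qed.
Lemma Im_mul a b : complex.Im (a * b) = complex.Re a * complex.Im b + complex.Im a * complex.Re b.
Proof. by case: a; case: b. Qed.
Lemma Re_inv a : complex.Re a^-1 = complex.Re a / sqn a.
Proof. by case: a. Qed.
Lemma Im_inv a : complex.Im a^-1 = - (complex.Im a / sqn a).
Proof. by case: a. Qed.
Lemma Re_conj a : complex.Re (Num.conj a) = complex.Re a.
Proof. by case: a. Qed.
Lemma Im_conj a : complex.Im (Num.conj a) = - complex.Im a.
Proof. by case: a. Qed.

Definition ReIm := (Re_add, Im_add, Re_opp, Im_opp, Re_mul, Im_mul, Re_conj, Im_conj).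

Lemma complexP a b : complex.Re a = complex.Re b -> complex.Im a = complex.Im b -> a = b.
Proof. by case: a; case: b => ? ? ? ? /= -> ->. Qed.

Lemma Re_sum (I : Type) (s : seq I) (p : pred I) (F : I -> R[i]) :
  complex.Re (\sum_(i <- s | p i) F i) = \sum_(i <- s | p i) complex.Re (F i).
Proof. by apply: (big_morph _ Re_add); case: R. Qed.

Lemma Im_sum (I : Type) (s : seq I) (p : pred I) (F : I -> R[i]) :
  complex.Im (\sum_(i <- s | p i) F i) = \sum_(i <- s | p i) complex.Im (F i).
Proof. by apply: (big_morph _ Im_add); case: R. Qed.

Lemma sqn_ge0 z : 0 <= sqn z. Proof. by rewrite addr_ge0 ?sqr_ge0. Qed.

Lemma sqnM a b : sqn (a * b) = sqn a * sqn b.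
Proof. by rewrite /sqn !ReIm; ring. Qed.

Lemma sqnN a : sqn (- a) = sqn a.
Proof. by rewrite /sqn !ReIm !sqrrN. Qed.

Lemma sqn_real x : sqn x%:C = x ^+ 2.
Proof. by rewrite /sqn /= expr0n addr0. Qed.

Lemma sqn0 : sqn 0 = 0. Proof. by rewrite /sqn /= expr0n addr0. Qed.
Lemma sqn1 : sqn 1 = 1. Proof. by rewrite /sqn /= expr0n addr0 expr1n. Qed.

Lemma sqn_eq0 a : (sqn a == 0) = (a == 0).
Proof.
apply/idP/eqP => [|->]; last by rewrite sqn0.
rewrite paddr_eq0 ?sqr_ge0// !sqrf_eq0 => /andP[/eqP r0 /eqP i0].
exact: complexP.
Qed.

Lemma sqnV a : sqn a^-1 = (sqn a)^-1.
Proof.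
have [->|a0] := eqVneq a 0; first by rewrite invr0 sqn0 invr0.
have s0 : sqn a != 0 by rewrite sqn_eq0.
by apply: (mulfI s0); rewrite -sqnM !divff// sqn1.
Qed.

Lemma normc_sqn z : normc z = Num.sqrt (sqn z). Proof. by case: z. Qed.

Lemma normc_ge0 z : 0 <= normc z. Proof. by rewrite normc_sqn sqrtr_ge0. Qed.

Lemma sqr_normc z : normc z ^+ 2 = sqn z.
Proof. by rewrite normc_sqn sqr_sqrtr ?sqn_ge0. Qed.

Lemma normc_le z x : 0 <= x -> (normc z <= x) = (sqn z <= x ^+ 2).
Proof. by move=> x0; rewrite -sqr_normc ler_sqr ?nnegrE ?normc_ge0. Qed.

Lemma normc_real x : normc x%:C = `|x|.
Proof. by rewrite normc_sqn sqn_real sqrtr_sqr. Qed.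

Lemma normc_nat (n : nat) : normc (n%:R : R[i]) = n%:R.
Proof. by rewrite -[n%:R](rmorph_nat (real_complex R)) normc_real ger0_norm. Qed.

Lemma normcN z : normc (- z) = normc z.
Proof. by rewrite !normc_sqn sqnN. Qed.

Lemma normcX z n : normc (z ^+ n) = normc z ^+ n.
Proof.
elim: n => [|n IH]; first by rewrite !expr0 normc_sqn sqn1 sqrtr1.
by rewrite !exprS normcM IH.
Qed.

Lemma normrCE z : `|z| = (normc z)%:C. Proof. by case: z. Qed.

Lemma normcD a b : normc (a + b) <= normc a + normc b.
Proof. exact: le_normcD. Qed.

Lemma normcB a b : normc (a - b) <= normc a + normc b.
Proof. by rewrite -(normcN b); exact: normcD. Qed.

Lemma normc_sum (I : Type) (s : seq I) (p : pred I) (F : I -> R[i]) :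
  normc (\sum_(i <- s | p i) F i) <= \sum_(i <- s | p i) normc (F i).
Proof.
elim/big_ind2 : _ => //; first by rewrite normc_sqn sqn0 sqrtr0.
by move=> a x b y ax bY; apply: le_trans (normcD _ _) _; exact: lerD.
Qed.

Lemma Re_le_normc z : `|complex.Re z| <= normc z.
Proof. by rewrite normc_sqn -sqrtr_sqr ler_wsqrtr// lerDl sqr_ge0. Qed.

Lemma Im_le_normc z : `|complex.Im z| <= normc z.
Proof. by rewrite normc_sqn -sqrtr_sqr ler_wsqrtr// lerDr sqr_ge0. Qed.

Lemma normc_le_ReIm z : normc z <= `|complex.Re z| + `|complex.Im z|.
Proof.
rewrite normc_le ?addr_ge0// sqrrD !real_normK ?num_real// /sqn.
have : 0 <= `|complex.Re z| * `|complex.Im z| by exact: mulr_ge0.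
by rewrite -mulr_natr; lra.
Qed.

Lemma normc_gt0 z : (0 < normc z) = (z != 0).
Proof. by rewrite normc_sqn sqrtr_gt0 lt_neqAle sqn_ge0 andbT eq_sym sqn_eq0. Qed.

Lemma mulJ_sqn z : z * Num.conj z = (sqn z)%:C.
Proof. by apply: complexP; rewrite !ReIm /sqn /=; ring. Qed.

End squared_modulus.

Section complex_measurable.
Context (R : realType) (d : measure_display) (T : measurableType d).
Implicit Types F G : T -> R[i].

Definition cmeas F := measurable_fun setT (fun x => complex.Re (F x)) /\
  measurable_fun setT (fun x => complex.Im (F x)).

Definition cbm F := bmfun (fun x => complex.Re (F x)) /\ bmfun (fun x => complex.Im (F x)).

Lemma cmeas_cst (a : R[i]) : cmeas (fun=> a).
Proof. by split; exact: measurable_cst. Qed.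

Lemma cmeasD F G : cmeas F -> cmeas G -> cmeas (fun x => F x + G x).
Proof.
move=> [rF iF] [rG iG]; split.
  by under eq_fun do rewrite Re_add; exact: measurable_funD.
by under eq_fun do rewrite Im_add; exact: measurable_funD.
Qed.

Lemma cmeasM F G : cmeas F -> cmeas G -> cmeas (fun x => F x * G x).
Proof.
move=> [rF iF] [rG iG]; split.
  by under eq_fun do rewrite Re_mul; apply: measurable_funB; exact: measurable_funM.
by under eq_fun do rewrite Im_mul; apply: measurable_funD; exact: measurable_funM.
Qed.

Lemma cmeasJ F : cmeas F -> cmeas (fun x => Num.conj (F x)).
Proof.
move=> [rF iF]; split; first by under eq_fun do rewrite Re_conj.
by under eq_fun do rewrite Im_conj; exact: measurableT_comp.
Qed.

Lemma cmeas_sqn F : cmeas F -> measurable_fun setT (fun x => sqn (F x)).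
Proof.
move=> [rF iF]; apply: measurable_funD; under eq_fun do rewrite expr2;
  exact: measurable_funM.
Qed.

Lemma cmeasV F : cmeas F -> cmeas (fun x => (F x)^-1).
Proof.
move=> mF; have [rF iF] := mF.
have mV : measurable_fun setT (fun x => (sqn (F x))^-1).
  (* On nonnegative reals, 0 included, the inverse is the power of exponent -1, whose measurability
     is known. *)
  rewrite (_ : (fun x => (sqn (F x))^-1) = (fun a => a `^ (-1)) \o (fun x => sqn (F x))).
    by apply: measurableT_comp; [exact: measurable_powR|exact: cmeas_sqn].
  by apply/funext => x /=; rewrite powR_inv1 ?sqn_ge0.
split.
  by under eq_fun do rewrite Re_inv; exact: measurable_funM.
under eq_fun do rewrite Im_inv.
by apply: measurableT_comp => //; exact: measurable_funM.
Qed.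

Lemma cmeas_sum (I : Type) (s : seq I) (p : pred I) (F : I -> T -> R[i]) :
  (forall i, cmeas (F i)) -> cmeas (fun x => \sum_(i <- s | p i) F i x).
Proof.
move=> mF; elim: s => [|i s IH].
  by under eq_fun do rewrite big_nil; exact: cmeas_cst.
under eq_fun do rewrite big_cons; case: (p i) => //; exact: cmeasD.
Qed.

Lemma cmeas_prod (I : Type) (s : seq I) (p : pred I) (F : I -> T -> R[i]) :
  (forall i, cmeas (F i)) -> cmeas (fun x => \prod_(i <- s | p i) F i x).
Proof.
move=> mF; elim: s => [|i s IH].
  by under eq_fun do rewrite big_nil; exact: cmeas_cst.
under eq_fun do rewrite big_cons; case: (p i) => //; exact: cmeasM.
Qed.

Lemma cbmP F (M : R) : cmeas F -> (forall x, sqn (F x) <= M) -> cbm F.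
Proof.
move=> [rF iF] FM.
have H x : normc (F x) <= Num.sqrt M by rewrite normc_sqn ler_wsqrtr.
split; split => //; exists (Num.sqrt M) => x; apply: le_trans (H x).
  exact: Re_le_normc.
exact: Im_le_normc.
Qed.

Lemma cbm_cst (a : R[i]) : cbm (fun=> a).
Proof. by split; exact: bmfun_cst. Qed.

Lemma cbmD F G : cbm F -> cbm G -> cbm (fun x => F x + G x).
Proof.
by move=> [rF iF] [rG iG]; split; [under eq_fun do rewrite Re_add|under eq_fun do rewrite Im_add]; exact: bmfunD.
Qed.

Lemma cbmN F : cbm F -> cbm (fun x => - F x).
Proof.
by move=> [rF iF]; split; [under eq_fun do rewrite Re_opp|under eq_fun do rewrite Im_opp]; exact: bmfunN.
Qed.

Lemma cbmB F G : cbm F -> cbm G -> cbm (fun x => F x - G x).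
Proof. by move=> bF bG; apply: cbmD => //; exact: cbmN. Qed.

Lemma cbmM F G : cbm F -> cbm G -> cbm (fun x => F x * G x).
Proof.
move=> [rF iF] [rG iG]; split; [under eq_fun do rewrite Re_mul|under eq_fun do rewrite Im_mul].
  by apply: bmfunB; exact: bmfunM.
by apply: bmfunD; exact: bmfunM.
Qed.

Lemma cbmZ a F : cbm F -> cbm (fun x => a * F x).
Proof. by move=> bF; apply: cbmM => //; exact: cbm_cst. Qed.

Lemma cbm_sum (I : Type) (s : seq I) (p : pred I) (F : I -> T -> R[i]) :
  (forall i, cbm (F i)) -> cbm (fun x => \sum_(i <- s | p i) F i x).
Proof.
move=> mF; elim: s => [|i s IH].
  by under eq_fun do rewrite big_nil; exact: cbm_cst.
under eq_fun do rewrite big_cons; case: (p i) => //; exact: cbmD.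
Qed.

Lemma bmfun_sqn F : cbm F -> bmfun (fun x => sqn (F x)).
Proof. by move=> [rF iF]; apply: bmfunD; exact: bmfunX. Qed.

Section cexpectation.
Variable P : probability T R.

Lemma cintegralD F G : cbm F -> cbm G ->
  cintegral P (fun x => F x + G x) = cintegral P F + cintegral P G.
Proof.
move=> [rF iF] [rG iG]; apply: complexP; rewrite ?Re_add ?Im_add /=.
  by under eq_Rintegral do rewrite Re_add; exact: bmRintegralD.
by under eq_Rintegral do rewrite Im_add; exact: bmRintegralD.
Qed.

Lemma cintegral_cst a : cintegral P (fun=> a) = a.
Proof. by apply: complexP; rewrite /= Rintegral_cst_prob. Qed.

Lemma cintegralZ a F : cbm F -> cintegral P (fun x => a * F x) = a * cintegral P F.
Proof.
move=> [rF iF]; apply: complexP; rewrite ?Re_mul ?Im_mul /=.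
  under eq_Rintegral do rewrite Re_mul.
  by rewrite bmRintegralB ?bmRintegralZ//; exact: bmfunZ.
under eq_Rintegral do rewrite Im_mul.
by rewrite bmRintegralD ?bmRintegralZ//; exact: bmfunZ.
Qed.

Lemma cintegralN F : cbm F -> cintegral P (fun x => - F x) = - cintegral P F.
Proof. by move=> bF; under [in LHS]eq_fun do rewrite -mulN1r; rewrite cintegralZ// mulN1r. Qed.

Lemma cintegralB F G : cbm F -> cbm G ->
  cintegral P (fun x => F x - G x) = cintegral P F - cintegral P G.
Proof. by move=> bF bG; rewrite cintegralD ?cintegralN//; exact: cbmN. Qed.

Lemma cintegral_sum (I : Type) (s : seq I) (p : pred I) (F : I -> T -> R[i]) :
  (forall i, cbm (F i)) ->
  cintegral P (fun x => \sum_(i <- s | p i) F i x) = \sum_(i <- s | p i) cintegral P (F i).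
Proof.
move=> bF; elim: s => [|i s IH].
  by under [in LHS]eq_fun do rewrite big_nil; rewrite big_nil cintegral_cst.
under [in LHS]eq_fun do rewrite big_cons; rewrite big_cons.
by case: (p i) => //; rewrite cintegralD ?IH//; exact: cbm_sum.
Qed.

Lemma eq_cintegral F G : F =1 G -> cintegral P F = cintegral P G.
Proof. by move=> /funext ->. Qed.

Lemma sqn_cintegral F : cbm F -> sqn (cintegral P F) <= \int[P]_x sqn (F x).
Proof.
move=> [rF iF]; rewrite /sqn bmRintegralD; [|exact: bmfunX|exact: bmfunX].
by apply: lerD; exact: bmRintegral_sqr.
Qed.

Lemma normc_cintegral_le F (M : R) : cbm F -> 0 <= M -> (forall x, normc (F x) <= M) ->
  normc (cintegral P F) <= M.
Proof.
move=> bF M0 FM; rewrite normc_le//; apply: le_trans (sqn_cintegral bF) _.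
rewrite -(Rintegral_cst_prob P (M ^+ 2)); apply: bmRintegral_le.
- exact: bmfun_sqn.
- exact: bmfun_cst.
- by move=> x; rewrite -normc_le.
Qed.

Definition cvariance F := \int[P]_x sqn (F x - cintegral P F).

Lemma cvarianceE F : cbm F -> cvariance F =
  (\int[P]_x (complex.Re (F x) ^+ 2) - (\int[P]_x complex.Re (F x)) ^+ 2) +
  (\int[P]_x (complex.Im (F x) ^+ 2) - (\int[P]_x complex.Im (F x)) ^+ 2).
Proof.
move=> [rF iF].
have H (f : T -> R) : bmfun f ->
    \int[P]_x ((f x - \int[P]_x f x) ^+ 2) = \int[P]_x (f x ^+ 2) - (\int[P]_x f x) ^+ 2.
  move=> bf; set m := \int[P]_x f x.
  transitivity (\int[P]_x ((f x ^+ 2 - (2 * m) * f x) + m ^+ 2)).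
    by apply: eq_Rintegral => x _; ring.
  have b1 := bmfunX bf; have b2 := bmfunZ (2 * m) bf.
  rewrite bmRintegralD; [|exact: bmfunB|exact: bmfun_cst].
  by rewrite bmRintegralB// bmRintegralZ// Rintegral_cst_prob -/m; ring.
rewrite -!H// /cvariance -bmRintegralD; last 2 first.
- by apply/bmfunX/bmfunB => //; exact: bmfun_cst.
- by apply/bmfunX/bmfunB => //; exact: bmfun_cst.
by apply: eq_Rintegral => x _; rewrite /sqn !ReIm.
Qed.

(** The pointwise inequality [2 |a b| <= |a|^2 + |b|^2] plays the role of the Cauchy-Schwarz
    inequality. It bounds the real and the imaginary part by half the sum of variances each, and the
    halves add up. *)
Lemma cov_le F G : cbm F -> cbm G ->
  normc (cintegral P (fun x => (F x - cintegral P F) * G x)) <= cvariance F + cvariance G.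
Proof.
move=> bF bG; set m := cintegral P F; set m' := cintegral P G.
have b1 : cbm (fun x => F x - m) by apply: cbmB => //; exact: cbm_cst.
have b2 : cbm (fun x => G x - m') by apply: cbmB => //; exact: cbm_cst.
have b3 := cbmM b1 b2.
(* [G] may be centred because [F - m] has mean zero. *)
have -> : cintegral P (fun x => (F x - m) * G x) = cintegral P (fun x => (F x - m) * (G x - m')).
  transitivity (cintegral P (fun x => (F x - m) * (G x - m') + m' * (F x - m))).
    by apply: eq_cintegral => x; ring.
  rewrite cintegralD//; last exact: cbmZ.
  by rewrite cintegralZ// cintegralB ?cintegral_cst; [rewrite subrr mulr0 addr0| |exact: cbm_cst].
have bs1 := bmfun_sqn b1; have bs2 := bmfun_sqn b2.
have half (f : T -> R) : bmfun f ->
   (forall x, `|f x| <= 2^-1 * (sqn (F x - m) + sqn (G x - m'))) ->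
   `|\int[P]_x f x| <= 2^-1 * (cvariance F + cvariance G).
  move=> bf H; apply: le_trans (le_normr_Rintegral _ _) _ => //.
    exact: bmfun_integrable.
  rewrite /cvariance -bmRintegralD// -bmRintegralZ; last exact: bmfunD.
  apply: bmRintegral_le => //; last exact/bmfunZ/bmfunD.
  have [mf [M fM]] := bf.
  by split; [exact: measurableT_comp|exists M => t; rewrite normr_id].
apply: le_trans (normc_le_ReIm _) _.
have E (v : R) : 2^-1 * v + 2^-1 * v = v by field.
rewrite -[leRHS]E.
have H x : normc ((F x - m) * (G x - m')) <= 2^-1 * (sqn (F x - m) + sqn (G x - m')).
  rewrite normcM -!sqr_normc; have := sqr_ge0 (normc (F x - m) - normc (G x - m')).
  lra.
have [r3 i3] := b3.
by apply: lerD; apply: half => // x; apply: le_trans (H x); [exact: Re_le_normc|exact: Im_le_normc].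
Qed.

End cexpectation.
End complex_measurable.

Section complex_deriv.
Context {R : realType}.
Implicit Types f g : R -> R[i].

Definition cder f f' := forall t : R,
  is_derive t 1 (fun u => complex.Re (f u)) (complex.Re (f' t)) /\
  is_derive t 1 (fun u => complex.Im (f u)) (complex.Im (f' t)).

Lemma cder_eq f f' g' : cder f f' -> f' =1 g' -> cder f g'.
Proof. by move=> df /funext <-. Qed.

Lemma cder_cst a : cder (fun=> a) (fun=> 0).
Proof. by move=> t; split; exact: is_derive_cst. Qed.

Lemma cder_real : cder (fun t => t%:C) (fun=> 1).
Proof. by move=> t; split; [exact: is_derive_id|exact: is_derive_cst]. Qed.

Lemma cderD f g f' g' : cder f f' -> cder g g' -> cder (fun t => f t + g t) (fun t => f' t + g' t).
Proof.
move=> df dg t; have [rf jf] := df t; have [rg jg] := dg t.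
have -> : (fun u => complex.Re (f u + g u)) = (fun u => complex.Re (f u)) + (fun u => complex.Re (g u)).
  by apply/funext => u; rewrite Re_add.
have -> : (fun u => complex.Im (f u + g u)) = (fun u => complex.Im (f u)) + (fun u => complex.Im (g u)).
  by apply/funext => u; rewrite Im_add.
by rewrite Re_add Im_add; split; exact: is_deriveD.
Qed.

Lemma cderM f g f' g' : cder f f' -> cder g g' ->
  cder (fun t => f t * g t) (fun t => f' t * g t + f t * g' t).
Proof.
move=> df dg t; have [rf jf] := df t; have [rg jg] := dg t.
have -> : (fun u => complex.Re (f u * g u)) = (fun u => complex.Re (f u)) * (fun u => complex.Re (g u)) - (fun u => complex.Im (f u)) * (fun u => complex.Im (g u)).
  by apply/funext => u; rewrite Re_mul.
have -> : (fun u => complex.Im (f u * g u)) = (fun u => complex.Re (f u)) * (fun u => complex.Im (g u)) + (fun u => complex.Im (f u)) * (fun u => complex.Re (g u)).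
  by apply/funext => u; rewrite Im_mul.
split.
  apply: (is_derive_eq (is_deriveB (is_deriveM rf rg) (is_deriveM jf jg))); rewrite !ReIm /GRing.scale /=.
  move: (complex.Re (f t)) (complex.Im (f t)) (complex.Re (g t)) (complex.Im (g t)) => *; ring.
apply: (is_derive_eq (is_deriveD (is_deriveM rf jg) (is_deriveM jf rg))); rewrite !ReIm /GRing.scale /=.
move: (complex.Re (f t)) (complex.Im (f t)) (complex.Re (g t)) (complex.Im (g t)) => *; ring.
Qed.

Lemma cderJ f f' : cder f f' -> cder (fun t => Num.conj (f t)) (fun t => Num.conj (f' t)).
Proof.
move=> df t; have [rf jf] := df t; rewrite Re_conj Im_conj; split.
  by have -> : (fun u => complex.Re (Num.conj (f u))) = (fun u => complex.Re (f u)) by apply/funext => u; rewrite Re_conj.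
have -> : (fun u => complex.Im (Num.conj (f u))) = - (fun u => complex.Im (f u)) by apply/funext => u; rewrite Im_conj.
exact: is_deriveN.
Qed.

(** Existence is all that is recorded: the formula for the derivative of an inverse matrix is later
    deduced from [A A^-1 = 1]. *)
Lemma cderV f f' : cder f f' -> (forall t, f t != 0) ->
  exists g', cder (fun t => (f t)^-1) g'.
Proof.
move=> df f0.
pose S (t : R) := sqn (f t).
have S0 t : S t != 0 by rewrite sqn_eq0.
pose rf u := complex.Re (f u); pose jf u := complex.Im (f u).
have dS (t : R) : exists S', is_derive t 1 S S'.
  have [dr dj] := df t; rewrite -/rf -/jf in dr dj.
  have -> : S = rf ^+ 2 + jf ^+ 2 by apply/funext => u.
  by eexists; apply: is_deriveD.
have dSV (t : R) : exists S', is_derive t 1 (fun u => (S u)^-1) S'.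
  have [S' dS'] := dS t; eexists; exact: (is_deriveV (S0 t)).
have dR (t : R) : exists a, is_derive t 1 (fun u => complex.Re (f u)^-1) a.
  have [V' dV'] := dSV t; have [dr dj] := df t.
  have -> : (fun u => complex.Re (f u)^-1) = rf * (fun u => (S u)^-1) by apply/funext => u; rewrite Re_inv.
  by eexists; exact: is_deriveM.
have dI (t : R) : exists a, is_derive t 1 (fun u => complex.Im (f u)^-1) a.
  have [V' dV'] := dSV t; have [dr dj] := df t.
  have -> : (fun u => complex.Im (f u)^-1) = - (jf * (fun u => (S u)^-1)) by apply/funext => u; rewrite Im_inv.
  by eexists; apply: is_deriveN; exact: is_deriveM.
exists (fun t => (projT1 (cid (dR t))) +i* (projT1 (cid (dI t)))) => t.
by split => /=; case: cid.
Qed.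

Lemma cder_unique f f' g' : cder f f' -> cder f g' -> f' =1 g'.
Proof.
move=> d1 d2 t; have [[_ r1] [_ i1]] := d1 t; have [[_ r2] [_ i2]] := d2 t.
by apply: complexP; [rewrite -r1 -r2|rewrite -i1 -i2].
Qed.

Lemma cder_sum (I : Type) (s : seq I) (p : pred I) (F F' : I -> R -> R[i]) :
  (forall i, cder (F i) (F' i)) ->
  cder (fun t => \sum_(i <- s | p i) F i t) (fun t => \sum_(i <- s | p i) F' i t).
Proof.
move=> dF; elim: s => [|i s IH].
  under eq_fun do rewrite big_nil.
  by apply: cder_eq; [exact: cder_cst|move=> t; rewrite big_nil].
have E (G : I -> R -> R[i]) : (fun t => \sum_(j <- i :: s | p j) G j t) =
    (fun t => if p i then G i t + \sum_(j <- s | p j) G j t else \sum_(j <- s | p j) G j t).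
  by apply/funext => t; rewrite big_cons.
rewrite !E.
by case: (p i) => //; exact: cderD.
Qed.

Lemma cder_prod (I : Type) (s : seq I) (p : pred I) (F : I -> R -> R[i]) :
  (forall i, exists g', cder (F i) g') ->
  exists g', cder (fun t => \prod_(i <- s | p i) F i t) g'.
Proof.
move=> dF; elim: s => [|i s [G IH]].
  by exists (fun=> 0); under eq_fun do rewrite big_nil; exact: cder_cst.
have [F' dF'] := dF i.
rewrite (_ : (fun t => \prod_(j <- i :: s | p j) F j t) =
    (fun t => if p i then F i t * \prod_(j <- s | p j) F j t else \prod_(j <- s | p j) F j t)).
  by case: (p i); eexists; [exact: cderM|exact: IH].
by apply/funext => t; rewrite big_cons.
Qed.

Lemma cder_continuous f f' : cder f f' ->
  continuous (fun t => complex.Re (f t)) /\ continuous (fun t => complex.Im (f t)).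
Proof.
move=> df; split => t; have [[r _] [i _]] := df t;
  by apply: differentiable_continuous; apply/derivable1_diffP.
Qed.

End complex_deriv.

Lemma sqr_normrC (R : realType) (z : R[i]) : `|z| ^+ 2 = (sqn z)%:C.
Proof. by rewrite normCK mulJ_sqn. Qed.

Section matrix_functions.
Context {R : realType}.
Local Notation C := R[i].

Section measurability.
Context (d : measure_display) (T : measurableType d).

Definition mcmeas m n (A : T -> 'M[C]_(m, n)) := forall i j, cmeas (fun x => A x i j).
Definition mcbm m n (A : T -> 'M[C]_(m, n)) := forall i j, cbm (fun x => A x i j).

Lemma mcmeas_cst m n (A : 'M[C]_(m, n)) : mcmeas (fun=> A).
Proof. by move=> i j; exact: cmeas_cst. Qed.

Lemma mcmeasM m n p (A : T -> 'M[C]_(m, n)) (B : T -> 'M[C]_(n, p)) :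
  mcmeas A -> mcmeas B -> mcmeas (fun x => A x *m B x).
Proof.
move=> mA mB i j; rewrite (_ : (fun x => _) = (fun x => \sum_k A x i k * B x k j)).
  by apply: cmeas_sum => k; exact: cmeasM.
by apply/funext => x; rewrite mxE.
Qed.

Lemma mcmeasD m n (A B : T -> 'M[C]_(m, n)) :
  mcmeas A -> mcmeas B -> mcmeas (fun x => A x + B x).
Proof.
move=> mA mB i j; rewrite (_ : (fun x => _) = (fun x => A x i j + B x i j)).
  exact: cmeasD.
by apply/funext => x; rewrite mxE.
Qed.

Lemma mcmeasJ m n (A : T -> 'M[C]_(m, n)) : mcmeas A -> mcmeas (fun x => (A x)^t*).
Proof.
move=> mA i j; rewrite (_ : (fun x => _) = (fun x => Num.conj (A x j i))).
  exact: cmeasJ.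
by apply/funext => x; rewrite adjE.
Qed.

Lemma cmeas_det n (A : T -> 'M[C]_n) : mcmeas A -> cmeas (fun x => \det (A x)).
Proof.
move=> mA; rewrite /determinant; apply: cmeas_sum => s.
by apply: cmeasM; [exact: cmeas_cst|apply: cmeas_prod => i; exact: mA].
Qed.

(** Cramer's rule makes each entry of the inverse a quotient of polynomials in the entries of [A].
    The measurability of the empirical Stieltjes transform comes from here. *)
Lemma mcmeasV n (A : T -> 'M[C]_n) : mcmeas A -> (forall x, A x \in unitmx) ->
  mcmeas (fun x => invmx (A x)).
Proof.
move=> mA uA i j.
rewrite (_ : (fun x => _) = (fun x => (\det (A x))^-1 * ((-1) ^+ (j + i) * \det (row' j (col' i (A x)))))).
  apply: cmeasM; first by apply: cmeasV; exact: cmeas_det.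
  apply: cmeasM; first exact: cmeas_cst.
  apply: cmeas_det => k l; rewrite (_ : (fun x => _) = (fun x => A x (lift j k) (lift i l))).
    exact: mA.
  by apply/funext => x; rewrite !mxE.
by apply/funext => x; rewrite /invmx uA !mxE.
Qed.

Lemma mcbm_cst m n (A : 'M[C]_(m, n)) : mcbm (fun=> A).
Proof. by move=> i j; exact: cbm_cst. Qed.

Lemma mcbmM m n p (A : T -> 'M[C]_(m, n)) (B : T -> 'M[C]_(n, p)) :
  mcbm A -> mcbm B -> mcbm (fun x => A x *m B x).
Proof.
move=> mA mB i j; rewrite (_ : (fun x => _) = (fun x => \sum_k A x i k * B x k j)).
  by apply: cbm_sum => k; exact: cbmM.
by apply/funext => x; rewrite mxE.
Qed.

Lemma mcbmD m n (A B : T -> 'M[C]_(m, n)) :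
  mcbm A -> mcbm B -> mcbm (fun x => A x + B x).
Proof.
move=> mA mB i j; rewrite (_ : (fun x => _) = (fun x => A x i j + B x i j)).
  exact: cbmD.
by apply/funext => x; rewrite mxE.
Qed.

Lemma mcbmN m n (A : T -> 'M[C]_(m, n)) : mcbm A -> mcbm (fun x => - A x).
Proof.
move=> mA i j; rewrite (_ : (fun x => _) = (fun x => - A x i j)).
  exact: cbmN.
by apply/funext => x; rewrite mxE.
Qed.

Lemma mcbmZ m n (a : T -> C) (A : T -> 'M[C]_(m, n)) : cbm a -> mcbm A -> mcbm (fun x => a x *: A x).
Proof.
move=> ma mA i j; rewrite (_ : (fun x => _) = (fun x => a x * A x i j)).
  exact: cbmM.
by apply/funext => x; rewrite mxE.
Qed.

Lemma cbm_tr n (A : T -> 'M[C]_n) : mcbm A -> cbm (fun x => \tr (A x)).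
Proof. by move=> mA; apply: cbm_sum => i; exact: mA. Qed.

Lemma mcbm_F2 m n (A : T -> 'M[C]_(m, n)) (M : R) : mcmeas A -> (forall x, F2 (A x) <= M%:C) -> mcbm A.
Proof.
move=> mA FM i j; apply: (@cbmP _ _ _ _ M); first exact: mA.
move=> x; rewrite -lecR; apply: le_trans (FM x).
by rewrite -sqr_normrC; exact: F2_ge_coef.
Qed.

Section expectation.
Variable P : probability T R.

Definition mE m n (A : T -> 'M[C]_(m, n)) : 'M[C]_(m, n) :=
  \matrix_(i, j) cintegral P (fun x => A x i j).

Lemma mED m n (A B : T -> 'M[C]_(m, n)) : mcbm A -> mcbm B ->
  mE (fun x => A x + B x) = mE A + mE B.
Proof.
move=> mA mB; apply/matrixP => i j; rewrite !mxE -cintegralD//.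
by apply: eq_cintegral => x; rewrite mxE.
Qed.

Lemma mEN m n (A : T -> 'M[C]_(m, n)) : mcbm A -> mE (fun x => - A x) = - mE A.
Proof.
move=> mA; apply/matrixP => i j; rewrite !mxE -cintegralN//.
by apply: eq_cintegral => x; rewrite mxE.
Qed.

Lemma mE_cst m n (A : 'M[C]_(m, n)) : mE (fun=> A) = A.
Proof. by apply/matrixP => i j; rewrite mxE cintegral_cst. Qed.

Lemma mEZ m n a (A : T -> 'M[C]_(m, n)) : mcbm A -> mE (fun x => a *: A x) = a *: mE A.
Proof.
move=> mA; apply/matrixP => i j; rewrite !mxE -cintegralZ//.
by apply: eq_cintegral => x; rewrite mxE.
Qed.

Lemma mEMl m n p (B : 'M[C]_(m, n)) (A : T -> 'M[C]_(n, p)) : mcbm A ->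
  mE (fun x => B *m A x) = B *m mE A.
Proof.
move=> mA; apply/matrixP => i j; rewrite !mxE.
transitivity (cintegral P (fun x => \sum_k B i k * A x k j)).
  by apply: eq_cintegral => x; rewrite mxE.
rewrite cintegral_sum; last by move=> k; apply: cbmZ; exact: mA.
by apply: eq_bigr => k _; rewrite mxE cintegralZ//; exact: mA.
Qed.

Lemma mE_tr n (A : T -> 'M[C]_n) : mcbm A -> \tr (mE A) = cintegral P (fun x => \tr (A x)).
Proof.
move=> mA; rewrite /mxtrace cintegral_sum; last by move=> i; exact: mA.
by apply: eq_bigr => i _; rewrite mxE.
Qed.

Lemma mE_sum m n (I : Type) (s : seq I) (p : pred I) (A : I -> T -> 'M[C]_(m, n)) :
  (forall i, mcbm (A i)) ->
  mE (fun x => \sum_(i <- s | p i) A i x) = \sum_(i <- s | p i) mE (A i).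
Proof.
move=> mA; apply/matrixP => i j; rewrite summxE mxE.
transitivity (cintegral P (fun x => \sum_(k <- s | p k) A k x i j)).
  by apply: eq_cintegral => x; rewrite summxE.
rewrite cintegral_sum; last by move=> k; exact: mA.
by apply: eq_bigr => k _; rewrite mxE.
Qed.

End expectation.
End measurability.

Section differentiation.

Definition mder m n (A A' : R -> 'M[C]_(m, n)) :=
  forall i j, cder (fun t => A t i j) (fun t => A' t i j).

Lemma mder_eq m n (A A' B' : R -> 'M[C]_(m, n)) : mder A A' -> A' =1 B' -> mder A B'.
Proof. by move=> dA /funext <-. Qed.

Lemma mder_cst m n (A : 'M[C]_(m, n)) : mder (fun=> A) (fun=> 0).
Proof. by move=> i j; apply: cder_eq; [exact: cder_cst|move=> t; rewrite mxE]. Qed.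

Lemma mderD m n (A A' B B' : R -> 'M[C]_(m, n)) : mder A A' -> mder B B' ->
  mder (fun t => A t + B t) (fun t => A' t + B' t).
Proof.
move=> dA dB i j; rewrite (_ : (fun t => _) = (fun t => A t i j + B t i j)).
  by apply: cder_eq; [exact: cderD|move=> t; rewrite mxE].
by apply/funext => t; rewrite mxE.
Qed.

Lemma mderM m n p (A A' : R -> 'M[C]_(m, n)) (B B' : R -> 'M[C]_(n, p)) :
  mder A A' -> mder B B' ->
  mder (fun t => A t *m B t) (fun t => A' t *m B t + A t *m B' t).
Proof.
move=> dA dB i j; rewrite (_ : (fun t => _) = (fun t => \sum_k A t i k * B t k j)).
  apply: cder_eq; first by apply: cder_sum => k; exact: (cderM (dA i k) (dB k j)).
  by move=> t; rewrite !mxE -big_split.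
by apply/funext => t; rewrite mxE.
Qed.

Lemma mderMl m n p (B : 'M[C]_(m, n)) (A A' : R -> 'M[C]_(n, p)) :
  mder A A' -> mder (fun t => B *m A t) (fun t => B *m A' t).
Proof.
move=> dA; apply: mder_eq; first by apply: mderM => //; exact: mder_cst.
by move=> t; rewrite mul0mx add0r.
Qed.

Lemma mderMr m n p (B : 'M[C]_(n, p)) (A A' : R -> 'M[C]_(m, n)) :
  mder A A' -> mder (fun t => A t *m B) (fun t => A' t *m B).
Proof.
move=> dA; apply: mder_eq; first by apply: mderM => //; exact: mder_cst.
by move=> t; rewrite mulmx0 addr0.
Qed.

Lemma mderJ m n (A A' : R -> 'M[C]_(m, n)) : mder A A' ->
  mder (fun t => (A t)^t*) (fun t => (A' t)^t*).
Proof.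
move=> dA i j; rewrite (_ : (fun t => _) = (fun t => Num.conj (A t j i))).
  by apply: cder_eq; [exact: cderJ|move=> t; rewrite adjE].
by apply/funext => t; rewrite adjE.
Qed.

Lemma mder_line m n (A B : 'M[C]_(m, n)) : mder (fun t => A + t%:C *: B) (fun=> B).
Proof.
move=> i j; rewrite (_ : (fun t => _) = (fun t => A i j + t%:C * B i j)).
  apply: cder_eq.
    by apply: cderD; [exact: cder_cst|apply: cderM; [exact: cder_real|exact: cder_cst]].
  by move=> t /=; rewrite mul1r mulr0 addr0 add0r.
by apply/funext => t; rewrite !mxE.
Qed.

Lemma cder_det n (A : R -> 'M[C]_n) : (exists A', mder A A') ->
  exists g', cder (fun t => \det (A t)) g'.
Proof.
move=> [A' dA]; rewrite /determinant.
have H (s : 'S_n) : exists g', cder (fun t => (-1) ^+ s * \prod_i A t i (s i)) g'.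
  have [g' dg] := @cder_prod R _ (index_enum 'I_n) predT (fun i t => A t i (s i)) (fun i => ex_intro _ _ (dA i (s i))).
  by eexists; apply: cderM; [exact: cder_cst|exact: dg].
exists (fun t => \sum_(s : 'S_n) projT1 (cid (H s)) t).
by apply: cder_sum => s; case: cid.
Qed.

(** Cramer's rule shows that the entries of the inverse are differentiable; the value of the
    derivative then follows by differentiating [A A^-1 = 1]. *)
Lemma mder_inv n (A A' : R -> 'M[C]_n) : (forall t, A t \in unitmx) -> mder A A' ->
  mder (fun t => invmx (A t)) (fun t => - (invmx (A t) *m A' t *m invmx (A t))).
Proof.
move=> uA dA.
have ex i j : exists g', cder (fun t => invmx (A t) i j) g'.
  rewrite (_ : (fun t => _) = (fun t => (\det (A t))^-1 * ((-1) ^+ (j + i) * \det (row' j (col' i (A t)))))).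
    have [d1 D1] := cder_det (ex_intro _ _ dA).
    have [d2 D2] : exists g', cder (fun t => \det (row' j (col' i (A t)))) g'.
      apply: cder_det; exists (fun t => row' j (col' i (A' t))) => k l.
      rewrite (_ : (fun t => _) = (fun t => A t (lift j k) (lift i l))).
        by apply: cder_eq; [exact: dA|move=> t; rewrite !mxE].
      by apply/funext => t; rewrite !mxE.
    have [d3 D3] := cderV D1 (fun t => eq_ind _ (fun b => is_true b) (uA t) _ (etrans (unitmxE (A t)) (unitfE _))).
    by eexists; apply: cderM; [exact: D3|apply: cderM; [exact: cder_cst|exact: D2]].
  by apply/funext => t; rewrite /invmx uA !mxE.
pose B' t := \matrix_(i, j) projT1 (cid (ex i j)) t.
have dB : mder (fun t => invmx (A t)) B'.
  move=> i j; apply: cder_eq; first exact: (projT2 (cid (ex i j))).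
  by move=> t; rewrite mxE.
apply: mder_eq; first exact: dB.
move=> t; have dI := mderM dA dB.
have d1 : mder (fun t => A t *m invmx (A t)) (fun=> 0).
  rewrite (_ : (fun t => _) = (fun=> 1%:M)); first exact: mder_cst.
  by apply/funext => u; rewrite mulmxV.
have /eqP : A' t *m invmx (A t) + A t *m B' t = 0.
  by apply/matrixP => i j; rewrite -[RHS](cder_unique (dI i j) (d1 i j) t).
rewrite addrC addr_eq0 => /eqP E.
by rewrite -[LHS](mulKmx (uA t)) E mulmxN mulmxA.
Qed.

Lemma cder_tr n (A A' : R -> 'M[C]_n) : mder A A' -> cder (fun t => \tr (A t)) (fun t => \tr (A' t)).
Proof. by move=> dA; apply: cder_sum => i; exact: dA. Qed.

End differentiation.
End matrix_functions.

(** * The resolvent of a Gaussian sample covariance matrix *)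

Lemma mxtrace_mulZ (C : numClosedFieldType) n (a b : C) (D S Q : 'M[C]_n) :
  b * \tr (D *m (a *: (S *m S *m Q))) = a * (b * \tr (Q *m (D *m (S *m S)))).
Proof.
rewrite -scalemxAr mxtraceZ mulrCA; congr (_ * (_ * _)).
by rewrite [RHS]mxtrace_mulC !mulmxA.
Qed.

Section complex_gaussian_product.
Context (R : realType) (E : finType) (s : R) (s_gt0 : 0 < s).
Notation V := (vecspace R E).
Variable mu : probability V R.
Hypothesis mu_rect : forall B : E -> set R, (forall e, measurable (B e)) ->
  mu (rect_set B) = (\prod_e normal_prob 0 s (B e))%E.

(** The derivative is asked to be differentiable in turn, as a convenient way to have the continuity
    that the one-dimensional lemmas require. *)
Definition cpartial (e : E) (F G : V -> R[i]) := forall x : V,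
  cder (fun t => F (update e x t)) (fun t => G (update e x t)) /\
  exists G', cder (fun t => G (update e x t)) G'.

Lemma cpartial_Re e F G : cpartial e F G ->
  partial_deriv e (fun x => complex.Re (F x)) (fun x => complex.Re (G x)).
Proof.
move=> H x; have [d1 [G' d2]] := H x; split; first by move=> t; case: (d1 t).
by case: (cder_continuous d2).
Qed.

Lemma cpartial_Im e F G : cpartial e F G ->
  partial_deriv e (fun x => complex.Im (F x)) (fun x => complex.Im (G x)).
Proof.
move=> H x; have [d1 [G' d2]] := H x; split; first by move=> t; case: (d1 t).
by case: (cder_continuous d2).
Qed.

Theorem cgauss_poincare (F : V -> R[i]) (dF : E -> V -> R[i]) : cbm F -> (forall e, cbm (dF e)) ->
  (forall e, cpartial e F (dF e)) ->
  cvariance mu F <= 16 * s ^+ 2 * \int[mu]_x \sum_e sqn (dF e x).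
Proof.
move=> bF bdF dFE; rewrite cvarianceE//.
have [bR bI] := bF.
rewrite bmRintegral_sum; last by move=> e; exact: bmfun_sqn.
rewrite (eq_bigr (fun e => \int[mu]_x (complex.Re (dF e x) ^+ 2) + \int[mu]_x (complex.Im (dF e x) ^+ 2))); last first.
  by move=> e _; have [? ?] := bdF e; rewrite /sqn bmRintegralD//; exact: bmfunX.
rewrite big_split mulrDr; apply: lerD.
  apply: (gauss_poincare s_gt0 mu_rect bR (dF := fun e x => complex.Re (dF e x))).
    by move=> e; case: (bdF e).
  by move=> e; exact: cpartial_Re.
apply: (gauss_poincare s_gt0 mu_rect bI (dF := fun e x => complex.Im (dF e x))).
  by move=> e; case: (bdF e).
by move=> e; exact: cpartial_Im.
Qed.

(** The summands are unbounded because of the factors [x e], so additivity rests on the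
    integrability of each product. *)
Lemma Rintegral_sum_coord (F : E -> V -> R) : (forall e, bmfun (F e)) ->
  \int[mu]_x (\sum_e x e * F e x) = \sum_e \int[mu]_x (x e * F e x).
Proof.
move=> bF; rewrite /Rintegral.
rewrite (eq_integral (fun x : V => \sum_e (x e * F e x)%:E)%E); last first.
  by move=> x _; rewrite sumEFin.
rewrite integral_sum//; last first.
  by move=> e; exact: (coordM_integrable s_gt0 mu_rect e (bF e)).
rewrite (eq_bigr (fun e => (fine (\int[mu]_x (x e * F e x)%:E))%:E)%E); last first.
  move=> e _; rewrite fineK//; apply: integrable_fin_num => //.
  exact: (coordM_integrable s_gt0 mu_rect e (bF e)).
by rewrite sumEFin.
Qed.

Theorem cgauss_ibp_sum (F dF : E -> V -> R[i]) : (forall e, cbm (F e)) -> (forall e, cbm (dF e)) ->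
  (forall e, cpartial e (F e) (dF e)) ->
  cintegral mu (fun x => \sum_e (x e)%:C * F e x) =
  (s ^+ 2)%:C * \sum_e cintegral mu (dF e).
Proof.
move=> bF bdF dFE.
apply: complexP.
  rewrite Re_mul /= mul0r subr0 Re_sum.
  under eq_Rintegral do rewrite Re_sum.
  transitivity (\int[mu]_x (\sum_e x e * complex.Re (F e x))).
    by apply: eq_Rintegral => x _; apply: eq_bigr => e _; rewrite Re_mul /= mul0r subr0.
  rewrite Rintegral_sum_coord; last by move=> e; case: (bF e).
  rewrite mulr_sumr; apply: eq_bigr => e _.
  apply: (gauss_ibp s_gt0 mu_rect); [by case: (bF e)|by case: (bdF e)|exact: cpartial_Re].
rewrite Im_mul /= mul0r addr0 Im_sum.
under eq_Rintegral do rewrite Im_sum.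
transitivity (\int[mu]_x (\sum_e x e * complex.Im (F e x))).
  by apply: eq_Rintegral => x _; apply: eq_bigr => e _; rewrite Im_mul /= mul0r addr0.
rewrite Rintegral_sum_coord; last by move=> e; case: (bF e).
rewrite mulr_sumr; apply: eq_bigr => e _.
apply: (gauss_ibp s_gt0 mu_rect); [by case: (bF e)|by case: (bdF e)|exact: cpartial_Im].
Qed.

Lemma mgauss_ibp m p (A dA : E -> V -> 'M[R[i]]_(m, p)) :
  (forall e, mcbm (A e)) -> (forall e, mcbm (dA e)) ->
  (forall e i j, cpartial e (fun x => A e x i j) (fun x => dA e x i j)) ->
  mE mu (fun x => \sum_e (x e)%:C *: A e x) = (s ^+ 2)%:C *: mE mu (fun x => \sum_e dA e x).
Proof.
move=> bA bdA dAE; rewrite mE_sum//; apply/matrixP => i j; rewrite !mxE summxE.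
transitivity (cintegral mu (fun x => \sum_e (x e)%:C * A e x i j)).
  by apply: eq_cintegral => x; rewrite summxE; apply: eq_bigr => e _; rewrite mxE.
rewrite (cgauss_ibp_sum (dF := fun e x => dA e x i j)) //.
- by congr (_ * _); apply: eq_bigr => e _; rewrite mxE.
- by move=> e; exact: bA.
- by move=> e; exact: bdA.
Qed.

End complex_gaussian_product.

Section nonreal_shift.
Context {R : realType}.
Local Notation C := R[i].
Variable z : C.
Hypothesis z_im : complex.Im z != 0.
Let y := `|complex.Im z|^-1.

Lemma im_le_shift (r : R) : complex.Im z ^+ 2 <= sqn (r%:C - z).
Proof. by rewrite /sqn !ReIm /= sub0r sqrrN lerDr sqr_ge0. Qed.

Lemma shift_neq0 (r : R) : r%:C - z != 0.
Proof.
rewrite -sqn_eq0 gt_eqF//; apply: lt_le_trans (im_le_shift r).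
by rewrite exprn_even_gt0.
Qed.

Lemma sqn_shiftV (r : R) : sqn ((r%:C - z)^-1) <= y ^+ 2.
Proof.
rewrite sqnV /y exprVn real_normK ?num_real// lef_pV2 ?posrE; first exact: im_le_shift.
  by rewrite lt_neqAle sqn_ge0 eq_sym sqn_eq0 shift_neq0.
by rewrite exprn_even_gt0.
Qed.

Lemma normc_shiftV (r : R) : normc ((r%:C - z)^-1) <= y.
Proof. by rewrite normc_le ?sqn_shiftV// invr_ge0. Qed.

(** From [r <= |r - z| + |z|]. It keeps [H Q] bounded however large the eigenvalues of the sample
    covariance [H] are. *)
Lemma ratio_bound (r : R) : 0 <= r -> r * normc ((r%:C - z)^-1) <= 1 + normc z * y.
Proof.
move=> r0.
have e1 : r <= normc (r%:C - z) + normc z.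
  by rewrite -{1}(ger0_norm r0) -normc_real -{1}(subrK z r%:C); exact: normcD.
have a0 : 0 < normc (r%:C - z) by rewrite normc_gt0 shift_neq0.
apply: le_trans (ler_wpM2r (normc_ge0 _) e1) _.
rewrite mulrDl {1}normcV divff ?gt_eqF// lerD2l.
by rewrite ler_wpM2l ?normc_ge0// normc_shiftV.
Qed.

Lemma ge0_complexP (r : C) : 0 <= r -> exists2 a : R, 0 <= a & r = a%:C.
Proof. by case: r => a b; rewrite lecE /= => /andP[/eqP -> a0]; exists a. Qed.

Lemma shift_pos (r : C) : 0 <= r -> r - z != 0.
Proof. by move=> /ge0_complexP[a _ ->]; exact: shift_neq0. Qed.

Lemma shift_b (r : C) : 0 <= r -> `|(r - z)^-1| ^+ 2 <= (y ^+ 2)%:C.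
Proof. by move=> /ge0_complexP[a _ ->]; rewrite sqr_normrC lecR; exact: sqn_shiftV. Qed.

Lemma shift_w (r : C) : 0 <= r -> r * `|(r - z)^-1| ^+ 2 <= (y * (1 + normc z * y))%:C.
Proof.
move=> /ge0_complexP[a a0 ->]; rewrite sqr_normrC -rmorphM lecR -sqr_normc expr2.
by rewrite mulrCA ler_pM ?mulr_ge0 ?normc_ge0// ?ratio_bound// normc_shiftV.
Qed.

Lemma shift_w2 (r : C) : 0 <= r -> r ^+ 2 * `|(r - z)^-1| ^+ 2 <= ((1 + normc z * y) ^+ 2)%:C.
Proof.
move=> /ge0_complexP[a a0 ->]; rewrite sqr_normrC -rmorphXn -rmorphM lecR -sqr_normc -exprMn.
by rewrite lerXn2r ?nnegrE ?mulr_ge0 ?normc_ge0// ?addr_ge0 ?mulr_ge0 ?normc_ge0 ?invr_ge0// ratio_bound.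
Qed.

End nonreal_shift.

(** * Variance of resolvent traces and the equation for the mean resolvent *)

Section gaussian_matrix.
Context (R : realType) (n k : nat).
Local Notation C := R[i].
Local Notation E := ('I_n * 'I_k * bool)%type.
Local Notation V := (vecspace R E).
Variables (S : 'M[C]_n) (z : C).
Hypothesis S_herm : S^t* = S.
Hypothesis z_im : complex.Im z != 0.

Definition entries_mx (x : V) : 'M[C]_(n, k) :=
  \matrix_(i, j) (x (i, j, false) +i* x (i, j, true)).

Definition data_mx (x : V) : 'M[C]_(n, k) := S *m entries_mx x.

Let Y := data_mx.
Let Q x : 'M[C]_n := resolvent (Y x *m (Y x)^t* ) z.

Lemma entries_mx_sum x : entries_mx x = \sum_(e : E) (x e)%:C *: entry_dir e.
Proof.
rewrite sum_entry_dir; apply/matrixP => i j; rewrite !mxE.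
by apply: complexP; rewrite !ReIm -complexiE /=; ring.
Qed.

Lemma entries_mx_update e x t :
  entries_mx (update e x t) = entries_mx (update e x 0) + t%:C *: entry_dir e.
Proof.
rewrite !entries_mx_sum (bigD1 e)//= [X in _ = X + _](bigD1 e)//= /update eqxx rmorph0 scale0r add0r addrC.
by congr (_ + _); apply: eq_bigr => e' /negbTE ->.
Qed.

Lemma mder_data e x : mder (fun t => Y (update e x t)) (fun=> S *m entry_dir e).
Proof.
rewrite (_ : (fun t => _) = (fun t => S *m (entries_mx (update e x 0) + t%:C *: entry_dir e))).
  by apply: mderMl; exact: mder_line.
by apply/funext => t; rewrite -entries_mx_update.
Qed.

Let B e : 'M[C]_(n, k) := S *m entry_dir e.

Lemma resolvent_unit x : Y x *m (Y x)^t* - z%:M \in unitmx.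
Proof. by apply: gram_shift_unit; exact: shift_pos. Qed.

Lemma mder_resolvent e x : mder (fun t => Q (update e x t))
  (fun t => - (Q (update e x t) *m (B e *m (Y (update e x t))^t* + Y (update e x t) *m (B e)^t* ) *m Q (update e x t))).
Proof.
have dY := mder_data e x.
apply: mder_eq.
  apply: mder_inv; first by move=> t; exact: resolvent_unit.
  apply: mderD; first by apply: mderM; [exact: dY|apply: mderJ; exact: dY].
  exact: mder_cst.
by move=> t /=; rewrite addr0.
Qed.

Lemma mcmeas_entries : mcmeas entries_mx.
Proof.
move=> i j; split.
  by rewrite (_ : (fun x => _) = (fun x : V => x (i, j, false))); [exact: measurable_coord|apply/funext => x; rewrite mxE].
by rewrite (_ : (fun x => _) = (fun x : V => x (i, j, true))); [exact: measurable_coord|apply/funext => x; rewrite mxE].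
Qed.

Lemma mcmeas_data : mcmeas Y.
Proof. by apply: mcmeasM; [exact: mcmeas_cst|exact: mcmeas_entries]. Qed.

Lemma mcmeas_resolvent : mcmeas Q.
Proof.
apply: mcmeasV; last exact: resolvent_unit.
apply: mcmeasD; last exact: mcmeas_cst.
by apply: mcmeasM; [exact: mcmeas_data|apply: mcmeasJ; exact: mcmeas_data].
Qed.

Let y := `|complex.Im z|^-1.

Lemma mcbm_resolvent : mcbm Q.
Proof.
apply: (@mcbm_F2 _ _ _ _ _ _ (n%:R * y ^+ 2)); first exact: mcmeas_resolvent.
move=> x; rewrite rmorphM rmorph_nat.
by apply: F2_resolvent; [exact: shift_pos|exact: shift_b].
Qed.

Lemma mcbm_resolvent_data : mcbm (fun x => Q x *m Y x).
Proof.
apply: (@mcbm_F2 _ _ _ _ _ _ (n%:R * (y * (1 + normc z * y)))).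
  by apply: mcmeasM; [exact: mcmeas_resolvent|exact: mcmeas_data].
move=> x; rewrite rmorphM rmorph_nat.
by apply: F2_resolvent_data; [exact: shift_pos|exact: shift_w].
Qed.

Lemma mcbm_data_resolvent : mcbm (fun x => (Y x)^t* *m Q x).
Proof.
apply: (@mcbm_F2 _ _ _ _ _ _ (n%:R * (y * (1 + normc z * y)))).
  by apply: mcmeasM; [apply: mcmeasJ; exact: mcmeas_data|exact: mcmeas_resolvent].
move=> x; rewrite rmorphM rmorph_nat.
by apply: F2_data_resolvent; [exact: shift_pos|exact: shift_w].
Qed.

Lemma mcbm_data_resolvent_data : mcbm (fun x => (Y x)^t* *m Q x *m Y x).
Proof.
apply: (@mcbm_F2 _ _ _ _ _ _ (n%:R * ((1 + normc z * y) ^+ 2))).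
  apply: mcmeasM; last exact: mcmeas_data.
  by apply: mcmeasM; [apply: mcmeasJ; exact: mcmeas_data|exact: mcmeas_resolvent].
move=> x; rewrite rmorphM rmorph_nat.
by apply: F2_data_resolvent_data; [exact: shift_pos|exact: shift_w2].
Qed.

(** Minus the partial derivative of the resolvent along the coordinate [e]. *)
Definition dresolvent e x : 'M[C]_n := Q x *m (B e *m (Y x)^t* + Y x *m (B e)^t* ) *m Q x.

Lemma mder_dresolvent e x : exists A', mder (fun t => dresolvent e (update e x t)) A'.
Proof.
have dY := mder_data e x; have dQ := mder_resolvent e x.
eexists; apply: mderM; last exact: dQ.
apply: mderM; first exact: dQ.
apply: mderD; first by apply: mderMl; apply: mderJ; exact: dY.
by apply: mderMr; exact: dY.
Qed.

(** The product is regrouped so that the unbounded [Y] occurs only inside [Q Y] and [Y^* Q]. *)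
Lemma mcbm_dresolvent e : mcbm (dresolvent e).
Proof.
rewrite (_ : dresolvent e = fun x => Q x *m B e *m ((Y x)^t* *m Q x) + (Q x *m Y x) *m (B e)^t* *m Q x).
  apply: mcbmD; apply: mcbmM; [|exact: mcbm_data_resolvent| |exact: mcbm_resolvent].
    by apply: mcbmM; [exact: mcbm_resolvent|exact: mcbm_cst].
  by apply: mcbmM; [exact: mcbm_resolvent_data|exact: mcbm_cst].
by apply/funext => x; exact: resolvent_gradE.
Qed.

Variables (s : R) (s_gt0 : 0 < s) (mu : probability V R).
Hypothesis mu_rect : forall A : E -> set R, (forall e, measurable (A e)) ->
  mu (rect_set A) = (\prod_e normal_prob 0 s (A e))%E.

Lemma cbm_tr_resolvent (M : 'M[C]_n) : cbm (fun x => \tr (Q x *m M)).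
Proof. by apply: cbm_tr; apply: mcbmM; [exact: mcbm_resolvent|exact: mcbm_cst]. Qed.

(** The four inequalities say that [m] and [l] bound the squared operator norms of [M] and [S]. The
    squared gradient is of order [n]; with [s ^+ 2] of order [1 / k] the unnormalized trace keeps a
    bounded variance as long as [n / k] is bounded. *)
Lemma cvariance_tr_resolvent (M : 'M[C]_n) (m l : R) : 0 <= m -> 0 <= l ->
  (forall p (A : 'M[C]_(p, n)), F2 (A *m M) <= m%:C * F2 A) ->
  (forall p (A : 'M[C]_(n, p)), F2 (M *m A) <= m%:C * F2 A) ->
  (forall p (A : 'M[C]_(p, n)), F2 (A *m S) <= l%:C * F2 A) ->
  (forall p (A : 'M[C]_(n, p)), F2 (S *m A) <= l%:C * F2 A) ->
  cvariance mu (fun x => \tr (Q x *m M)) <=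
  16 * s ^+ 2 * (4 * (l * (y ^+ 2 * (m * (n%:R * (y * (1 + normc z * y))))))).
Proof.
move=> m0 l0 Mr Ml Sr Sl.
pose dF e x : C := - \tr (dresolvent e x *m M).
have bdF e : cbm (dF e).
  apply: cbmN; apply: cbm_tr; apply: mcbmM; [exact: mcbm_dresolvent|exact: mcbm_cst].
have pF e : cpartial e (fun x => \tr (Q x *m M)) (dF e).
  move=> x; split.
    apply: cder_eq; first by apply: cder_tr; apply: mderMr; exact: mder_resolvent.
    by move=> t; rewrite /dF mulNmx raddfN.
  have [A' dA] := mder_dresolvent e x.
  exists (fun t => (-1) * \tr (A' t *m M)); rewrite /dF.
  rewrite (_ : (fun t => _) = (fun t => (-1) * \tr (dresolvent e (update e x t) *m M))).
    apply: cder_eq.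
      apply: cderM; first exact: cder_cst.
      by apply: cder_tr; apply: mderMr; exact: dA.
    by move=> t; rewrite mul0r add0r.
  by apply/funext => t; rewrite mulN1r.
apply: le_trans (cgauss_poincare s_gt0 mu_rect (cbm_tr_resolvent M) bdF pF) _.
apply: ler_wpM2l; first by rewrite mulr_ge0// sqr_ge0.
(* The factor 4 is 2 for the two real directions of an entry times 2 for the linear and the
   antilinear part of the gradient. *)
set K := 4 * _; rewrite -(Rintegral_cst_prob mu K); apply: bmRintegral_le.
- by apply: bmfun_sum => e; exact: bmfun_sqn.
- exact: bmfun_cst.
move=> x; rewrite -lecR rmorph_sum.
rewrite (eq_bigr (fun e => `|\tr ((Y x)^t* *m (Q x *m M *m Q x) *m S *m entry_dir e) +
   \tr ((entry_dir e)^t* *m (S *m (Q x *m M *m Q x) *m Y x))| ^+ 2)); last first.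
  move=> e _; apply: (etrans (esym (sqr_normrC _))); rewrite /dF normrN /dresolvent.
  by rewrite (tr_resolvent_grad (Q x) M (Y x) (entry_dir e) S_herm).
rewrite sum_entry_dir_grad.
have H := @F2_grad_le _ n k (Y x) z _ _ (shift_pos z_im) (shift_b z_im) (shift_w z_im) M S m%:C l%:C.
have y2 : 0 <= ((`|complex.Im z|^-1 ^+ 2)%:C : C) by rewrite ler0c sqr_ge0.
have {}H := H y2 (etrans (ler0c m) m0) (etrans (ler0c l) l0) Mr Ml Sr Sl.
apply: le_trans (ler_wpM2l (ler0n _ 2) H) _.
rewrite le_eqVlt; apply/orP; left; apply/eqP.
set t := l%:C * _.
have -> : K%:C = 4 * t.
  rewrite /K /t /y; generalize (`|complex.Im z|^-1 ^+ 2) (`|complex.Im z|^-1 * (1 + normc z / `|complex.Im z|)) => a b.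
  by rewrite !rmorphM /= !rmorph_nat.
by clearbody t; ring.
Qed.

(** Integration by parts on the leftmost factor [Y], expanded along its Gaussian coordinates. *)
Lemma mE_gram_resolvent :
  mE mu (fun x => Y x *m (Y x)^t* *m Q x) =
  (s ^+ 2)%:C *: mE mu (fun x => (2 * k%:R - 2 * \tr ((Y x)^t* *m Q x *m Y x)) *: (S *m S *m Q x)).
Proof.
pose A e x : 'M[C]_n := B e *m ((Y x)^t* *m Q x).
pose dA e x : 'M[C]_n := B e *m ((B e)^t* *m Q x - (Y x)^t* *m dresolvent e x).
have -> : (fun x => Y x *m (Y x)^t* *m Q x) = (fun x => \sum_e (x e)%:C *: A e x).
  apply/funext => x; rewrite /A -mulmxA {1}/Y /data_mx entries_mx_sum mulmx_sumr mulmx_suml.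
  by apply: eq_bigr => e _; rewrite -scalemxAr -scalemxAl.
rewrite (mgauss_ibp s_gt0 mu_rect (dA := dA)).
- congr (_ *: mE _ _); apply/funext => x; exact: (sum_resolvent_ibp (Q x) (Y x) S_herm).
- by move=> e; apply: mcbmM; [exact: mcbm_cst|exact: mcbm_data_resolvent].
- move=> e; apply: mcbmM; first exact: mcbm_cst.
  apply: mcbmD; first by apply: mcbmM; [exact: mcbm_cst|exact: mcbm_resolvent].
  apply: mcbmN.
  rewrite (_ : (fun x => _) = (fun x => ((Y x)^t* *m Q x) *m B e *m ((Y x)^t* *m Q x) + ((Y x)^t* *m Q x *m Y x) *m (B e)^t* *m Q x)).
    apply: mcbmD; apply: mcbmM; [|exact: mcbm_data_resolvent| |exact: mcbm_resolvent].
      by apply: mcbmM; [exact: mcbm_data_resolvent|exact: mcbm_cst].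
    by apply: mcbmM; [exact: mcbm_data_resolvent_data|exact: mcbm_cst].
  by apply/funext => x; exact: data_resolvent_gradE.
- move=> e i j x.
  have dY := mder_data e x; have dQ := mder_resolvent e x.
  have [W dW] := mder_dresolvent e x.
  split.
    have D : mder (fun t => A e (update e x t)) (fun t => dA e (update e x t)).
      apply: mder_eq; first by apply: mderMl; apply: mderM; [apply: mderJ; exact: dY|exact: dQ].
      by move=> t /=; rewrite mulmxN.
    exact: (D i j).
  have [W' dW'] : exists W', mder (fun t => dA e (update e x t)) W'.
    rewrite /dA; eexists; apply: mderMl; apply: mderD; first by apply: mderMl; exact: dQ.
    rewrite (_ : (fun t => - _) = (fun t => (- 1%:M) *m ((Y (update e x t))^t* *m dresolvent e (update e x t)))).
      by apply: mderMl; apply: mderM; [apply: mderJ; exact: dY|exact: dW].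
    by apply/funext => t; rewrite mulNmx mul1mx.
  by exists (fun t => W' t i j).
Qed.

Hypothesis k_gt0 : (0 < k)%N.
Hypothesis s_var : s ^+ 2 = (2 * k%:R)^-1.
Let q x : C := k%:R^-1 * \tr (Q x).
Let g : C := cintegral mu q.
Let c : C := n%:R / k%:R.

Let cbm_q : cbm q.
Proof.
apply: cbmZ; rewrite (_ : (fun x => _) = (fun x => \tr (Q x *m 1%:M))).
  exact: cbm_tr_resolvent.
by apply/funext => x; rewrite mulmx1.
Qed.

Lemma master_equation (D : 'M[C]_n) :
  D *m ((1 - c - z * g) *: (S *m S) - z%:M) = 1%:M ->
  g = k%:R^-1 * \tr D +
    z * cintegral mu (fun x => (q x - g) * (k%:R^-1 * \tr (Q x *m (D *m (S *m S))))).
Proof.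
move=> hD.
have bQ : mcbm Q := mcbm_resolvent.
have bRQ : mcbm (fun x => S *m S *m Q x) by apply: mcbmM; [exact: mcbm_cst|exact: bQ].
have k0 : (k%:R : C) != 0 by rewrite pnatr_eq0 -lt0n.
have bqg : cbm (fun x => q x - g) by apply: cbmB => //; exact: cbm_cst.
have bqR : mcbm (fun x => (q x - g) *: (S *m S *m Q x)) by exact: mcbmZ.
have E1 : 1%:M + z *: mE mu Q = (1 - c - z * g) *: (S *m S *m mE mu Q)
    - z *: mE mu (fun x => (q x - g) *: (S *m S *m Q x)).
  transitivity (mE mu (fun x => Y x *m (Y x)^t* *m Q x)).
    rewrite -mEZ// -[X in X + _](mE_cst mu) -mED//.
    - congr (mE mu _); apply/funext => x; rewrite mul_resolvent//; exact: shift_pos.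
    - exact: mcbm_cst.
    - by apply: mcbmZ => //; exact: cbm_cst.
  rewrite mE_gram_resolvent s_var -mEZ; last first.
    apply: mcbmZ => //; apply: cbmB; first exact: cbm_cst.
    by apply: cbmZ; apply: cbm_tr; exact: mcbm_data_resolvent_data.
  transitivity (mE mu (fun x => (1 - c - z * g) *: (S *m S *m Q x) + - (z *: ((q x - g) *: (S *m S *m Q x))))).
    (* Since [s ^+ 2 = 1 / (2 k)] and [tr (Y^* Q Y) = n + z tr Q], the random factor equals
       [1 - c - z q], which is split around the mean [g]. *)
    congr (mE mu _); apply/funext => x; rewrite !scalerA -scalerBl; congr (_ *: _).
    rewrite tr_data_resolvent_data; last exact: shift_pos.
    rewrite /q -/(Q x) /c fmorphV rmorphM /= !rmorph_nat.
    by field.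
  rewrite mED; last 2 first.
  - by apply: mcbmZ => //; exact: cbm_cst.
  - by apply: mcbmN; apply: mcbmZ => //; exact: cbm_cst.
  by rewrite mEN ?mEZ ?mEMl//; apply: mcbmZ => //; exact: cbm_cst.
set T := mE mu Q in E1; set W := mE mu _ in E1.
have E2 : ((1 - c - z * g) *: (S *m S) - z%:M) *m T = 1%:M + z *: W.
  rewrite mulmxBl -scalemxAl mul_scalar_mx.
  by move/eqP: E1; rewrite eq_sym subr_eq => /eqP ->; rewrite addrAC addrK.
have E3 : T = D + z *: (D *m W) by rewrite -[LHS]mul1mx -hD -mulmxA E2 mulmxDr mulmx1 -scalemxAr.
have gE : g = k%:R^-1 * \tr T by rewrite /g /q cintegralZ ?mE_tr//; exact: cbm_tr.
rewrite {1}gE E3 mxtraceD mxtraceZ mulrDr; congr (_ + _); rewrite mulrCA; congr (_ * _).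
rewrite /W -mEMl// mE_tr; last by apply: mcbmM => //; exact: mcbm_cst.
rewrite -cintegralZ; last by apply: cbm_tr; apply: mcbmM => //; exact: mcbm_cst.
apply: eq_cintegral => x; move: (q x - g) (Q x) => a q0.
exact: mxtrace_mulZ.
Qed.

End gaussian_matrix.

(** * Stability of the fixed point equation *)

Section stability.
Context {R : realType}.
Local Notation C := R[i].
Local Notation Im := complex.Im.
Local Notation Re := complex.Re.

Variables (n : nat) (lam : 'I_n -> R) (K c : R) (z : C).
Let x := normc z.
Let eta := Im z.

(** The unknown is [f = c b], the analogue of a trace divided by [k], and the eigenvalues are listed
    with repetition. In these terms the equation for [b] says that [f] is a fixed point of
    [fp_map]. *)
Definition fp_denom (f : C) i : C := (1 - c%:C - z * f) * (lam i)%:C - z.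
Definition fp_map (f : C) : C := K^-1%:C * \sum_i (fp_denom f i)^-1.
Definition fp_v0 (f : C) : R := K^-1 * \sum_i (sqn (fp_denom f i))^-1.
Definition fp_v1 (f : C) : R := K^-1 * \sum_i lam i / sqn (fp_denom f i).

Lemma Im_fp_denom f i : Im (fp_denom f i) = - (lam i * Im (z * f) + eta).
Proof. by rewrite /fp_denom /eta !ReIm /=; ring. Qed.

Lemma Im_fp_map f : Im (fp_map f) = Im (z * f) * fp_v1 f + eta * fp_v0 f.
Proof.
rewrite /fp_map /fp_v1 /fp_v0 (Im_mul K^-1%:C) [complex.Im K^-1%:C]/= mul0r addr0 [complex.Re K^-1%:C]/= Im_sum.
rewrite mulrCA [X in _ + X]mulrCA -mulrDr; congr (_ * _).
rewrite !mulr_sumr -big_split /=; apply: eq_bigr => i _.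
by rewrite Im_inv Im_fp_denom; ring.
Qed.

(** The imaginary part of [z] over a denominator is that of [z] times the conjugate of the
    denominator, up to a positive factor. As [z] times its conjugate is real, the term [- z] drops
    out and [z f] becomes [|z|^2] times the conjugate of [f]. *)
Lemma Im_z_fp_map f : Im (z * fp_map f) = ((1 - c) * eta + x ^+ 2 * Im f) * fp_v1 f.
Proof.
rewrite /fp_map mulrCA mulr_sumr Im_mul /= mul0r addr0 Im_sum /fp_v1 mulrCA; congr (_ * _).
rewrite mulr_sumr; apply: eq_bigr => i _.
rewrite Im_mul Re_inv Im_inv /x sqr_normc mulrA; set S := (sqn (fp_denom f i))^-1.
rewrite -mulNr !mulrA -mulrDl; congr (_ * _).
by rewrite /fp_denom /sqn /eta !ReIm /=; ring.
Qed.

Hypothesis eta0 : eta != 0.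
Hypothesis K0 : 0 < K.
Hypothesis lam0 : forall i, 0 < lam i.
Let y := `|eta|^-1.

Lemma fp_v0_ge0 f : 0 <= fp_v0 f.
Proof.
apply: mulr_ge0; first by rewrite invr_ge0 ltW.
by apply: sumr_ge0 => i _; rewrite invr_ge0 sqn_ge0.
Qed.

Lemma fp_v1_ge0 f : 0 <= fp_v1 f.
Proof.
apply: mulr_ge0; first by rewrite invr_ge0 ltW.
by apply: sumr_ge0 => i _; rewrite mulr_ge0 ?invr_ge0 ?sqn_ge0// ltW.
Qed.

Let x0 : 0 <= x. Proof. exact: normc_ge0. Qed.
Let y0 : 0 < y. Proof. by rewrite invr_gt0 normr_gt0. Qed.

(** Both terms of the imaginary part of the denominator have the sign of [eta], so they cannot
    cancel. Conditions of the form [Im w / eta >= 0] treat the two half-planes at once. *)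
Lemma sqn_fp_denom_ge g i : 0 <= Im (z * g) / eta -> eta ^+ 2 <= sqn (fp_denom g i).
Proof.
move=> P0; apply: (@le_trans _ _ (Im (fp_denom g i) ^+ 2)); last by rewrite lerDr sqr_ge0.
rewrite Im_fp_denom sqrrN.
have -> : lam i * Im (z * g) + eta = eta * (1 + lam i * (Im (z * g) / eta)) by field.
rewrite exprMn ler_peMr ?sqr_ge0// expr_ge1 ?lerDl ?addr_ge0// mulr_ge0//; exact: ltW.
Qed.

Variables (kap L : R).
Hypothesis kap0 : 0 < kap.
Hypothesis c_ge0 : 0 <= c.
Hypothesis c_le : c <= 1 - kap.
Hypothesis c_nK : n%:R = c * K.
Hypothesis lamL : forall i, lam i <= L.

Lemma div_eta_le (a : R) (b : R) : `|a| <= b -> a / eta <= b * y.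
Proof.
move=> ab; apply: le_trans (ler_norm _) _.
by rewrite normrM normfV; apply: ler_wpM2r => //; rewrite ltW.
Qed.

Lemma fp_weight_ge (f : C) : 0 <= Im f / eta -> kap <= (1 - c) + x ^+ 2 * (Im f / eta).
Proof.
move=> F0; have : 0 <= x ^+ 2 * (Im f / eta) by rewrite mulr_ge0 ?sqr_ge0.
by move: c_le; lra.
Qed.

(** Only the sign of [Im f] is assumed, because the lemma must cover an exact solution, whose
    measure may charge the negative half-line. Multiplying the denominator by the conjugate of [z]
    makes this sign sufficient. *)
Lemma fp_denom_neq0 f i : 0 <= Im f / eta -> fp_denom f i != 0.
Proof.
move=> F0; apply/eqP => d0.
have A0 := fp_weight_ge F0.
have : Im (fp_denom f i * Num.conj z) = - (lam i * ((1 - c) * eta + x ^+ 2 * Im f)).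
  by rewrite /fp_denom /x sqr_normc /sqn /eta !ReIm /=; ring.
rewrite d0 mul0r /= => /eqP; rewrite eq_sym oppr_eq0 mulf_eq0 gt_eqF//=.
have -> : (1 - c) * eta + x ^+ 2 * Im f = eta * ((1 - c) + x ^+ 2 * (Im f / eta)) by field.
by rewrite mulf_eq0 (negbTE eta0) /= gt_eqF// (lt_le_trans kap0 A0).
Qed.

(** Eliminating [Im (z f)] between the two relations gives
    [A (1 - (x v)^2) = 1 - c + x^2 v0 >= kap], where [A <= 1 + x^2 y^2]. The factor 2 in the gap
    comes from [1 + x v <= 2]. *)
Lemma fp_contraction f : f = fp_map f -> 0 <= Im f / eta -> normc f <= y ->
  kap / (2 * (1 + x ^+ 2 * y ^+ 2)) <= 1 - x * fp_v1 f.
Proof.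
move=> fE F0 fy; set F := Im f / eta in F0; set v := fp_v1 f; set A := (1 - c) + x ^+ 2 * F.
have A1 : kap <= A by exact: fp_weight_ge.
have v0 := fp_v0_ge0 f; have v1 : 0 <= v := fp_v1_ge0 f.
have Fy : F <= y ^+ 2.
  by rewrite expr2; apply: div_eta_le; apply: le_trans (Im_le_normc f) fy.
have A2 : A <= 1 + x ^+ 2 * y ^+ 2.
  have : x ^+ 2 * F <= x ^+ 2 * y ^+ 2 by apply: ler_wpM2l => //; exact: sqr_ge0.
  by rewrite /A; move: c_ge0; lra.
have P : Im (z * f) / eta = A * v.
  have -> : Im (z * f) = ((1 - c) * eta + x ^+ 2 * Im f) * v by rewrite -Im_z_fp_map -fE.
  by rewrite /A /F; field.
have FE : F = (A * v) * v + fp_v0 f.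
  have E : Im f = Im (z * f) * v + eta * fp_v0 f by rewrite -Im_fp_map -fE.
  by rewrite -P {1}/F {1}E; field.
have AE : A * (1 - (x * v) ^+ 2) = (1 - c) + x ^+ 2 * fp_v0 f.
  by rewrite mulrBr mulr1 {1}/A FE; ring.
have B : kap <= A * (1 - (x * v) ^+ 2).
  rewrite AE; have : 0 <= x ^+ 2 * fp_v0 f by rewrite mulr_ge0 ?sqr_ge0.
  by move: c_le; lra.
have A_gt0 : 0 < A by exact: lt_le_trans A1.
have D0 : 0 < 1 - (x * v) ^+ 2 by rewrite -(pmulr_rgt0 _ A_gt0); exact: lt_le_trans B.
have xv0 : 0 <= x * v by exact: mulr_ge0.
have xv1 : x * v < 1 by rewrite -(@expr_lt1 _ 2)// -subr_gt0.
rewrite ler_pdivrMr; last by rewrite mulr_gt0// (lt_le_trans A_gt0 A2).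
apply: le_trans B _.
apply: (@le_trans _ _ ((1 + x ^+ 2 * y ^+ 2) * (1 - (x * v) ^+ 2))).
  by apply: ler_wpM2r => //; exact: ltW.
rewrite [leRHS]mulrA [leRHS]mulrC ler_wpM2l//; first exact: le_trans (ltW A_gt0) A2.
have -> : 1 - (x * v) ^+ 2 = (1 - x * v) * (1 + x * v) by ring.
rewrite ler_wpM2l ?subr_ge0 ?ltW//; move: xv1; set t := x * v; clearbody t; lra.
Qed.

(** The same elimination with two extra terms in [eps], whose total the smallness condition keeps
    below [kap], using [v <= L y^2]. No gap survives at [g], but the contraction factor between [f]
    and [g] is a mean of the two factors, and the gap at [f] is enough. *)
Lemma fp_perturbed g eps : 0 <= L -> g = fp_map g + eps -> 0 <= Im g / eta -> 0 <= Im (z * g) / eta ->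
  x ^+ 2 * y * normc eps * (1 + L * x * y ^+ 2) <= kap -> x * fp_v1 g <= 1.
Proof.
move=> L0 gE G0 P0 small; set G := Im g / eta in G0; set v := fp_v1 g; set A := (1 - c) + x ^+ 2 * G.
have A1 : kap <= A by exact: fp_weight_ge.
have v0 := fp_v0_ge0 g; have v1 : 0 <= v := fp_v1_ge0 g.
have vL : v <= L * y ^+ 2.
  have H i : lam i / sqn (fp_denom g i) <= L * y ^+ 2.
    have e1 : eta ^+ 2 <= sqn (fp_denom g i) by exact: sqn_fp_denom_ge.
    have e2 : 0 < eta ^+ 2 by rewrite exprn_even_gt0.
    apply: ler_pM => //.
    - exact: ltW.
    - by rewrite invr_ge0 sqn_ge0.
    - by rewrite /y exprVn real_normK ?num_real// lef_pV2 ?posrE//; exact: lt_le_trans e1.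
  rewrite /v /fp_v1; apply: (@le_trans _ _ (K^-1 * (n%:R * (L * y ^+ 2)))).
    apply: ler_wpM2l; first by rewrite invr_ge0 ltW.
    by rewrite mulr_natl -[X in _ *+ X]card_ord -sumr_const; apply: ler_sum.
  have -> : K^-1 * (n%:R * (L * y ^+ 2)) = c * (L * y ^+ 2).
    by rewrite c_nK; field; rewrite gt_eqF.
  by rewrite ler_piMl ?mulr_ge0 ?exprn_ge0 ?(ltW y0)//; move: c_le kap0; lra.
have e1 : Im eps / eta <= normc eps * y by apply: div_eta_le; exact: Im_le_normc.
have e2 : Im (z * eps) / eta <= x * normc eps * y.
  by apply: div_eta_le; rewrite /x -normcM; exact: Im_le_normc.
have e1' : - (normc eps * y) <= Im eps / eta.
  by rewrite lerNl -mulNr; apply: div_eta_le; rewrite normrN; exact: Im_le_normc.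
have e2' : - (x * normc eps * y) <= Im (z * eps) / eta.
  by rewrite lerNl -mulNr; apply: div_eta_le; rewrite normrN /x -normcM; exact: Im_le_normc.
have P : Im (z * g) / eta = A * v + Im (z * eps) / eta.
  have -> : Im (z * g) = ((1 - c) * eta + x ^+ 2 * Im g) * v + Im (z * eps).
    by rewrite -Im_z_fp_map -[in RHS]Im_add -mulrDr -gE.
  by rewrite /A /G; field.
have GE : G = (A * v + Im (z * eps) / eta) * v + fp_v0 g + Im eps / eta.
  have E : Im g = Im (z * g) * v + eta * fp_v0 g + Im eps.
    by rewrite -Im_fp_map -[in RHS]Im_add -gE.
  by rewrite -P {1}/G {1}E; field.
have AE : A * (1 - (x * v) ^+ 2) = (1 - c) + x ^+ 2 * fp_v0 g
    + x ^+ 2 * (Im (z * eps) / eta * v + Im eps / eta).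
  by rewrite mulrBr mulr1 {1}/A GE; ring.
have B : - (x * normc eps * y * (L * y ^+ 2) + normc eps * y) <= Im (z * eps) / eta * v + Im eps / eta.
  rewrite opprD; apply: lerD => //; rewrite -mulNr.
  have ne : 0 <= x * normc eps * y by rewrite !mulr_ge0 ?normc_ge0// ltW.
  apply: (@le_trans _ _ (- (x * normc eps * y) * v)).
    by rewrite !mulNr lerN2 ler_wpM2l.
  by rewrite ler_wpM2r.
have D : 0 <= A * (1 - (x * v) ^+ 2).
  rewrite AE; have h1 : 0 <= x ^+ 2 * fp_v0 g by rewrite mulr_ge0 ?sqr_ge0.
  have := ler_wpM2l (sqr_ge0 x) B.
  have -> : x ^+ 2 * - (x * normc eps * y * (L * y ^+ 2) + normc eps * y) = - (x ^+ 2 * y * normc eps * (1 + L * x * y ^+ 2)) by ring.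
  move: h1 small c_le; set t := x ^+ 2 * (_ + _); set t' := x ^+ 2 * y * _ * _; set t2 := x ^+ 2 * _.
  by clearbody t t' t2; lra.
move: D; rewrite pmulr_rge0; last exact: lt_le_trans A1.
by rewrite subr_ge0 expr_le1// mulr_ge0.
Qed.

Lemma fp_mapB f g : 0 <= Im f / eta -> 0 <= Im g / eta ->
  fp_map g - fp_map f = (g - f) * (z * (K^-1%:C * \sum_i (lam i)%:C / (fp_denom f i * fp_denom g i))).
Proof.
move=> F0 G0; rewrite /fp_map -mulrBr mulrCA mulrA [RHS]mulrCA; congr (_ * _).
rewrite -sumrB mulr_sumr; apply: eq_bigr => i _.
have df := fp_denom_neq0 i F0; have dg := fp_denom_neq0 i G0.
have -> : (fp_denom g i)^-1 - (fp_denom f i)^-1 = (fp_denom f i - fp_denom g i) / (fp_denom f i * fp_denom g i).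
  by field; rewrite df dg.
by rewrite mulrA; congr (_ * _); rewrite /fp_denom; ring.
Qed.

Lemma amgm_div (a p q : R) : 0 <= a -> 0 < p -> 0 < q -> a / (p * q) <= 2^-1 * (a / p ^+ 2 + a / q ^+ 2).
Proof.
move=> a0 p0 q0.
have -> : 2^-1 * (a / p ^+ 2 + a / q ^+ 2) = a / (p * q) + 2^-1 * a * (p^-1 - q^-1) ^+ 2.
  by field; rewrite !gt_eqF.
by rewrite lerDl mulr_ge0 ?sqr_ge0// mulr_ge0// invr_ge0 ler0n.
Qed.

(** The arithmetic-geometric inequality in each term. The arithmetic mean is what allows a gap at
    [f] alone to produce a contraction. *)
Lemma fp_multiplier_le f g : 0 <= Im f / eta -> 0 <= Im g / eta ->
  normc (z * (K^-1%:C * \sum_i (lam i)%:C / (fp_denom f i * fp_denom g i)))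
  <= 2^-1 * (x * fp_v1 f + x * fp_v1 g).
Proof.
move=> F0 G0; rewrite !normcM normc_real ger0_norm ?invr_ge0 ?(ltW K0)//.
rewrite -/x -mulrDr [leRHS]mulrCA; apply: ler_wpM2l => //.
rewrite /fp_v1 -mulrDr [leRHS]mulrCA; apply: ler_wpM2l; first by rewrite invr_ge0 ltW.
apply: (le_trans (normc_sum _ _ _)); rewrite -big_split [leRHS]mulr_sumr; apply: ler_sum => i _.
have df : 0 < normc (fp_denom f i) by rewrite normc_gt0 fp_denom_neq0.
have dg : 0 < normc (fp_denom g i) by rewrite normc_gt0 fp_denom_neq0.
rewrite normcM normc_real ger0_norm ?(ltW (lam0 i))// normcV normcM -!sqr_normc.
by apply: amgm_div => //; exact: ltW.
Qed.

Lemma fp_stability f g eps : 0 <= L -> f = fp_map f -> g = fp_map g + eps ->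
  0 <= Im f / eta -> 0 <= Im g / eta -> 0 <= Im (z * g) / eta -> normc f <= y -> normc g <= y ->
  normc (g - f) <= normc eps * (4 * (1 + x ^+ 2 * y ^+ 2) / kap
                                + 2 * y ^+ 2 * x ^+ 2 * (1 + L * x * y ^+ 2) / kap).
Proof.
move=> L0 fE gE F0 G0 P0 fy gy.
have e0 : 0 <= normc eps := normc_ge0 _.
have q0 : 0 <= 4 * (1 + x ^+ 2 * y ^+ 2) / kap.
  by rewrite !mulr_ge0 ?invr_ge0 ?(ltW kap0)// addr_ge0// mulr_ge0// sqr_ge0.
have r0 : 0 <= 2 * y ^+ 2 * x ^+ 2 * (1 + L * x * y ^+ 2) / kap.
  by apply: divr_ge0 (ltW kap0); repeat (apply: mulr_ge0 || apply: addr_ge0 || apply: sqr_ge0 || exact: ler0n || exact: x0 || exact: L0 || exact: ltW y0).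
(* When [eps] is not small, [big] says that the second summand of the bound is at least the trivial
   estimate [2 y]; that summand is made for this case. *)
have [small|/ltW big] := leP (x ^+ 2 * y * normc eps * (1 + L * x * y ^+ 2)) kap; last first.
  apply: (@le_trans _ _ (2 * y)).
    by apply: le_trans (normcB _ _) _; move: fy gy; lra.
  rewrite mulrDr; apply: ler_wpDl; first exact: mulr_ge0.
  have -> : normc eps * (2 * y ^+ 2 * x ^+ 2 * (1 + L * x * y ^+ 2) / kap) =
    2 * y * (x ^+ 2 * y * normc eps * (1 + L * x * y ^+ 2) / kap) by field; rewrite gt_eqF.
  by rewrite ler_peMr ?mulr_ge0 ?(ltW y0)// ler_pdivlMr// mul1r.
have c1 := fp_contraction fE F0 fy.
have c2 := fp_perturbed L0 gE G0 P0 small.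
rewrite mulrDr; apply: ler_wpDr; first exact: mulr_ge0.
set U := z * (K^-1%:C * \sum_i (lam i)%:C / (fp_denom f i * fp_denom g i)).
have U1 : normc U <= 2^-1 * (x * fp_v1 f + x * fp_v1 g) by exact: fp_multiplier_le.
have gf : g - f = (g - f) * U + eps.
  by rewrite {1}gE {1}fE addrAC fp_mapB.
have : normc (g - f) <= normc (g - f) * normc U + normc eps.
  by rewrite {1}gf; apply: le_trans (normcD _ _) _; rewrite normcM.
set D := normc (g - f); set u := normc U; rewrite -/u in U1 => H.
have D0 : 0 <= D := normc_ge0 _.
set p := 1 + x ^+ 2 * y ^+ 2 in c1 q0 *.
have p0 : 0 < p by rewrite /p ltr_pwDl// mulr_ge0 ?sqr_ge0.
(* [u] is at most the mean of [1 - kap / (2 p)] and 1, hence half of the gap remains. *)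
have u1 : kap / (4 * p) <= 1 - u.
  have -> : kap / (4 * p) = 2^-1 * (kap / (2 * p)) by field; rewrite gt_eqF.
  by move: c1 c2 U1; set t := kap / _; clearbody t u; lra.
have : D * (kap / (4 * p)) <= normc eps.
  apply: le_trans (ler_wpM2l D0 u1) _; move: H; clearbody D u; lra.
rewrite -ler_pdivlMr; last by rewrite divr_gt0// mulr_gt0.
by rewrite invf_div mulrA.
Qed.

End stability.

(** * Derivatives of Stieltjes transforms *)

Section cauchy_kernel.
Context {C : numClosedFieldType}.

(* Averaging [1 / (a^2 - h^2)] over the rotations of [h] by roots of -1 squares
   the relative error [(h / a) ^ (2 ^ m)] at each step; this replaces the Cauchy
   integral formula for [1 / a^2]. *)
Lemma cauchy_kernel m (h : C) : h != 0 ->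
  exists (I : finType) (w p : I -> C),
  [/\ forall i, `|p i| = `|h|, \sum_i `|w i| = `|h|^-1 &
    forall a, `|h| < `|a| ->
      \sum_i w i / (a - p i) = a ^- 2 / (1 - (h / a) ^+ (2 ^ m.+1))].
Proof.
elim: m h => [|m IH] h h0.
  exists bool, (fun b => (if b then 1 else -1) / (2 * h)), (fun b => if b then h else - h); split.
  - by case=> //; rewrite normrN.
  - rewrite big_bool /= !normrM normrN normr1 mul1r normfV normrM gtr0_norm ?ltr0n//.
    by field; rewrite normr_eq0.
  - move=> a ha; rewrite big_bool /=.
    have a0 : a != 0 by rewrite -normr_eq0 gt_eqF// (le_lt_trans _ ha).
    have d1 : a - h != 0 by rewrite subr_eq0; apply: contraTneq ha => ->; rewrite ltxx.
    have d2 : a + h != 0.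
      by rewrite addr_eq0; apply: contraTneq ha => ->; rewrite normrN ltxx.
    rewrite opprK expr_div_n; field.
    by rewrite d1 d2 a0 h0 /= andbT subr_sqr mulf_neq0.
pose N := (2 ^ m.+1)%N; have N0 : (0 < N)%N by rewrite expn_gt0.
(* Rotating [h] by [zeta] changes the sign of [t = (h / a) ^+ N], and the mean of [1 / (1 - t)] and
   [1 / (1 + t)] is [1 / (1 - t ^+ 2)]. *)
pose zeta : C := N.-root (-1).
have zN : zeta ^+ N = -1 by rewrite rootCK.
have z1 : `|zeta| = 1 by rewrite norm_rootC normrN normr1 rootC1.
have z0 : zeta != 0 by rewrite -normr_eq0 z1 oner_neq0.
have [I [w [p [pI wI HI]]]] := IH h h0.
have [J [v [q [qJ vJ HJ]]]] := IH (zeta * h) (mulf_neq0 z0 h0).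
have zh : `|zeta * h| = `|h| by rewrite normrM z1 mul1r.
exists (I + J)%type, (fun k => 2^-1 * match k with inl i => w i | inr j => v j end),
  (fun k => match k with inl i => p i | inr j => q j end); split.
- by case=> i; rewrite ?pI ?qJ.
- rewrite big_sumType /= (eq_bigr (fun i => 2^-1 * `|w i|)); last by move=> i _; rewrite normrM gtr0_norm ?invr_gt0 ?ltr0n.
  rewrite [X in _ + X](eq_bigr (fun i => 2^-1 * `|v i|)); last by move=> i _; rewrite normrM gtr0_norm ?invr_gt0 ?ltr0n.
  by rewrite -!mulr_sumr wI vJ zh; field; rewrite normr_eq0.
- move=> a ha; rewrite big_sumType /= (eq_bigr (fun i => 2^-1 * (w i / (a - p i)))); last by move=> i _; rewrite mulrA.
  rewrite [X in _ + X](eq_bigr (fun i => 2^-1 * (v i / (a - q i)))); last by move=> i _; rewrite mulrA.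
  rewrite -!mulr_sumr HI// HJ ?zh//.
  have E1 : (zeta * h / a) ^+ N = - (h / a) ^+ N by rewrite -mulrA exprMn zN mulN1r.
  have E2 : (h / a) ^+ (2 ^ m.+2) = ((h / a) ^+ N) ^+ 2 by rewrite (expnSr 2 m.+1) exprM.
  rewrite E2 -/N E1.
  have a0 : a != 0 by rewrite -normr_eq0 gt_eqF// (le_lt_trans _ ha).
  have q1 : `|(h / a) ^+ N| < 1.
    rewrite normrX exprn_ilt1 ?normr_ge0 -?lt0n// normrM normfV ltr_pdivrMr ?mul1r//.
    by rewrite normr_gt0.
  move: q1; set t := (h / a) ^+ N => q1.
  have d1 : 1 - t != 0.
    by rewrite subr_eq0; apply: contraTneq q1 => <-; rewrite normr1 ltxx.
  have d2 : 1 + t != 0.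
    by rewrite addrC addr_eq0; apply: contraTneq q1 => ->; rewrite normrN normr1 ltxx.
  clearbody t; rewrite opprK; field.
  rewrite a0 d1 d2 /= ?andbT.
  have -> : 1 - t ^+ 2 = (1 - t) * (1 + t) by ring.
  by rewrite mulf_neq0.
Qed.

(** As [|h / a| <= 1 / 2], the relative error is of order [2 ^- (2 ^ m.+1)]. Replacing the exponent
    by the smaller [m.+1] is enough for a limit, and [1 / |1 - q| <= 2] costs one more factor 2. *)
Lemma cauchy_kernel_error m (h a : C) : h != 0 -> 2 * `|h| <= `|a| ->
  `|a ^- 2 / (1 - (h / a) ^+ (2 ^ m.+1)) - a ^- 2| <= `|a| ^- 2 * 2 ^- m.
Proof.
move=> h0 ha.
have h_gt0 : 0 < `|h| by rewrite normr_gt0.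
have a_gt0 : 0 < `|a| by apply: lt_le_trans ha; rewrite mulr_gt0.
have a0 : a != 0 by rewrite -normr_gt0.
set q := (h / a) ^+ _.
have q1 : `|q| <= 2 ^- m.+1.
  rewrite /q normrX; apply: (@le_trans _ _ (2 ^- (2 ^ m.+1))).
    rewrite -exprVn; apply: lerXn2r; rewrite ?nnegrE// ?invr_ge0 ?ler0n//.
    by rewrite normrM normfV ler_pdivrMr// mulrC ler_pdivlMr// mulrC.
  rewrite lef_pV2 ?posrE ?exprn_gt0 ?ltr0n//.
  by rewrite -!natrX ler_nat leq_exp2l// ltnW// ltn_expl.
have q2 : `|q| <= 2^-1.
  apply: le_trans q1 _; rewrite lef_pV2 ?posrE ?exprn_gt0 ?ltr0n//.
  by rewrite exprS ler_peMr ?ler0n// exprn_ege1// ler1n.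
have d : 2^-1 <= `|1 - q|.
  apply: le_trans (lerB_dist _ _); rewrite normr1 lerBrDr.
  apply: le_trans (_ : 2^-1 + 2^-1 <= 1); first by rewrite lerD2l.
  by rewrite -div1r -mulr2n -mulrnAl divff// pnatr_eq0.
have d_gt0 : 0 < `|1 - q| by apply: lt_le_trans d; rewrite invr_gt0 ltr0n.
have d0 : 1 - q != 0 by rewrite -normr_gt0.
have -> : a ^- 2 / (1 - q) - a ^- 2 = a ^- 2 * (q / (1 - q)) by field; rewrite a0 d0.
clearbody q; rewrite !normrM !normfV !normrX; apply: ler_wpM2l; first by rewrite invr_ge0 exprn_ge0.
rewrite ler_pdivrMr//; apply: le_trans q1 _.
rewrite exprSr invfM ler_wpM2l// invr_ge0 exprn_ge0// ler0n.
Qed.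

End cauchy_kernel.

Section resolvent_average.
Context {R : realType}.
Local Notation C := R[i].

(* Satisfied by the Stieltjes transform [f] of any probability measure on the
   line, with [l] its derivative at [z]: a finite combination of values of [f]
   is an average of the same combination of kernels [1 / (t - z)]. *)
Definition resolvent_average (f : C -> C) (l z : C) :=
  forall (I : finType) (w h : I -> C) (u : C) (e : R),
  (forall i, complex.Im (z + h i) != 0) ->
  (forall t : R, normc (\sum_i w i * (t%:C - (z + h i))^-1 + u * (t%:C - z)^-1 ^+ 2) <= e) ->
  normc (\sum_i w i * f (z + h i) + u * l) <= e.

Section at_point.
Variable z : C.
Hypothesis z_im : complex.Im z != 0.
Let y := `|complex.Im z|^-1.

Lemma Im_shift_half h : normc h <= `|complex.Im z| / 2 ->
  complex.Im (z + h) != 0 /\ `|complex.Im (z + h)|^-1 <= 2 * y.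
Proof.
move=> hz; have e0 : 0 < `|complex.Im z| by rewrite normr_gt0.
have b : `|complex.Im z| / 2 <= `|complex.Im (z + h)|.
  rewrite Im_add; apply: le_trans (lerB_normD _ _).
  have := Im_le_normc h; move: hz; lra.
have b0 : 0 < `|complex.Im (z + h)| by apply: lt_le_trans b; rewrite divr_gt0.
split; first by rewrite -normr_gt0.
rewrite /y -(invrK 2) -invfM lef_pV2 ?posrE//; first by rewrite mulrC.
by rewrite mulr_gt0.
Qed.

(** A difference quotient is a two-point combination, so its error is bounded by that of the
    kernels, which is explicitly [h (t - z)^-2 (t - z - h)^-1]. This takes the place of
    differentiation under the integral sign. *)
Lemma resolvent_average_increment f l h : resolvent_average f l z -> h != 0 ->
  normc h <= `|complex.Im z| / 2 ->
  normc (h^-1 * (f (z + h) - f z) - l) <= normc h * (2 * y ^+ 3).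
Proof.
move=> fl h0 hz; have [zh_im zh_le] := Im_shift_half hz.
have E (g : C -> C) l' : h^-1 * (g (z + h) - g z) - l' =
   \sum_(i : bool) (if i then h^-1 else - h^-1) * g (z + (if i then h else 0)) + (-1) * l'.
  by rewrite big_bool /= addr0; ring.
rewrite E; apply: fl => [[]|t]; rewrite ?addr0//.
rewrite -(E (fun u => (t%:C - u)^-1)).
have a0 := shift_neq0 z_im t; have b0 := shift_neq0 zh_im t.
have -> : h^-1 * ((t%:C - (z + h))^-1 - (t%:C - z)^-1) - (t%:C - z)^-1 ^+ 2 =
   h * ((t%:C - z)^-1 ^+ 2 * (t%:C - (z + h))^-1).
  by field; rewrite a0 b0 h0.
rewrite normcM; apply: ler_wpM2l; rewrite ?normc_ge0// normcM normcX.
have -> : 2 * y ^+ 3 = y ^+ 2 * (2 * y) by ring.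
apply: ler_pM; rewrite ?normc_ge0 ?exprn_ge0 ?normc_ge0//.
  by rewrite lerXn2r ?nnegrE ?normc_ge0 ?invr_ge0// normc_shiftV.
by apply: le_trans (normc_shiftV zh_im t) zh_le.
Qed.

Lemma complex_derive_average f l : resolvent_average f l z -> complex_derive f z = l.
Proof.
move=> fl; rewrite /complex_derive /derive1.
apply: (@cvg_lim C^o); first exact: norm_hausdorff.
apply/cvgrPdist_le => /= e e0.
have [e' e'0 eE] : exists2 e' : R, 0 < e' & e = e'%:C.
  have [e' e'0 eE] := ge0_complexP (ltW e0).
  by exists e' => //; move: e0; rewrite eE ltcR.
have y0 : 0 < y by rewrite invr_gt0 normr_gt0.
have K0 : 0 < 2 * y ^+ 3 by rewrite mulr_gt0// exprn_gt0.
pose r := Num.min (`|complex.Im z| / 2) (e' / (2 * y ^+ 3)).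
have r0 : 0 < r by rewrite lt_min !divr_gt0// normr_gt0.
have r0C : 0 < (r%:C : C) by rewrite ltcR.
near=> h.
have h0 : h != 0 by near: h; exact: (@nbhs_dnbhs_neq C^o).
have hr : normc h < r.
  by rewrite -ltcR -normrCE; near: h; exact: (@dnbhs0_lt _ C^o _ r0C).
move: hr; rewrite lt_min => /andP[h1 h2].
rewrite distrC normrCE eE lecR [h + z]addrC.
apply: le_trans (resolvent_average_increment fl h0 (ltW h1)) _.
by rewrite -ler_pdivlMr// ltW.
Unshelve. all: by end_near. Qed.

Lemma resolvent_average_cauchy f1 l1 f2 l2 (B : R) :
  resolvent_average f1 l1 z -> resolvent_average f2 l2 z ->
  (forall h, normc h = `|complex.Im z| / 2 -> normc (f1 (z + h) - f2 (z + h)) <= B) ->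
  normc (l1 - l2) <= 2 * y * B.
Proof.
move=> a1 a2 hB; have e0 : 0 < `|complex.Im z| by rewrite normr_gt0.
have y0 : 0 < y by rewrite invr_gt0.
pose r := `|complex.Im z| / 2; have r0 : 0 < r by rewrite divr_gt0.
have rC0 : (r%:C : C) != 0 by rewrite eq_complex /= eqxx andbT gt_eqF.
(* At level [m] each of the two derivatives is reproduced up to [y ^+ 2 * 2 ^- m], as the radius [r]
   is at most half of [|t - z|] for every real [t]. The inequality then follows by letting [m]
   grow. *)
have H m : normc (l1 - l2) <= 2 * y * B + 2 * (y ^+ 2 * 2 ^- m).
  have [I [w [p [pI wI kE]]]] := cauchy_kernel m rC0.
  have pr i : normc (p i) = r.
    by apply: (@complexI R); rewrite -normrCE pI normrCE normc_real gtr0_norm.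
  have pim i : complex.Im (z + p i) != 0 by have [] := @Im_shift_half (p i); rewrite ?pr.
  have K t : normc (\sum_i w i * (t%:C - (z + p i))^-1 + (-1) * (t%:C - z)^-1 ^+ 2) <= y ^+ 2 * 2 ^- m.
    have ay : `|complex.Im z| <= normc (t%:C - z).
      rewrite -ler_sqr ?nnegrE ?normc_ge0// sqr_normc real_normK ?num_real//.
      exact: im_le_shift.
    have a_gt0 : 0 < normc (t%:C - z) by exact: lt_le_trans ay.
    rewrite (eq_bigr (fun i => w i / (t%:C - z - p i))); last first.
      by move=> i _; rewrite opprD addrA.
    rewrite kE; last by rewrite !normrCE ltcR normc_real gtr0_norm// (lt_le_trans _ ay)// /r; move: e0; lra.
    rewrite mulN1r exprVn -lecR -normrCE.
    apply: le_trans (cauchy_kernel_error _ _ _) _ => //.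
      by rewrite !normrCE normc_real gtr0_norm// -[2](rmorph_nat (real_complex R)) -rmorphM lecR /r mulrC divfK ?pnatr_eq0.
    rewrite normrCE -[2](rmorph_nat (real_complex R)) -!rmorphXn -!fmorphV -rmorphM lecR.
    rewrite ler_wpM2r ?invr_ge0 ?exprn_ge0//.
    rewrite /y exprVn lef_pV2 ?posrE ?exprn_gt0//.
    by rewrite lerXn2r ?nnegrE ?normc_ge0.
  have b1 := a1 _ _ _ _ _ pim K; have b2 := a2 _ _ _ _ _ pim K.
  have b3 : normc (\sum_i w i * (f1 (z + p i) - f2 (z + p i))) <= 2 * y * B.
    apply: (le_trans (normc_sum _ _ _)).
    apply: (@le_trans _ _ (\sum_i normc (w i) * B)).
      by apply: ler_sum => i _; rewrite normcM ler_wpM2l ?normc_ge0// hB ?pr.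
    rewrite -mulr_suml.
    (* The total weight is [1 / r], the factor of Cauchy's estimate on a circle of radius [r]. *)
    have -> : \sum_i normc (w i) = 2 * y; last by [].
    apply: (@complexI R); rewrite rmorph_sum /= (eq_bigr (fun i => `|w i|)); last by move=> i _; rewrite normrCE.
    by rewrite wI normrCE normc_real gtr0_norm// -fmorphV /r invf_div /y.
  have -> : l1 - l2 = \sum_i w i * (f1 (z + p i) - f2 (z + p i)) -
     ((\sum_i w i * f1 (z + p i) + (-1) * l1) - (\sum_i w i * f2 (z + p i) + (-1) * l2)).
    under eq_bigr do rewrite mulrBr.
    by rewrite sumrB; ring.
  apply: le_trans (normcB _ _) _; apply: lerD b3 _.
  by apply: le_trans (normcB _ _) _; rewrite mulr2n mulrDl mul1r; exact: lerD.
apply/ler_addgt0Pr => e e_gt0.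
pose m := Num.bound (2 * y ^+ 2 / e).
apply: le_trans (H m) _; rewrite lerD2l mulrA ler_pdivrMr ?exprn_gt0// [leRHS]mulrC -ler_pdivrMr//.
apply: le_trans (ltW (archi_boundP _)) _.
  by rewrite divr_ge0 ?(ltW e_gt0)// mulr_ge0// exprn_ge0// ltW.
by rewrite -natrX ler_nat ltnW// ltn_expl.
Qed.

Lemma resolvent_average_point (t : R) :
  resolvent_average (fun u => (t%:C - u)^-1) ((t%:C - z)^-1 ^+ 2) z.
Proof. by move=> I w h u e _; exact. Qed.

(** A bound on a norm by a constant passes to averages. The lemma serves both transforms: integrated
    over the line for the deterministic one, over the sample for the expected one. *)
Lemma resolvent_average_integral d (T : measurableType d) (P : probability T R)
    (f : C -> T -> C) (l : T -> C) :
  (forall u, complex.Im u != 0 -> cbm (f u)) -> cbm l ->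
  (forall x, resolvent_average (fun u => f u x) (l x) z) ->
  resolvent_average (fun u => cintegral P (f u)) (cintegral P l) z.
Proof.
move=> bf bl fl I w h u e him H.
have b1 i : cbm (fun x => w i * f (z + h i) x) by apply: cbmZ; exact: bf.
have -> : \sum_i w i * cintegral P (f (z + h i)) + u * cintegral P l =
   cintegral P (fun x => \sum_i w i * f (z + h i) x + u * l x).
  rewrite cintegralD; [|exact: cbm_sum|exact: cbmZ].
  rewrite cintegral_sum// cintegralZ//; congr (_ + _).
  by apply: eq_bigr => i _; rewrite cintegralZ//; exact: bf.
apply: normc_cintegral_le.
- by apply: cbmD; [exact: cbm_sum|exact: cbmZ].
- exact: le_trans (normc_ge0 _) (H 0).
- by move=> x; exact: fl.
Qed.

Lemma resolvent_average_mean n (sg : 'I_n -> R) : (0 < n)%N ->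
  resolvent_average (fun u => n%:R^-1 * \sum_i ((sg i)%:C - u)^-1)
    (n%:R^-1 * \sum_i ((sg i)%:C - z)^-1 ^+ 2) z.
Proof.
move=> n0 I w h u e him H.
have -> : \sum_j w j * (n%:R^-1 * \sum_i ((sg i)%:C - (z + h j))^-1) + u * (n%:R^-1 * \sum_i ((sg i)%:C - z)^-1 ^+ 2)
  = n%:R^-1 * \sum_i (\sum_j w j * ((sg i)%:C - (z + h j))^-1 + u * ((sg i)%:C - z)^-1 ^+ 2).
  rewrite big_split /= mulrDr exchange_big /=; congr (_ + _); last by rewrite -mulr_sumr mulrCA.
  rewrite mulr_sumr; apply: eq_bigr => j _; rewrite -mulr_sumr; exact: mulrCA.
rewrite normcM normcV normc_nat ler_pdivrMl ?ltr0n//.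
apply: (le_trans (normc_sum _ _ _)).
by rewrite mulr_natl -[X in _ *+ X]card_ord -sumr_const; apply: ler_sum => i _; exact: H.
Qed.

End at_point.

Lemma cbm_kernel (z : C) : complex.Im z != 0 ->
  cbm (fun t : measurableTypeR R => ((t : R)%:C - z)^-1).
Proof.
move=> z_im; apply: (@cbmP _ _ _ _ (`|complex.Im z|^-1 ^+ 2)); last by move=> t; exact: sqn_shiftV.
apply: cmeasV; apply: cmeasD; last exact: cmeas_cst.
by split => /=; [exact: measurable_id|exact: measurable_cst].
Qed.

Lemma resolvent_average_stieltjes (F : probability (measurableTypeR R) R) (z : C) :
  complex.Im z != 0 ->
  resolvent_average (stieltjes F) (cintegral F (fun t : measurableTypeR R => ((t : R)%:C - z)^-1 ^+ 2)) z.
Proof.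
move=> z_im; apply: (@resolvent_average_integral z _ (measurableTypeR R) F (fun u t => ((t : R)%:C - u)^-1)).
- exact: cbm_kernel.
- by under eq_fun do rewrite expr2; apply: cbmM; exact: cbm_kernel.
- by move=> t; exact: resolvent_average_point.
Qed.

End resolvent_average.

(** * Eigenvalues with multiplicities *)

Section spectrum.
Context {C : numClosedFieldType}.

Lemma rank_diag_mx (F : fieldType) n (d : 'rV[F]_n) :
  \rank (diag_mx d) = (\sum_j (d 0%R j != 0%R))%N.
Proof.
elim: n d => [|n IH] d; first by rewrite big_ord0; apply/eqP; rewrite -leqn0 rank_leq_row.
have -> : diag_mx d = diag_mx (row_mx (lsubmx (d : 'rV_(1 + n))) (rsubmx (d : 'rV_(1 + n)))).
  by rewrite hsubmxK.
rewrite diag_mx_row (rank_diag_block_mx (diag_mx (lsubmx (d : 'rV_(1 + n))))) IH big_ord_recl.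
congr (_ + _)%N; last first.
  by apply: eq_bigr => j _; rewrite mxE; congr (nat_of_bool (d _ _ != _)); apply: val_inj.
set a := lsubmx _; have -> : diag_mx a = (a 0%R 0%R)%:M.
  by apply/matrixP => i j; rewrite !mxE !ord1.
rewrite rank_rV -scalemx1 scaler_eq0 oner_eq0 orbF mxE.
by congr (nat_of_bool (d _ _ != _)); apply: val_inj.
Qed.

Lemma rank_eigenspace_fcalc n (U : 'M[C]_n) (g : 'I_n -> C) (a : C) : U \is unitarymx ->
  \rank (eigenspace (fcalc U g) a) = (\sum_j (g j == a))%N.
Proof.
move=> uU; rewrite /eigenspace mxrank_ker fcalcB// /fcalc.
have uU' : U^t* \in unitmx by apply: unitarymx_unit; rewrite trmxC_unitary.
rewrite mxrankMfree ?row_free_unit ?unitarymx_unit//.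
rewrite (eqmxMfull _ (etrans (row_full_unit _) uU')) rank_diag_mx.
under [X in (_ - X)%N]eq_bigr do rewrite mxE subr_eq0.
have E : (\sum_(j < n) (g j == a) + \sum_(j < n) (g j != a))%N = n.
  rewrite -big_split /= -[RHS]card_ord -sum1_card; apply: eq_bigr => j _.
  by case: (g j == a).
by rewrite -[X in (X - _)%N]E addnK.
Qed.

Section counting.
Variables (L n : nat) (sg : 'I_n -> C) (lam : 'I_L -> C) (mult : 'I_L -> nat).
Hypothesis lam_inj : injective lam.
Hypothesis multE : forall i, mult i = (\sum_j (sg j == lam i))%N.
Hypothesis sum_mult : (\sum_i mult i)%N = n.

Lemma count_eigenvalue_le j : (\sum_i (sg j == lam i) <= 1)%N.
Proof.
have [[i /eqP ji]|nj] := pselect (exists i, sg j == lam i).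
  rewrite (bigD1 i)//= ji eqxx big1// => i' i'i; apply/eqP; rewrite eqb0.
  by rewrite (inj_eq lam_inj) eq_sym.
rewrite big1// => i _; apply/eqP; rewrite eqb0; apply/negP => ji; apply: nj.
by exists i.
Qed.

(** Each count is at most 1 because the [lam i] are distinct, and the counts add up to [n] over the
    [n] indices; so none of them can be 0. *)
Lemma count_eigenvalue j : (\sum_i (sg j == lam i))%N = 1%N.
Proof.
have E : (\sum_j \sum_i (sg j == lam i) = \sum_(j < n) 1)%N.
  rewrite exchange_big /= sum1_card card_ord -[RHS]sum_mult.
  by apply: eq_bigr => i _; rewrite multE.
apply/eqP; rewrite eqn_leq count_eigenvalue_le /=.
rewrite leqNgt; apply/negP => lt1.
have : (\sum_j \sum_i (sg j == lam i) < \sum_(j < n) 1)%N.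
  rewrite (bigD1 j)//= [X in (_ < X)%N](bigD1 j)//= -addSn leq_add//.
  by apply: leq_sum => k _; exact: count_eigenvalue_le.
by rewrite E ltnn.
Qed.

Lemma eigenvalue_of_spectrum j : exists i, sg j = lam i.
Proof.
apply: contrapT => nj; have := count_eigenvalue j; rewrite big1// => i _.
by apply/eqP; rewrite eqb0; apply/negP => /eqP ji; apply: nj; exists i.
Qed.

Lemma sum_spectrum (h : C -> C) : \sum_i (mult i)%:R * h (lam i) = \sum_j h (sg j).
Proof.
transitivity (\sum_i \sum_j h (sg j) *+ (sg j == lam i)).
  apply: eq_bigr => i _; rewrite multE natr_sum mulr_suml.
  by apply: eq_bigr => j _; case: eqP => [->|]; rewrite ?mul1r ?mul0r.
rewrite exchange_big /=; apply: eq_bigr => j _.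
by rewrite -[RHS]mulr1n -(count_eigenvalue j) sumrMnr.
Qed.

End counting.

Lemma spectral_fcalc_sqrt n (A : 'M[C]_n) (f : C -> C) :
  invmx (spectralmx A) *m diag_mx (map_mx f (spectral_diag A)) *m spectralmx A
  = fcalc (spectralmx A) (fun i => f (spectral_diag A 0 i)).
Proof.
rewrite invmx_unitary ?spectral_unitarymx// /fcalc.
by congr (_ *m diag_mx _ *m _); apply/rowP => i; rewrite !mxE.
Qed.

Section fcalc_forms.
Variables (n : nat) (U : 'M[C]_n) (g : 'I_n -> C).
Hypothesis uU : U \is unitarymx.

Lemma fcalc_sqrt_adj : (forall j, 0 <= g j) ->
  (fcalc U (fun j => sqrtC (g j)))^t* = fcalc U (fun j => sqrtC (g j)).
Proof.
move=> g0; rewrite fcalc_adj//; apply: eq_fcalc => j; apply: geC0_conj.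
by rewrite sqrtC_ge0.
Qed.

Lemma fcalc_sqrt_sqr :
  fcalc U (fun j => sqrtC (g j)) *m fcalc U (fun j => sqrtC (g j)) = fcalc U g.
Proof. by rewrite fcalcM//; apply: eq_fcalc => j; rewrite -expr2 sqrtCK. Qed.

Lemma fcalc_shift_inv (S : 'M[C]_n) (w z : C) : S *m S = fcalc U g ->
  (forall j, w * g j - z != 0) ->
  fcalc U (fun j => (w * g j - z)^-1) *m (w *: (S *m S) - z%:M) = 1%:M.
Proof. by move=> -> d0; rewrite fcalcZ fcalcB// fcalcC// fcalc_mulV. Qed.

Lemma fcalc_div (S : 'M[C]_n) (h : 'I_n -> C) : S *m S = fcalc U g ->
  fcalc U (fun j => (h j)^-1) *m (S *m S) = fcalc U (fun j => g j / h j).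
Proof. by move=> ->; rewrite fcalcM//; apply: eq_fcalc => j; rewrite mulrC. Qed.

End fcalc_forms.

Lemma tr_resolvent_sqr n k (Y : 'M[C]_(n, k)) (z : C) : (forall r, 0 <= r -> r - z != 0) ->
  \tr (resolvent (Y *m Y^t* ) z *m resolvent (Y *m Y^t* ) z)
  = \sum_i (spectral_diag (Y *m Y^t* ) 0 i - z)^-1 ^+ 2.
Proof.
move=> z_pos; have uU := spectral_unitarymx (Y *m Y^t* ).
rewrite resolvent_fcalc// fcalcM// fcalc_tr//.
Qed.

End spectrum.

(** Passes from distinct eigenvalues with multiplicities to a real list with repetition, in the
    order of the eigenbasis that defines [psd_sqrtmx]. The strict order of the [lam i] serves to
    make them distinct. *)
Lemma has_spectrumP (R : realType) (L n : nat) (A : 'M[R[i]]_n) (lam : 'I_L -> R) (mult : 'I_L -> nat) :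
  has_spectrum A lam mult ->
  exists r : 'I_n -> R,
  [/\ forall j, spectral_diag A 0 j = (r j)%:C, forall j, exists i, r j = lam i &
   forall h : R[i] -> R[i], \sum_i (mult i)%:R * h (lam i)%:C = \sum_j h (r j)%:C].
Proof.
move=> [hA lam_lt _ rk sm].
have uU := spectral_unitarymx A.
have lam_inj : injective (fun i => (lam i)%:C).
  move=> i j /(congr1 (@complex.Re R)) /= ij.
  case: (ltngtP i j) => [/lam_lt|/lam_lt|/val_inj//]; by rewrite ij ltxx.
have multE i : mult i = (\sum_j (spectral_diag A 0%R j == (lam i)%:C))%N.
  by rewrite -rk {1}(herm_fcalc hA) rank_eigenspace_fcalc.
have ex j : exists i, spectral_diag A 0 j = (lam i)%:C.
  by have := eigenvalue_of_spectrum lam_inj multE sm j.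
pose r j := complex.Re (spectral_diag A 0 j).
have rE j : spectral_diag A 0 j = (r j)%:C by rewrite /r; have [i ->] := ex j.
exists r; split => //.
  by move=> j; have [i e] := ex j; exists i; rewrite /r e.
move=> h; rewrite (sum_spectrum lam_inj multE sm h).
by apply: eq_bigr => j _; rewrite rE.
Qed.

(** * The bias of the normalized trace *)

Section integral_complements.
Context {R : realType} (d : measure_display) (T : measurableType d).
Variable P : probability T R.

Lemma cintegral_Im_ge0 (F : T -> R[i]) : cbm F -> (forall x, 0 <= complex.Im (F x)) ->
  0 <= complex.Im (cintegral P F).
Proof. by move=> _ F0; apply: Rintegral_ge0 => x _; exact: F0. Qed.

Lemma cintegral_Im_div_ge0 (a : R[i]) (eta : R) (F : T -> R[i]) : cbm F ->
  (forall x, 0 <= complex.Im (a * F x) / eta) ->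
  0 <= complex.Im (a * cintegral P F) / eta.
Proof.
move=> bF F0.
have E (w : R[i]) : complex.Im w / eta = complex.Im (eta^-1%:C * w).
  by rewrite Im_mul /= mul0r addr0 mulrC.
rewrite E mulrA -cintegralZ//; apply: cintegral_Im_ge0; first exact: cbmZ.
by move=> x; rewrite -mulrA -E.
Qed.

Lemma cvarianceZ (a : R) (F : T -> R[i]) : cbm F ->
  cvariance P (fun x => a%:C * F x) = a ^+ 2 * cvariance P F.
Proof.
move=> bF; rewrite /cvariance cintegralZ// -bmRintegralZ; last first.
  by apply: bmfun_sqn; apply: cbmB => //; exact: cbm_cst.
by apply: eq_Rintegral => x _; rewrite -mulrBr sqnM sqn_real.
Qed.

End integral_complements.

Section nevanlinna.
Context {R : realType}.
Local Notation C := R[i].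
Variable z : C.
Hypothesis z_im : complex.Im z != 0.
Let eta := complex.Im z.
Let y := `|eta|^-1.

Lemma Im_kernel_div_ge0 (t : R) : 0 <= complex.Im (t%:C - z)^-1 / eta.
Proof.
have a0 := shift_neq0 z_im t.
rewrite Im_inv; have -> : complex.Im (t%:C - z) = - eta by rewrite !ReIm /= sub0r.
have -> : - (- eta / sqn (t%:C - z)) / eta = (sqn (t%:C - z))^-1.
  by field; rewrite sqn_eq0 a0 /eta z_im.
by rewrite invr_ge0 sqn_ge0.
Qed.

(** What is retained of the value at [z] of the Stieltjes transform of a measure of mass at most 1
    on the nonnegative half-line. The three conditions are convex, so normalized traces and
    expectations inherit them from the kernel. *)
Definition nevanlinna (w : C) :=
  [/\ 0 <= complex.Im w / eta, 0 <= complex.Im (z * w) / eta & normc w <= y].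

Lemma nevanlinna_kernel (t : R) : 0 <= t -> nevanlinna (t%:C - z)^-1.
Proof.
move=> t0; have a0 := shift_neq0 z_im t; split; last exact: normc_shiftV.
  exact: Im_kernel_div_ge0.
have -> : z * (t%:C - z)^-1 = - 1 + t%:C * (t%:C - z)^-1 by field.
have -> : complex.Im (- 1 + t%:C * (t%:C - z)^-1) = t * (eta / sqn (t%:C - z)).
  rewrite Im_add Im_mul Im_inv; have -> : complex.Im (t%:C - z) = - eta by rewrite !ReIm /= sub0r.
  by rewrite /= oppr0; ring.
have -> : t * (eta / sqn (t%:C - z)) / eta = t / sqn (t%:C - z) by field; rewrite sqn_eq0 a0 /eta z_im.
by rewrite divr_ge0// sqn_ge0.
Qed.

Lemma nevanlinna_sum n (k : R) (w : 'I_n -> C) : 0 < k -> n%:R <= k ->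
  (forall i, nevanlinna (w i)) -> nevanlinna (k^-1%:C * \sum_i w i).
Proof.
move=> k0 nk H; have kV : 0 <= k^-1 by rewrite invr_ge0 ltW.
have E (a : R) (u : C) : complex.Im (a%:C * u) = a * complex.Im u.
  by rewrite Im_mul /= mul0r addr0.
split.
- rewrite E -mulrA mulr_ge0// Im_sum mulr_suml; apply: sumr_ge0 => i _; by case: (H i).
- rewrite mulrCA E -mulrA mulr_ge0// mulr_sumr Im_sum mulr_suml; apply: sumr_ge0 => i _.
  by case: (H i).
- rewrite normcM normc_real ger0_norm// ler_pdivrMl//.
  apply: (le_trans (normc_sum _ _ _)); apply: (@le_trans _ _ (n%:R * y)).
    by rewrite mulr_natl -[X in _ *+ X]card_ord -sumr_const; apply: ler_sum => i _; case: (H i).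
  by rewrite ler_wpM2r// invr_ge0.
Qed.

Lemma nevanlinna_integral d (T : measurableType d) (P : probability T R) (F : T -> C) :
  cbm F -> (forall x, nevanlinna (F x)) -> nevanlinna (cintegral P F).
Proof.
move=> bF H; split.
- have := @cintegral_Im_div_ge0 _ _ _ P 1 eta F bF; rewrite mul1r; apply.
  by move=> x; rewrite mul1r; case: (H x).
- by apply: cintegral_Im_div_ge0 => // x; case: (H x).
- by apply: normc_cintegral_le; rewrite ?invr_ge0// => x; case: (H x).
Qed.

End nevanlinna.

Section bias.
Context {R : realType}.
Local Notation C := R[i].
Variables (n k : nat) (U : 'M[C]_n) (r : 'I_n -> R) (Lam kap : R).
Hypothesis uU : U \is unitarymx.
Hypothesis k_gt0 : (0 < k)%N.
Hypothesis r_gt0 : forall j, 0 < r j.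
Hypothesis r_le : forall j, r j <= Lam.
Hypothesis Lam0 : 0 <= Lam.
Hypothesis kap0 : 0 < kap.
Hypothesis nk_le : n%:R / k%:R <= 1 - kap :> R.
Let c : R := n%:R / k%:R.
Let S : 'M[C]_n := fcalc U (fun j => sqrtC (r j)%:C).
Local Notation E := ('I_n * 'I_k * bool)%type.
Local Notation V := (vecspace R E).
Variables (s : R) (mu : probability V R).
Hypothesis s_gt0 : 0 < s.
Hypothesis s_var : s ^+ 2 = (2 * k%:R)^-1.
Hypothesis mu_rect : forall A : E -> set R, (forall e, measurable (A e)) ->
  mu (rect_set A) = (\prod_e normal_prob 0 s (A e))%E.

Let rC_ge0 j : 0 <= (r j)%:C :> C. Proof. by rewrite ler0c ltW. Qed.

Let S_herm : S^t* = S.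
Proof. exact: (@fcalc_sqrt_adj _ n U (fun j => (r j)%:C) rC_ge0). Qed.

Let S_sqr : S *m S = fcalc U (fun j => (r j)%:C).
Proof. exact: (fcalc_sqrt_sqr (fun j => (r j)%:C) uU). Qed.

Let S_le j : `|sqrtC (r j)%:C : C| ^+ 2 <= Lam%:C.
Proof. by rewrite -normrX sqrtCK normrCE normc_real gtr0_norm// lecR. Qed.

Section at_point.
Variable z : C.
Hypothesis z_im : complex.Im z != 0.
Let x := normc z.
Let y := `|complex.Im z|^-1.
Let Q (v : V) : 'M[C]_n := resolvent (data_mx S v *m (data_mx S v)^t* ) z.
Let q v : C := k%:R^-1 * \tr (Q v).
Let g := cintegral mu q.

Let kR : 0 < k%:R :> R. Proof. by rewrite ltr0n. Qed.
Let natC (m : nat) : (m%:R : C) = (m%:R : R)%:C. Proof. by rewrite rmorph_nat. Qed.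
Let c_ge0 : 0 <= c. Proof. by rewrite divr_ge0. Qed.
Let nkR : n%:R <= k%:R :> R.
Proof. by have := nk_le; rewrite ler_pdivrMr// => /le_trans; apply; rewrite ler_piMl// gerBl ltW. Qed.
Let c_nK : n%:R = c * k%:R. Proof. by rewrite /c divfK// gt_eqF. Qed.
Let y0 : 0 < y. Proof. by rewrite invr_gt0 normr_gt0. Qed.
Let x0 : 0 <= x. Proof. exact: normc_ge0. Qed.

Lemma cbm_normalized_tr (M : 'M[C]_n) : cbm (fun v => k%:R^-1 * \tr (Q v *m M)).
Proof. by apply: cbmZ; exact: cbm_tr_resolvent. Qed.

Let cbm_q : cbm q.
Proof.
rewrite (_ : q = fun v => k%:R^-1 * \tr (Q v *m 1%:M)); first exact: cbm_normalized_tr.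
by apply/funext => v; rewrite mulmx1.
Qed.

Lemma nevanlinna_normalized_trace : nevanlinna z g.
Proof.
apply: nevanlinna_integral => // v; rewrite /q natC -fmorphV /Q tr_resolvent; last exact: shift_pos.
apply: nevanlinna_sum => // i.
have [t t0 ->] := ge0_complexP (spectral_gram_ge0 (data_mx S v) i).
exact: nevanlinna_kernel.
Qed.

Lemma cvariance_normalized_tr (M : 'M[C]_n) (m : R) : 0 <= m ->
  (forall p (A : 'M[C]_(p, n)), F2 (A *m M) <= m%:C * F2 A) ->
  (forall p (A : 'M[C]_(n, p)), F2 (M *m A) <= m%:C * F2 A) ->
  cvariance mu (fun v => k%:R^-1 * \tr (Q v *m M)) <=
  k%:R ^- 2 * (32 * Lam * m * y ^+ 3 * (1 + x * y)).
Proof.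
move=> m0 Mr Ml; rewrite natC -fmorphV cvarianceZ; last exact: cbm_tr_resolvent.
have Sr p (A : 'M[C]_(p, n)) : F2 (A *m S) <= Lam%:C * F2 A by apply: F2_fcalc_r.
have Sl p (A : 'M[C]_(n, p)) : F2 (S *m A) <= Lam%:C * F2 A by apply: F2_fcalc_l.
have := cvariance_tr_resolvent S_herm z_im s_gt0 mu_rect m0 Lam0 Mr Ml Sr Sl.
move=> H; rewrite exprVn; apply: ler_wpM2l; first by rewrite invr_ge0 exprn_ge0.
apply: le_trans H _; rewrite s_var -/y -/x.
(* The factor [n] of the gradient meets the [1 / k] of [s ^+ 2]; their quotient [c] is at most 1 and
   disappears. *)
have -> : 16 * (2 * k%:R)^-1 * (4 * (Lam * (y ^+ 2 * (m * (n%:R * (y * (1 + x * y)))))))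
  = c * (32 * Lam * m * y ^+ 3 * (1 + x * y)) by rewrite /c; field; rewrite gt_eqF.
have xy0 : 0 <= 1 + x * y by rewrite addr_ge0// mulr_ge0// ltW.
rewrite ler_piMl//; last by move: nk_le kap0; rewrite -/c; lra.
by rewrite !mulr_ge0// ?exprn_ge0// ltW.
Qed.

Lemma master_error : exists eps : C,
  g = fp_map r k%:R c z g + eps /\
  normc eps <= k%:R ^- 2 * (32 * Lam * x * y ^+ 3 * (1 + x * y) * (1 + Lam ^+ 2 * y ^+ 2)).
Proof.
have [g1 g2 g3] := nevanlinna_normalized_trace.
pose dn j := fp_denom r c z g j.
have dn0 j : dn j != 0 by apply: (fp_denom_neq0 z_im r_gt0 kap0 nk_le j g1).
have cC : (n%:R / k%:R : C) = c%:C by rewrite /c rmorphM fmorphV /= -!natC.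
pose D := fcalc U (fun j => (dn j)^-1).
have DE : D *m ((1 - n%:R / k%:R - z * g) *: (S *m S) - z%:M) = 1%:M.
  by rewrite cC; exact: (fcalc_shift_inv uU S_sqr dn0).
pose M := D *m (S *m S).
pose G v := k%:R^-1 * \tr (Q v *m M).
exists (z * cintegral mu (fun v => (q v - g) * G v)); split.
  have := master_equation S_herm z_im s_gt0 mu_rect k_gt0 s_var DE.
  rewrite -/g => {1}->; congr (_ + _).
  by rewrite /fp_map fcalc_tr// fmorphV /= -natC.
have bG : cbm G := cbm_normalized_tr M.
rewrite normcM -/x.
have V1 : cvariance mu q <= k%:R ^- 2 * (32 * Lam * 1 * y ^+ 3 * (1 + x * y)).
  rewrite (_ : q = fun v => k%:R^-1 * \tr (Q v *m 1%:M)).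
    by apply: cvariance_normalized_tr => // p A; rewrite ?mulmx1 ?mul1mx mul1r.
  by apply/funext => v; rewrite mulmx1.
have ME : M = fcalc U (fun j => (r j)%:C / dn j).
  exact: (fcalc_div uU dn S_sqr).
(* The squared operator norm of [M]: the eigenvalues are at most [Lam], and the denominators at
   least [|Im z|] in modulus by the sign of [Im (z g)]. *)
have Mle j : `|(r j)%:C / dn j| ^+ 2 <= (Lam ^+ 2 * y ^+ 2)%:C.
  rewrite sqr_normrC lecR sqnM sqn_real sqnV; apply: ler_pM => //.
  - exact: sqr_ge0.
  - by rewrite invr_ge0 sqn_ge0.
  - by rewrite lerXn2r ?nnegrE// ltW.
  - rewrite /y exprVn real_normK ?num_real// lef_pV2 ?posrE ?exprn_even_gt0//; last first.
      by rewrite lt_neqAle sqn_ge0 eq_sym sqn_eq0 dn0.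
    by apply: sqn_fp_denom_ge.
have V2 : cvariance mu G <= k%:R ^- 2 * (32 * Lam * (Lam ^+ 2 * y ^+ 2) * y ^+ 3 * (1 + x * y)).
  apply: cvariance_normalized_tr.
  - by rewrite mulr_ge0 ?exprn_ge0// ltW.
  - by move=> p A; rewrite ME; apply: F2_fcalc_r.
  - by move=> p A; rewrite ME; apply: F2_fcalc_l.
have H := le_trans (cov_le mu cbm_q bG) (lerD V1 V2).
apply: le_trans (ler_wpM2l x0 H) _.
by rewrite le_eqVlt; apply/orP; left; apply/eqP; ring.
Qed.

Lemma trace_bias f : 0 <= complex.Im f / complex.Im z -> normc f <= y -> f = fp_map r k%:R c z f ->
  normc (g - f) <= k%:R ^- 2 * (32 * Lam * x * y ^+ 3 * (1 + x * y) * (1 + Lam ^+ 2 * y ^+ 2)) *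
   (4 * (1 + x ^+ 2 * y ^+ 2) / kap + 2 * y ^+ 2 * x ^+ 2 * (1 + Lam * x * y ^+ 2) / kap).
Proof.
move=> f1 f3 fE; have [eps [gE eps_le]] := master_error.
have [g1 g2 g3] := nevanlinna_normalized_trace.
apply: le_trans (fp_stability z_im kR r_gt0 kap0 c_ge0 nk_le c_nK r_le Lam0 fE gE f1 g1 g2 f3 g3) _.
apply: ler_wpM2r => //.
have p0 a b : 0 <= a -> 0 <= b -> 0 <= a * b / kap by move=> a0 b0; rewrite divr_ge0 ?mulr_ge0// ltW.
have xy n' m : 0 <= x ^+ n' * y ^+ m by rewrite mulr_ge0 ?exprn_ge0// ltW.
apply: addr_ge0; apply: p0 => //.
- by rewrite addr_ge0.
- by rewrite -mulrA mulrC -mulrA mulr_ge0//; rewrite mulrC mulr_ge0// ?exprn_ge0// ltW.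
- by rewrite addr_ge0// -mulrA mulr_ge0// ?mulr_ge0 ?exprn_ge0// ltW.
Qed.

End at_point.
End bias.

(** Separates the variables. The three factors bounded in [b1], [b2] and [b3] contribute the degrees
    2, 0 and 3 in [x], and 4, 2 and 4 in [y]; the constant [10 + 2 * Lam] sums the coefficients 4, 6
    and [2 * Lam] of the last factor. *)
Lemma bias_polynomial (R : realFieldType) (x y Lam kap : R) : 0 <= x -> 0 <= y -> 0 <= Lam -> 0 < kap ->
  32 * Lam * x * y ^+ 3 * (1 + x * y) * (1 + Lam ^+ 2 * y ^+ 2) *
   (4 * (1 + x ^+ 2 * y ^+ 2) / kap + 2 * y ^+ 2 * x ^+ 2 * (1 + Lam * x * y ^+ 2) / kap)
  <= 32 * Lam * (1 + Lam ^+ 2) * (10 + 2 * Lam) / kap * (1 + x) ^+ 5 * (1 + y) ^+ 10.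
Proof.
move=> x0 y0 L0 k0.
have X i j : (i <= j)%N -> x ^+ i <= (1 + x) ^+ j.
  move=> ij; apply: (@le_trans _ _ ((1 + x) ^+ i)).
    by rewrite lerXn2r ?nnegrE ?addr_ge0// lerDr.
  by apply: ler_weXn2l => //; rewrite lerDl.
have Y i j : (i <= j)%N -> y ^+ i <= (1 + y) ^+ j.
  move=> ij; apply: (@le_trans _ _ ((1 + y) ^+ i)).
    by rewrite lerXn2r ?nnegrE ?addr_ge0// lerDr.
  by apply: ler_weXn2l => //; rewrite lerDl.
have X0 j : 0 <= (1 + x) ^+ j by rewrite exprn_ge0// addr_ge0.
have Y0 j : 0 <= (1 + y) ^+ j by rewrite exprn_ge0// addr_ge0.
have XY i j i' j' : (i <= i')%N -> (j <= j')%N -> x ^+ i * y ^+ j <= (1 + x) ^+ i' * (1 + y) ^+ j'.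
  by move=> ii jj; apply: ler_pM; rewrite ?exprn_ge0 ?X ?Y.
have b1 : x * y ^+ 3 * (1 + x * y) <= (1 + x) ^+ 2 * (1 + y) ^+ 4.
  have -> : (1 + x) ^+ 2 * (1 + y) ^+ 4 = ((1 + x) ^+ 1 * (1 + y) ^+ 3) * (1 + (x + y + x * y)) by ring.
  apply: ler_pM.
  - by rewrite mulr_ge0// exprn_ge0.
  - by rewrite addr_ge0// mulr_ge0.
  - by rewrite -{1}(expr1 x); apply: XY.
  - by rewrite lerD2l lerDr addr_ge0.
have b2 : 1 + Lam ^+ 2 * y ^+ 2 <= (1 + Lam ^+ 2) * (1 + y) ^+ 2.
  rewrite mulrDl mul1r; apply: lerD; first by rewrite exprn_ege1// lerDl.
  by rewrite ler_wpM2l ?exprn_ge0// Y.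
have b3 : 4 * (1 + x ^+ 2 * y ^+ 2) + 2 * y ^+ 2 * x ^+ 2 * (1 + Lam * x * y ^+ 2) <= (10 + 2 * Lam) * ((1 + x) ^+ 3 * (1 + y) ^+ 4).
  have h1 := XY 0 0 3 4 isT isT; have h2 := XY 2 2 3 4 isT isT.
  have h3 := ler_wpM2l L0 (XY 3 4 3 4 isT isT).
  rewrite (_ : 4 * _ + _ = 4 * (x ^+ 0 * y ^+ 0) + 6 * (x ^+ 2 * y ^+ 2) + 2 * (Lam * (x ^+ 3 * y ^+ 4))); last by ring.
  move: h1 h2 h3; set t := (1 + x) ^+ 3 * _; move: (x ^+ 0 * _) (x ^+ 2 * _) (Lam * (x ^+ 3 * _)) => a b d.
  have -> : (10 + 2 * Lam) * t = 10 * t + 2 * (Lam * t) by ring.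
  by clearbody t; move: (Lam * t) => e; lra.
have -> : 32 * Lam * x * y ^+ 3 * (1 + x * y) * (1 + Lam ^+ 2 * y ^+ 2) *
   (4 * (1 + x ^+ 2 * y ^+ 2) / kap + 2 * y ^+ 2 * x ^+ 2 * (1 + Lam * x * y ^+ 2) / kap) =
  32 * Lam / kap * ((x * y ^+ 3 * (1 + x * y)) * ((1 + Lam ^+ 2 * y ^+ 2) *
   (4 * (1 + x ^+ 2 * y ^+ 2) + 2 * y ^+ 2 * x ^+ 2 * (1 + Lam * x * y ^+ 2)))).
  by field; rewrite gt_eqF.
have -> : 32 * Lam * (1 + Lam ^+ 2) * (10 + 2 * Lam) / kap * (1 + x) ^+ 5 * (1 + y) ^+ 10 =
  32 * Lam / kap * (((1 + x) ^+ 2 * (1 + y) ^+ 4) * (((1 + Lam ^+ 2) * (1 + y) ^+ 2) *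
     ((10 + 2 * Lam) * ((1 + x) ^+ 3 * (1 + y) ^+ 4)))).
  by field; rewrite gt_eqF.
apply: ler_wpM2l; first by rewrite divr_ge0 ?mulr_ge0// ltW.
have p1 : 0 <= 1 + x * y by rewrite addr_ge0// mulr_ge0.
have p2 : 0 <= 1 + Lam ^+ 2 * y ^+ 2 by rewrite addr_ge0// mulr_ge0// exprn_ge0.
have p3 : 0 <= 4 * (1 + x ^+ 2 * y ^+ 2) + 2 * y ^+ 2 * x ^+ 2 * (1 + Lam * x * y ^+ 2).
  by rewrite addr_ge0// ?mulr_ge0// ?addr_ge0// ?mulr_ge0// ?exprn_ge0.
apply: ler_pM => //; first by rewrite !mulr_ge0// exprn_ge0.
  exact: mulr_ge0.
exact: ler_pM.
Qed.

(** * Conclusion *)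

Lemma cintegral_vec_rv (R : realType) (d : measure_display) (T : measurableType d)
  (P : probability T R) (E : finType) (xi : E -> T -> R)
  (mxi : forall e, measurable_fun setT (xi e)) (G : vecspace R E -> R[i]) : cbm G ->
  cintegral P (fun w => G (fun e => xi e w)) = cintegral (distribution P (vec_rv mxi)) G.
Proof.
move=> [bR bI]; apply: complexP => /=.
  exact: (Rintegral_vec_rv P mxi bR).
exact: (Rintegral_vec_rv P mxi bI).
Qed.

Section empirical_distribution.
Context {R : realType}.
Local Notation C := R[i].
Variables (n k : nat) (S : 'M[C]_n).
Local Notation V := (vecspace R ('I_n * 'I_k * bool)%type).
Let H (v : V) : 'M[C]_n := data_mx S v *m (data_mx S v)^t*.

Definition esd (v : V) (z : C) : C := esd_stieltjes (H v) z.

Definition esd_deriv (v : V) (z : C) : C :=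
  n%:R^-1 * \sum_i (spectral_diag (H v) 0 i - z)^-1 ^+ 2.

Lemma esd_tr v z : complex.Im z != 0 -> esd v z = n%:R^-1 * \tr (resolvent (H v) z).
Proof. by move=> z_im; rewrite /esd /esd_stieltjes /H tr_resolvent//; exact: shift_pos. Qed.

Lemma esd_deriv_tr v z : complex.Im z != 0 ->
  esd_deriv v z = n%:R^-1 * \tr (resolvent (H v) z *m resolvent (H v) z).
Proof. by move=> z_im; rewrite /esd_deriv /H tr_resolvent_sqr//; exact: shift_pos. Qed.

Lemma cbm_esd z : complex.Im z != 0 -> cbm (fun v => esd v z).
Proof.
move=> z_im; rewrite (_ : (fun v => _) = fun v => n%:R^-1 * \tr (resolvent (H v) z)).
  by apply: cbmZ; apply: cbm_tr; exact: mcbm_resolvent.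
by apply/funext => v; exact: esd_tr.
Qed.

Lemma cbm_esd_deriv z : complex.Im z != 0 -> cbm (fun v => esd_deriv v z).
Proof.
move=> z_im; rewrite (_ : (fun v => _) = fun v => n%:R^-1 * \tr (resolvent (H v) z *m resolvent (H v) z)).
  by apply: cbmZ; apply: cbm_tr; apply: mcbmM; exact: mcbm_resolvent.
by apply/funext => v; exact: esd_deriv_tr.
Qed.

Lemma spectral_gram_real v : exists sg : 'I_n -> R, forall i, spectral_diag (H v) 0 i = (sg i)%:C.
Proof.
exists (fun i => complex.Re (spectral_diag (H v) 0 i)) => i.
by have [t _ ->] := ge0_complexP (spectral_gram_ge0 (data_mx S v) i).
Qed.

Lemma resolvent_average_esd v z : (0 < n)%N -> resolvent_average (esd v) (esd_deriv v z) z.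
Proof.
move=> n0; have [sg sgE] := spectral_gram_real v.
have -> : esd v = fun u => n%:R^-1 * \sum_i ((sg i)%:C - u)^-1.
  by apply/funext => u; rewrite /esd /esd_stieltjes; congr (_ * _); apply: eq_bigr => i _; rewrite sgE.
have -> : esd_deriv v z = n%:R^-1 * \sum_i ((sg i)%:C - z)^-1 ^+ 2.
  by rewrite /esd_deriv; congr (_ * _); apply: eq_bigr => i _; rewrite sgE.
exact: resolvent_average_mean.
Qed.

End empirical_distribution.

Lemma psd_sqrt_fcalc (R : realType) n (A : 'M[R[i]]_n) (r : 'I_n -> R) :
  (forall j, spectral_diag A 0 j = (r j)%:C) ->
  psd_sqrtmx A = fcalc (spectralmx A) (fun j => sqrtC (r j)%:C).
Proof.
move=> rE; rewrite /psd_sqrtmx spectral_fcalc_sqrt; apply: eq_fcalc => j.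
by rewrite rE.
Qed.

(** [c0] is a lower bound for [n / k]; dividing by it changes the normalization of the trace from
    [k] to [n]. *)
Definition bias_constant (R : realFieldType) (Lam kap c0 : R) : R :=
  32 * Lam * (1 + Lam ^+ 2) * (10 + 2 * Lam) / kap / c0.

Lemma bias_constant_ge0 (R : realFieldType) (Lam kap c0 : R) :
  0 <= Lam -> 0 < kap -> 0 < c0 -> 0 <= bias_constant Lam kap c0.
Proof.
move=> L0 k0 c0_gt0; apply: divr_ge0 (ltW c0_gt0); apply: divr_ge0 (ltW k0).
by rewrite !mulr_ge0// ?addr_ge0 ?exprn_ge0// mulr_ge0.
Qed.

Section sample_covariance.
Context {R : realType}.
Local Notation C := R[i].
Variables (L n k : nat) (A : 'M[C]_n) (lam : 'I_L -> R) (mult : 'I_L -> nat)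
  (F : probability (measurableTypeR R) R) (Lam kap c0 : R).
Hypothesis A_spec : has_spectrum A lam mult.
Hypothesis F_eq : is_deterministic_equivalent n k lam mult F.
Hypothesis lam_gt0 : forall i, 0 < lam i.
Hypothesis lam_le : forall i, lam i <= Lam.
Hypothesis Lam0 : 0 <= Lam.
Hypothesis kap0 : 0 < kap.
Hypothesis c0_gt0 : 0 < c0.
Hypothesis k_gt0 : (0 < k)%N.
Hypothesis nk_ge : c0 <= n%:R / k%:R.
Hypothesis nk_le : n%:R / k%:R <= 1 - kap.
Local Notation E := ('I_n * 'I_k * bool)%type.
Local Notation V := (vecspace R E).
Variables (s : R) (mu : probability V R).
Hypothesis s_gt0 : 0 < s.
Hypothesis s_var : s ^+ 2 = (2 * k%:R)^-1.
Hypothesis mu_rect : forall B : E -> set R, (forall e, measurable (B e)) ->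
  mu (rect_set B) = (\prod_e normal_prob 0 s (B e))%E.

Let S := psd_sqrtmx A.
Let kR : 0 < k%:R :> R. Proof. by rewrite ltr0n. Qed.
Let n_gt0 : (0 < n)%N.
Proof.
rewrite lt0n; apply/eqP => n0; have := lt_le_trans c0_gt0 nk_ge.
by rewrite n0 mul0r ltxx.
Qed.
Let natC (m : nat) : (m%:R : C) = (m%:R : R)%:C. Proof. by rewrite rmorph_nat. Qed.

Lemma nevanlinna_stieltjes z : complex.Im z != 0 ->
  0 <= complex.Im (stieltjes F z) / complex.Im z /\ normc (stieltjes F z) <= `|complex.Im z|^-1.
Proof.
move=> z_im; split; last first.
  by apply: normc_cintegral_le; [exact: cbm_kernel|rewrite invr_ge0|move=> t; exact: normc_shiftV].
have := @cintegral_Im_div_ge0 R _ _ F 1 (complex.Im z) _ (cbm_kernel z_im).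
rewrite mul1r; apply => t; rewrite mul1r; exact: Im_kernel_div_ge0.
Qed.

Lemma esd_bias z : complex.Im z != 0 ->
  normc (cintegral mu (fun v => esd S v z) - stieltjes F z) <=
  k%:R ^- 2 * (bias_constant Lam kap c0 * (1 + normc z) ^+ 5 * (1 + `|complex.Im z|^-1) ^+ 10).
Proof.
move=> z_im.
have [r [rE r_lam r_sum]] := has_spectrumP A_spec.
have r_gt0 j : 0 < r j by have [i ->] := r_lam j.
have r_le j : r j <= Lam by have [i ->] := r_lam j.
have SE : S = fcalc (spectralmx A) (fun j => sqrtC (r j)%:C) := psd_sqrt_fcalc rE.
set b := stieltjes F z; have [b1 b2] := nevanlinna_stieltjes z_im; rewrite -/b in b1 b2.
set c : R := n%:R / k%:R.
have c_gt0 : 0 < c by exact: lt_le_trans nk_ge.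
have c_le1 : c <= 1 by apply: le_trans nk_le _; rewrite gerBl ltW.
have cC : (n%:R / k%:R : C) = c%:C by rewrite /c rmorphM fmorphV /= -!natC.
have nC : (n%:R : C) != 0 by rewrite pnatr_eq0 -lt0n.
have kC : (k%:R : C) != 0 by rewrite pnatr_eq0 -lt0n.
pose f := c%:C * b.
have f1 : 0 <= complex.Im f / complex.Im z.
  by rewrite /f Im_mul /= mul0r addr0 -mulrA mulr_ge0// ltW.
have f2 : normc f <= `|complex.Im z|^-1.
  rewrite /f normcM normc_real gtr0_norm//; apply: le_trans b2.
  by rewrite ler_piMl// normc_ge0.
have fE : f = fp_map r k%:R c z f.
  have rs : \sum_i (mult i)%:R * ((lam i)%:C * (1 - c%:C - c%:C * z * b) - z)^-1 =
      \sum_j ((r j)%:C * (1 - c%:C - c%:C * z * b) - z)^-1.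
    exact: (r_sum (fun l => (l * (1 - c%:C - c%:C * z * b) - z)^-1)).
  have bE : b = n%:R^-1 * \sum_(i < L) (mult i)%:R *
      ((lam i)%:C * (1 - n%:R / k%:R - n%:R / k%:R * z * b) - z)^-1 := F_eq z_im.
  rewrite cC rs in bE.
  rewrite {1}/f {1}bE /fp_map mulrA; congr (_ * _).
    by rewrite -cC fmorphV /= -natC; field; rewrite nC kC.
  apply: eq_bigr => j _; rewrite /fp_denom /f; congr ((_ - _)^-1).
  by rewrite mulrC; congr ((_ - _) * _); rewrite mulrCA mulrA.
have := trace_bias (spectral_unitarymx A) k_gt0 r_gt0 r_le Lam0 kap0 nk_le s_gt0 s_var mu_rect z_im f1 f2 fE.
rewrite -SE; set g := cintegral mu _ => H.
(* [esd] is a trace divided by [n] and [g] the mean of a trace divided by [k], so the two differ by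
   the factor [c], exactly as [b] and [f] do. *)
have gE : cintegral mu (fun v => esd S v z) = c^-1%:C * g.
  rewrite /g -cintegralZ; last by apply: cbmZ; apply: cbm_tr; exact: mcbm_resolvent.
  apply: eq_cintegral => v; rewrite esd_tr// mulrA; congr (_ * _).
  by rewrite fmorphV /= -cC; field; rewrite nC kC.
have -> : cintegral mu (fun v => esd S v z) - b = c^-1%:C * (g - f).
  rewrite gE mulrBr /f mulrA -rmorphM mulVf ?gt_eqF//.
  by rewrite rmorph1 mul1r.
rewrite normcM normc_real gtr0_norm ?invr_gt0//.
have xy := bias_polynomial (normc_ge0 z) (_ : 0 <= `|complex.Im z|^-1) Lam0 kap0.
rewrite -mulrA in H; have {}H := le_trans H (ler_wpM2l _ (xy _)).
have kk : 0 <= k%:R ^- 2 :> R by rewrite invr_ge0 exprn_ge0.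
have y0 : 0 <= `|complex.Im z|^-1 by rewrite invr_ge0.
apply: le_trans (ler_wpM2l _ (H kk y0)) _; first by rewrite invr_ge0 ltW.
set M := 32 * Lam * (1 + Lam ^+ 2) * (10 + 2 * Lam) / kap; set X := (1 + normc z) ^+ 5; set Y := (_ + _) ^+ 10.
have -> : bias_constant Lam kap c0 = M / c0 by [].
have -> : k%:R ^- 2 * (M / c0 * X * Y) = c0^-1 * (k%:R ^- 2 * (M * X * Y)) by ring.
apply: ler_wpM2r; last by rewrite lef_pV2.
have X0 : 0 <= X by rewrite exprn_ge0// addr_ge0// normc_ge0.
have Y0 : 0 <= Y by rewrite exprn_ge0// addr_ge0.
have M0 : 0 <= M by apply: divr_ge0 (ltW kap0); rewrite !mulr_ge0// ?addr_ge0 ?exprn_ge0// mulr_ge0.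
by rewrite mulr_ge0// mulr_ge0// mulr_ge0.
Qed.

Lemma esd_deriv_bias z : complex.Im z != 0 ->
  normc (cintegral mu (fun v => complex_derive (esd S v) z) - complex_derive (stieltjes F) z) <=
  k%:R ^- 2 * (2 ^+ 16 * bias_constant Lam kap c0 * (1 + normc z) ^+ 5 * (1 + `|complex.Im z|^-1) ^+ 11).
Proof.
move=> z_im.
have aF := resolvent_average_stieltjes F z_im.
rewrite (complex_derive_average z_im aF).
have aS (v : V) : resolvent_average (esd S v) (esd_deriv S v z) z by exact: resolvent_average_esd.
have -> : cintegral mu (fun v => complex_derive (esd S v) z) = cintegral mu (fun v => esd_deriv S v z).
  by apply: eq_cintegral => v; exact: complex_derive_average.
have aE := @resolvent_average_integral R z _ V mu (fun u v => esd S v u) (fun v => esd_deriv S v z)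
  (fun u hu => cbm_esd k S hu) (cbm_esd_deriv k S z_im) aS.
set x := normc z; set y := `|complex.Im z|^-1.
have x0 : 0 <= x by exact: normc_ge0.
have y0 : 0 <= y by rewrite invr_ge0.
have C0 : 0 <= bias_constant Lam kap c0 by exact: bias_constant_ge0.
(* On the circle of radius [|Im z| / 2] both [1 + |z|] and [1 + 1 / |Im z|] at most double, which
   gives [2 ^+ 5] and [2 ^+ 10]. The factor [2 * y] of Cauchy's estimate completes [2 ^+ 16] and
   raises the degree in [y] to 11. *)
pose B := k%:R ^- 2 * (bias_constant Lam kap c0 * (2 * (1 + x)) ^+ 5 * (2 * (1 + y)) ^+ 10).
have kk : 0 <= k%:R ^- 2 :> R by rewrite invr_ge0 exprn_ge0.
apply: le_trans (resolvent_average_cauchy (B := B) z_im aE aF _) _.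
  move=> h hz; have hz' : normc h <= `|complex.Im z| / 2 by rewrite hz.
  have [zh1 zh2] := Im_shift_half z_im hz'.
  apply: le_trans (esd_bias zh1) _.
  apply: ler_wpM2l => //; apply: ler_pM.
  - by rewrite mulr_ge0// exprn_ge0// addr_ge0// normc_ge0.
  - by rewrite exprn_ge0// addr_ge0// invr_ge0.
  - apply: ler_wpM2l => //; rewrite lerXn2r ?nnegrE ?addr_ge0 ?normc_ge0 ?mulr_ge0 ?addr_ge0//.
    have := normcD z h; have := Im_le_normc z; rewrite -/x hz.
    by move: x0; move: (`|complex.Im z|) (normc (z + h)) => a b; lra.
  - rewrite lerXn2r ?nnegrE ?addr_ge0 ?invr_ge0 ?mulr_ge0 ?addr_ge0//.
    by move: zh2 y0; rewrite -/y; move: (`|complex.Im (z + h)|^-1) => a; lra.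
have -> : 2 * y * B = k%:R ^- 2 * (2 ^+ 16 * bias_constant Lam kap c0 * (1 + x) ^+ 5 * ((1 + y) ^+ 10 * y)).
  by rewrite /B; ring.
apply: ler_wpM2l => //; apply: ler_wpM2l.
  by apply: mulr_ge0; [apply: mulr_ge0 => //; exact: exprn_ge0|rewrite exprn_ge0// addr_ge0].
by rewrite [leRHS]exprSr ler_wpM2l ?exprn_ge0 ?addr_ge0// lerDr.
Qed.

End sample_covariance.

(** For [a > 0] all coefficients up to degree [m] are positive, and values at nonnegative points
    increase with [m]; a bound with smaller exponents can thus be raised to the exact degree
    demanded. *)
Definition binomial_poly (R : realType) (a : R) (m : nat) : {poly R} := a *: ('X + 1%:P) ^+ m.

Lemma binomial_polyE (R : realType) (a : R) m (x : R) :
  (binomial_poly a m).[x] = a * (1 + x) ^+ m.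
Proof. by rewrite /binomial_poly !hornerE addrC. Qed.

Lemma nonneg_binomial_poly (R : realType) (a : R) m : 0 < a -> nonneg_poly m (binomial_poly a m).
Proof.
move=> a0; split.
  rewrite /binomial_poly size_scale ?gt_eqF//.
  by rewrite (_ : 1%:P = - (-1)%:P) ?size_exp_XsubC// polyCN opprK.
have : binomial_poly a m \is a polyOver Num.nneg.
  apply: polyOverZ; first by rewrite nnegrE ltW.
  by apply: rpredX; apply: rpredD; [exact: polyOverX|rewrite polyOverC nnegrE].
by move=> /polyOverP H i; have := H i; rewrite nnegrE.
Qed.

Theorem theorem3 (R : realType) (d : measure_display) (T : measurableType d)
    (P : probability T R) (L : nat) (N : nat -> nat)
    (RN : forall K : nat, 'M[R[i]]_(N K)) (lam : nat -> 'I_L -> R)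
    (mult : nat -> 'I_L -> nat) (X : forall K : nat, T -> 'M[R[i]]_(N K, K))
    (F : nat -> probability (measurableTypeR R) R)
    (hA1 : assumption_A1 RN lam mult)
    (hA2 : assumption_A2 R N mult)
    (hA3 : assumption_A3 P X)
    (hF : \forall K \near \oo,
      is_deterministic_equivalent (N K) K (lam K) (mult K) (F K)) :
  let bhat K (w : T) := esd_stieltjes (sample_cov (RN K) (X K w)) in
  let b K := stieltjes (F K) in
  exists P9 P12 P15 P20 : {poly R},
    [/\ nonneg_poly 9 P9, nonneg_poly 12 P12,
        nonneg_poly 15 P15 & nonneg_poly 20 P20] /\
    \forall K \near \oo, forall z : R[i], complex.Im z != 0 ->
      normc (cintegral P (fun w => bhat K w z) - b K z)
        <= K%:R ^- 2 * P9.[normc z] * P12.[`|complex.Im z|^-1] /\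
      normc (cintegral P (fun w => complex_derive (bhat K w) z)
             - complex_derive (b K) z)
        <= K%:R ^- 2 * P15.[normc z] * P20.[`|complex.Im z|^-1].
Proof.
move=> bhat b.
have [[cl [/andP[cl0 cl1] ncv]] _] := hA2.
have [hspec [lmin [lmax [lmin0 hlam]]]] := hA1.
(* The limit ratio lies strictly between 0 and 1. Half its distance to each end leaves room for
   [N / K] to stay in between for large [K]. The absolute value makes [Lam] nonnegative even when
   there is no eigenvalue to compare with. *)
pose kap : R := (1 - cl) / 2; pose c0 : R := cl / 2; pose Lam : R := `|lmax|.
have kap0 : 0 < kap by rewrite divr_gt0 ?subr_gt0.
have c0_gt0 : 0 < c0 by rewrite divr_gt0.
have Lam0 : 0 <= Lam := normr_ge0 _.
(* Adding 1 makes the leading coefficients positive, so that the degrees are exact. *)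
pose C1 := bias_constant Lam kap c0 + 1.
have C0 : 0 <= bias_constant Lam kap c0 by exact: bias_constant_ge0.
have C1_gt0 : 0 < C1 by rewrite ltr_wpDl.
have C1_ge : bias_constant Lam kap c0 <= C1 by rewrite lerDl.
(* Each constant is carried by the polynomial in [|z|]. The exponents 5 and 10, and 5 and 11 for the
   derivatives, are raised to the prescribed ones because both bases are at least 1. *)
exists (binomial_poly C1 9), (binomial_poly 1 12), (binomial_poly (2 ^+ 16 * C1) 15), (binomial_poly 1 20).
split; first by split; apply: nonneg_binomial_poly; rewrite ?mulr_gt0 ?exprn_gt0.
have nk_ge : \forall K \near \oo, c0 <= (N K)%:R / K%:R.
  by apply: (cvgr_ge _ ncv); rewrite /c0; move: cl0; lra.
have nk_le : \forall K \near \oo, (N K)%:R / K%:R <= 1 - kap.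
  by apply: (cvgr_le _ ncv); rewrite /kap; move: cl1; lra.
near=> K => z z_im.
have k_gt0 : (0 < K)%N by near: K; exact: nbhs_infty_gt.
have hnk1 : c0 <= (N K)%:R / K%:R by near: K.
have hnk2 : (N K)%:R / K%:R <= 1 - kap by near: K.
have hsp : has_spectrum (RN K) (lam K) (mult K) by near: K.
have hl : forall i, lmin < lam K i < lmax by near: K.
have hFK : is_deterministic_equivalent (N K) K (lam K) (mult K) (F K) by near: K.
have lam_gt0 i : 0 < lam K i by have /andP[h _] := hl i; exact: lt_trans h.
have lam_le i : lam K i <= Lam.
  by have /andP[_ h] := hl i; apply: le_trans (ltW h) (ler_norm _).
pose s : R := Num.sqrt (K%:R^-1 / 2).
have K0 : 0 < K%:R :> R by rewrite ltr0n.
have s_gt0 : 0 < s by rewrite sqrtr_gt0 divr_gt0 ?invr_gt0.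
have s_var : s ^+ 2 = (2 * K%:R)^-1.
  by rewrite sqr_sqrtr ?divr_ge0 ?invr_ge0// invfM mulrC.
pose part (e : 'I_(N K) * 'I_K * bool) (w : T) : R :=
  if e.2 then complex.Im (X K w e.1.1 e.1.2) else complex.Re (X K w e.1.1 e.1.2).
have [mpart lawpart indpart] := hA3 K.
have mu_rect := distribution_rect (xi := part) mpart lawpart indpart.
set mu := distribution P _ in mu_rect.
pose S := psd_sqrtmx (RN K).
(* The empirical transform depends on the outcome only through the real coordinates of [X K], so
   expectations can be computed under their joint law [mu]. *)
have bhatE w : bhat K w = esd S (fun e => part e w).
  apply/funext => u; rewrite /bhat /sample_cov /esd /data_mx.
  suff -> : entries_mx (fun e => part e w) = X K w by [].
  by apply/matrixP => i j; rewrite mxE /part /=; case: (X K w i j).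
have E1 : cintegral P (fun w => bhat K w z) = cintegral mu (fun v => esd S v z).
  rewrite -(cintegral_vec_rv P mpart); last exact: cbm_esd.
  by apply: eq_cintegral => w; rewrite bhatE.
have aS (v : vecspace R ('I_(N K) * 'I_K * bool)%type) : resolvent_average (esd S v) (esd_deriv S v z) z.
  apply: resolvent_average_esd; rewrite lt0n; apply/eqP => n0.
  by have := lt_le_trans c0_gt0 hnk1; rewrite n0 mul0r ltxx.
have E2 : cintegral P (fun w => complex_derive (bhat K w) z) =
    cintegral mu (fun v => complex_derive (esd S v) z).
  have D (v : vecspace R ('I_(N K) * 'I_K * bool)%type) : complex_derive (esd S v) z = esd_deriv S v z by exact: complex_derive_average.
  rewrite [RHS](eq_cintegral mu D) -(cintegral_vec_rv P mpart); last exact: cbm_esd_deriv.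
  by apply: eq_cintegral => w; rewrite bhatE D.
rewrite E1 E2 !binomial_polyE !mul1r.
have x1 : 1 <= 1 + normc z by rewrite lerDl normc_ge0.
have y1 : 1 <= 1 + `|complex.Im z|^-1 by rewrite lerDl invr_ge0.
have kk : 0 <= K%:R ^- 2 :> R by rewrite invr_ge0 exprn_ge0.
have step (a a' : R) i j i' j' : 0 <= a -> a <= a' -> (i <= i')%N -> (j <= j')%N ->
    K%:R ^- 2 * (a * (1 + normc z) ^+ i * (1 + `|complex.Im z|^-1) ^+ j) <=
    K%:R ^- 2 * (a' * (1 + normc z) ^+ i') * (1 + `|complex.Im z|^-1) ^+ j'.
  move=> a0 aa' ii jj; rewrite -[leRHS]mulrA; apply: ler_wpM2l => //.
  have px m : 0 <= (1 + normc z) ^+ m by rewrite exprn_ge0// (le_trans ler01).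
  have py m : 0 <= (1 + `|complex.Im z|^-1) ^+ m by rewrite exprn_ge0// (le_trans ler01).
  apply: ler_pM => //; first exact: mulr_ge0.
    by apply: ler_pM => //; exact: ler_weXn2l.
  exact: ler_weXn2l.
split.
  apply: le_trans (esd_bias hsp hFK lam_gt0 lam_le Lam0 kap0 c0_gt0 k_gt0 hnk1 hnk2 s_gt0 s_var mu_rect z_im) _.
  exact: step.
apply: le_trans (esd_deriv_bias hsp hFK lam_gt0 lam_le Lam0 kap0 c0_gt0 k_gt0 hnk1 hnk2 s_gt0 s_var mu_rect z_im) _.
apply: step => //.
  by rewrite mulr_ge0// exprn_ge0.
by apply: ler_wpM2l => //; rewrite exprn_ge0.
Unshelve. all: by end_near. Qed.
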